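(* Let $s\in(0,1)$, let $\Omega\subset\mathbb{R}^N$ be a bounded domain with $C^{1,1}$ boundary, and let $w_1$ be a positive eigenfunction of $(-\Delta)^s$ associated to $\lambda_1(s,2)$. Consider, for $\lambda\in\mathbb{R}$, the problem $$(P)\qquad\begin{cases}(-\Delta)^s u=\lambda u+f(x)&\text{in }\Omega,\\ u=0&\text{in }\Omega^c:=\mathbb{R}^N\setminus\Omega.\end{cases}$$ For any $f\in L^\infty(\Omega)$ with $\int_\Omega f(x)w_1\,dx\neq0$ there is $\delta=\delta(f)>0$ such that: (1) if $\int_\Omega f(x)w_1\,dx>0$, then any weak solution $u$ of $(P)$ satisfies (a) $u<0$ in $\Omega$ if $\lambda\in(\lambda_1(s,2),\lambda_1(s,2)+\delta)$; (b) $u>0$ in $\Omega$ if $\lambda\in(\lambda_1(s,2)-\delta,\lambda_1(s,2))$; (2) if $\int_\Omega f(x)w_1\,dx<0$, then any weak solution $u$ of $(P)$ satisfies (a) $u>0$ in $\Omega$ if $\lambda\in(\lambda_1(s,2),\lambda_1(s,2)+\delta)$; (b) $u<0$ in $\Omega$ if $\lambda\in(\lambda_1(s,2)-\delta,\lambda_1(s,2))$.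
   Context: Constant: $\mathcal{K}=2(1-s)\left(\int_{S^{N-1}}|\langle\omega,e\rangle|^2\,d\mathcal{H}^{N-1}(\omega)\right)^{-1}$ for any $e\in S^{N-1}$. Here $(-\Delta)^su(x)=2\mathcal{K}\,\mathrm{P.V.}\int_{\mathbb{R}^N}\frac{u(x)-u(y)}{|x-y|^{N+2s}}dy$ (the case $p=2$ of the fractional $p$-Laplacian $(-\Delta_p)^s$, with this normalization). Spaces: for an open set $A$, $W^{s,2}(A)$ is the set of $u\in L^2(A)$ with $|u|_{W^{s,2}(A)}^2:=\int_{A^2}\frac{|u(x)-u(y)|^2}{|x-y|^{N+2s}}dxdy<\infty$. $\widetilde{W}^{s,2}(\Omega)$ is the space of $u\in W^{s,2}(\Omega)$ whose extension by zero belongs to $W^{s,2}(\mathbb{R}^N)$ (functions are identified with their zero extension). $\widehat{W}^{s,2}(\Omega)$ is the set of $u\in L^2_{loc}(\mathbb{R}^N)$ such that $u\in W^{s,2}(U)$ for some open $U\supset\supset\Omega$ and $\int_{\mathbb{R}^N}\frac{|u(x)|}{(1+|x|)^{N+2s}}dx<\infty$. Weak solutions: $u\in\widehat{W}^{s,2}(\Omega)$ is a weak solution of $(P)$ if $u=0$ a.e. in $\Omega^c$ and, for every $v\in\widetilde{W}^{s,2}(\Omega)$, $$\mathcal{K}\int_{\mathbb{R}^{2N}}\frac{(u(x)-u(y))(v(x)-v(y))}{|x-y|^{N+2s}}dxdy=\lambda\int_\Omega uv\,dx+\int_\Omega fv\,dx.$$ (Weak solutions with $f\in L^\infty(\Omega)$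 are identified with their continuous representatives on $\overline\Omega$.) First eigenvalue: $\lambda_1(s,2)=\inf\{\mathcal{K}|u|_{W^{s,2}(\mathbb{R}^N)}^2: u\in\widetilde{W}^{s,2}(\Omega),\ \|u\|_{L^2(\Omega)}=1\}$. An eigenfunction associated to $\lambda_1(s,2)$ is a function $w\in\widetilde{W}^{s,2}(\Omega)\setminus\{0\}$ such that, for all $v\in\widetilde{W}^{s,2}(\Omega)$, $$\mathcal{K}\int_{\mathbb{R}^{2N}}\frac{(w(x)-w(y))(v(x)-v(y))}{|x-y|^{N+2s}}dxdy=\lambda_1(s,2)\int_\Omega wv\,dx.$$ *)

(* Defs.v *)
(* R^N, with N = n.+1 >= 1, is 'rV[R]_n.+1.  Its library
   norm is the sup norm; the topology, compactness and boundedness do not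
   depend on this, but wherever the geometry matters the Euclidean norm enorm
   is used. *)
From HB Require Import structures.
From mathcomp Require Import all_boot all_order all_algebra.
From mathcomp Require Import all_classical all_reals all_analysis.

Set Implicit Arguments.
Unset Strict Implicit.
Unset Printing Implicit Defensive.

Import Order.TTheory GRing.Theory Num.Theory.
Import numFieldNormedType.Exports.

Local Open Scope classical_set_scope.
Local Open Scope ring_scope.

Section euclidean.
Context {R : realType} {n : nat}.

Definition edot (x y : 'rV[R]_n) : R := \sum_(i < n) x 0 i * y 0 i.

Definition enorm (x : 'rV[R]_n) : R := Num.sqrt (edot x x).

End euclidean.

(* Borel sigma-algebra of R^n, as the sigma-algebra generated by the
   coordinates. *)
Section measurable_rV.
Context {R : realType} {n : nat}.

Let coord (i : 'I_n) (x : 'rV[R]_n) : R := x 0 i.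

Let rV_set0 : g_sigma_preimage coord set0.
Proof. exact: sigma_algebra0. Qed.

Let rV_setC A : g_sigma_preimage coord A -> g_sigma_preimage coord (~` A).
Proof. exact: sigma_algebraC. Qed.

Let rV_bigcup (F : (set 'rV[R]_n)^nat) :
  (forall i, g_sigma_preimage coord (F i)) ->
  g_sigma_preimage coord (\bigcup_i (F i)).
Proof. exact: sigma_algebra_bigcup. Qed.

HB.instance Definition _ := @isMeasurable.Build default_measure_display
  'rV[R]_n (g_sigma_preimage coord) rV_set0 rV_setC rV_bigcup.

Lemma measurable_coord (i : 'I_n) :
  measurable_fun [set: 'rV[R]_n] (fun x : 'rV[R]_n => x 0 i).
Proof.
move=> _ Y mY; rewrite setTI; apply: sub_sigma_algebra => /=.
rewrite -bigcup_seq/=; exists i => /=; first by rewrite mem_index_enum.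
by exists Y => //; rewrite setTI.
Qed.

Lemma measurable_fun_rVP d (T : measurableType d) (f : T -> 'rV[R]_n) :
  (forall i, measurable_fun [set: T] (fun t => f t 0 i)) ->
  measurable_fun [set: T] f.
Proof.
move=> mf _ A; rewrite setTI; move: A.
apply: smallest_sub => /=.
  split=> [|A mA|F mF].
  - by rewrite preimage_set0.
  - rewrite setTD preimage_setC; exact: measurableC.
  - by rewrite preimage_bigcup; exact: bigcupT_measurable.
rewrite -bigcup_seq => A [i _ [B mB <-]]; rewrite setTI.
by have := mf i measurableT B mB; rewrite setTI.
Qed.

End measurable_rV.

Section lebesgue.
Context {R : realType}.

Definition consrV n (z : measurableTypeR R * 'rV[R]_n) : 'rV[R]_n.+1 :=
  row_mx (const_mx z.1 : 'rV_1) z.2.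

(* (x_0, x_1, ..., x_n) |-> (x_1, ..., x_n) *)
Definition behead_rV n (x : 'rV[R]_n.+1) : 'rV[R]_n :=
  \row_(i < n) x 0 (lift ord0 i).

Definition unconsrV n (x : 'rV[R]_n.+1) : measurableTypeR R * 'rV[R]_n :=
  (x 0 0, behead_rV x).

Lemma consrVK n : cancel (@consrV n) (@unconsrV n).
Proof.
move=> [a t]; congr pair.
  have -> : 0 = (lshift n (0 : 'I_1) : 'I_n.+1) by exact/val_inj.
  by rewrite [LHS](@row_mxEl _ 1 1 n) mxE.
apply/rowP => i; rewrite mxE.
have -> : lift ord0 i = (rshift 1 i : 'I_n.+1) by exact/val_inj.
by rewrite [LHS](@row_mxEr _ 1 1 n).
Qed.

Lemma measurable_consrV n : measurable_fun setT (@consrV n).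
Proof.
apply: measurable_fun_rVP => i.
have [->|i0] := eqVneq i 0.
  rewrite (_ : (fun _ => _) = fst) //.
  by apply/funext => z; have /(congr1 fst) := consrVK z.
case: (unliftP ord0 i) i0 => [j ->{i} _|->]; last by rewrite eqxx.
rewrite (_ : (fun _ => _) = (fun x : 'rV[R]_n => x 0 j) \o snd); last first.
  apply/funext => z /=; have /(congr1 snd)/rowP/(_ j) := consrVK z.
  by rewrite mxE.
by apply: measurableT_comp => //; exact: measurable_coord.
Qed.

Lemma measurable_unconsrV n : measurable_fun setT (@unconsrV n).
Proof.
apply/measurable_fun_pairP; split; first exact: (measurable_coord 0).
apply: measurable_fun_rVP => i.
rewrite (_ : (fun _ => _) = fun x : 'rV[R]_n.+1 => x 0 (lift ord0 i)).
  exact: measurable_coord.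
by apply/funext => x; rewrite /= mxE.
Qed.

Section cons_measure.
Context {n : nat} (mu : {sigma_finite_measure set 'rV[R]_n -> \bar R}).

Definition cons_measure : set 'rV[R]_n.+1 -> \bar R :=
  pushforward (@lebesgue_measure R \x mu)%E (@consrV n).

Let cons_measure0 : cons_measure set0 = 0%E.
Proof. by rewrite /cons_measure /pushforward preimage_set0 measure0. Qed.

Let cons_measure_ge0 A : (0 <= cons_measure A)%E.
Proof. by rewrite /cons_measure /pushforward measure_ge0. Qed.

Let cons_measure_sigma_additive : semi_sigma_additive cons_measure.
Proof.
move=> F mF tF mUF; rewrite /cons_measure /pushforward preimage_bigcup.
apply: measure_semi_sigma_additive.
- by move=> i; rewrite -[X in measurable X]setTI; exact: measurable_consrV.
- apply/trivIsetP => /= i j _ _ ij; rewrite -preimage_setI.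
  by move/trivIsetP : tF => /(_ _ _ _ _ ij) ->//; rewrite preimage_set0.
- rewrite -preimage_bigcup -[X in measurable X]setTI.
  exact: measurable_consrV.
Qed.

HB.instance Definition _ := isMeasure.Build _ _ _ cons_measure
  cons_measure0 cons_measure_ge0 cons_measure_sigma_additive.

Let cons_measure_sigma_finite : sigma_finite setT cons_measure.
Proof.
have /sigma_finiteP[F [TF ndF Foo]] := sigma_finiteT (@lebesgue_measure R).
have /sigma_finiteP[G [TG ndG Goo]] := sigma_finiteT mu.
exists (fun k => @unconsrV n @^-1` (F k `*` G k)).
  rewrite -preimage_bigcup (_ : \bigcup_i _ = setT) ?preimage_setT//.
  apply/seteqP; split=> // -[x y] _.
  have [k _ Fkx] : (\bigcup_i F i) x by rewrite -TF.
  have [l _ Gly] : (\bigcup_i G i) y by rewrite -TG.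
  exists (maxn k l) => //; split => /=.
    by move: x Fkx; exact/subsetPset/ndF/leq_maxl.
  by move: y Gly; exact/subsetPset/ndG/leq_maxr.
move=> k; have [mF Fk] := Foo k; have [mG Gk] := Goo k; split.
  rewrite -[X in measurable X]setTI.
  by apply: measurable_unconsrV => //; exact: measurableX.
rewrite /cons_measure /pushforward -comp_preimage.
rewrite (_ : _ \o _ = id); last by apply/funext => z /=; rewrite consrVK.
by rewrite preimage_id product_measure1E// lte_mul_pinfty// ge0_fin_numE.
Qed.

HB.instance Definition _ := Measure_isSigmaFinite.Build _ _ _ cons_measure
  cons_measure_sigma_finite.

End cons_measure.

(* The product of n copies of the one-dimensional Lebesgue measure. *)
Fixpoint lebesgue_rV n : {sigma_finite_measure set 'rV[R]_n -> \bar R} :=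
  match n with
  | 0 => @dirac _ 'rV[R]_0 0 R
  | n.+1 => cons_measure (lebesgue_rV n)
  end.

End lebesgue.

Section hausdorff.
Context {R : realType} {N : nat}.

Definition diam (C : set 'rV[R]_N) : R :=
  sup [set enorm (z.1 - z.2) | z in C `*` C].

Definition unit_ball_volume k : R :=
  fine (lebesgue_rV k [set x : 'rV[R]_k | enorm x <= 1]).

(* The test on set0 makes the zero-dimensional measure count points. *)
Definition hausdorff_gauge k (delta : R) (C : set 'rV[R]_N) : \bar R :=
  if `[< C = set0 >] then 0%E
  else if `[< forall x y, C x -> C y -> enorm (x - y) <= delta >]
  then (unit_ball_volume k * (diam C / 2) ^+ k)%:E
  else +oo%E.

(* k-dimensional Hausdorff measure, normalized to agree with the Lebesgue
   measure when k = N; mu_ext takes the infimum over countable Borel covers. *)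
Definition hausdorff k (A : set 'rV[R]_N) : \bar R :=
  ereal_sup [set mu_ext (hausdorff_gauge k delta) A | delta in [set d | 0 < d]].

Let diam_ge0 C : 0 <= diam C.
Proof.
rewrite /diam; have [[[r [z Cz zr]] hub]|/sup_out ->//] := pselect (has_sup
  [set enorm (z.1 - z.2) | z in C `*` C]).
by apply: le_trans (ub_le_sup hub _); [|exists z; last exact: zr];
  rewrite -?zr ?sqrtr_ge0.
Qed.

Let hausdorff_gauge_ge0 k delta C : (0 <= hausdorff_gauge k delta C)%E.
Proof.
rewrite /hausdorff_gauge; case: asboolP => // _; case: asboolP => // _.
by rewrite lee_fin mulr_ge0 ?fine_ge0 ?exprn_ge0 ?divr_ge0.
Qed.

Let hausdorff_gauge0 k delta : hausdorff_gauge k delta set0 = 0%E.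
Proof. by rewrite /hausdorff_gauge; case: asboolP. Qed.

Let hausdorff0 k : hausdorff k set0 = 0%E.
Proof.
apply/eqP; rewrite eq_le; apply/andP; split.
  apply: ge_ereal_sup => _ [d _ <-].
  by rewrite mu_ext0.
apply: (@le_trans _ _ (mu_ext (hausdorff_gauge k 1) set0)).
  exact: mu_ext_ge0.
by apply: ereal_sup_ubound; exists 1 => //=.
Qed.

Let hausdorff_ge0 k A : (0 <= hausdorff k A)%E.
Proof.
apply: (@le_trans _ _ (mu_ext (hausdorff_gauge k 1) A)).
  exact: mu_ext_ge0.
by apply: ereal_sup_ubound; exists 1 => //=.
Qed.

Let le_hausdorff k : {homo hausdorff k : A B / A `<=` B >-> (A <= B)%E}.
Proof.
move=> A B AB; apply: ge_ereal_sup => _ [d d0 <-].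
apply: (@le_trans _ _ (mu_ext (hausdorff_gauge k d) B)); first exact: le_mu_ext.
by apply: ereal_sup_ubound; exists d.
Qed.

Let hausdorff_sigma_subadditive k : sigma_subadditive (hausdorff k).
Proof.
move=> F; apply: ge_ereal_sup => _ [d d0 <-].
apply: le_trans (mu_ext_sigma_subadditive (hausdorff_gauge_ge0 k d) F) _.
apply: lee_nneseries => [i _ _|i _]; first exact: mu_ext_ge0.
by apply: ereal_sup_ubound; exists d.
Qed.

HB.instance Definition _ k := isOuterMeasure.Build R 'rV[R]_N (hausdorff k)
  (hausdorff0 k) (hausdorff_ge0 k) (@le_hausdorff k)
  (@hausdorff_sigma_subadditive k).

Definition hausdorff_outer k : {outer_measure set 'rV[R]_N -> \bar R} :=
  hausdorff k.
Definition hausdorff_measure k :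
    {measure set (caratheodory_type (hausdorff_outer k)) -> \bar R} :=
  (hausdorff_outer k : set (caratheodory_type (hausdorff_outer k)) -> \bar R).

End hausdorff.

Section domain.
Context {R : realType} {n : nat}.

Definition bounded_domain (Omega : set 'rV[R]_n.+1) : Prop :=
  [/\ open Omega, connected Omega, Omega !=set0 & bounded_set Omega].

Definition gradient (gamma : 'rV[R]_n -> R) (x : 'rV[R]_n) : 'rV[R]_n :=
  \row_(i < n) 'D_(delta_mx 0 i) gamma x.

Definition C11 (gamma : 'rV[R]_n -> R) : Prop :=
  (forall x, differentiable gamma x) /\
  exists L : R, forall x y,
    enorm (gradient gamma x - gradient gamma y) <= L * enorm (x - y).

(* Near each boundary point, after the orthogonal change of coordinates
   y = x *m Q, the domain is the strict epigraph
   y_0 > gamma (y_1, ..., y_n) of a C^{1,1} function gamma. *)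
Definition C11_boundary (Omega : set 'rV[R]_n.+1) : Prop :=
  forall x0, (closure Omega `\` interior Omega) x0 ->
  exists (r : R) (Q : 'M[R]_n.+1) (gamma : 'rV[R]_n -> R),
    [/\ 0 < r, Q *m Q^T = 1%:M, C11 gamma &
      forall x, enorm (x - x0) < r ->
        (Omega x <-> gamma (behead_rV (x *m Q)) < (x *m Q) 0 0)].

End domain.

Section fractional.
Context {R : realType} {n : nat}.
Local Notation V := 'rV[R]_n.+1.
Local Notation leb := (@lebesgue_rV R n.+1).
Implicit Types (s lambda : R) (e : V) (A Omega : set V) (u v w f : V -> R).

Definition sphere : set V := [set x | enorm x = 1].

(* The constant K of the operator; its value does not depend on the unit
   vector e. *)
Definition Kconst s e : R :=
  2 * (1 - s) *
  (\int[hausdorff_measure n]_(x in sphere) (`|edot x e| ^+ 2))^-1.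

Definition L2 A u : Prop := u \_ A \in Lfun leb 2%:E.

Definition Linfty A u : Prop := u \_ A \in Lfun leb +oo%E.

(* |x - y|^(N + 2s) with N = n.+1; powR makes it 0, hence its inverse 0, on the
   (negligible) diagonal. *)
Definition kernel_den s (z : V * V) : R :=
  enorm (z.1 - z.2) `^ (n.+1%:R + 2 * s).

(* The square of the Gagliardo seminorm of W^{s,2}(A). *)
Definition gagliardo2 s A u : \bar R :=
  (\int[leb \x leb]_(z in A `*` A)
     (`|u z.1 - u z.2| ^+ 2 / kernel_den s z)%:E)%E.

Definition Ws2 s A u : Prop := L2 A u /\ (gagliardo2 s A u < +oo)%E.

(* Elements are represented by their extensions by zero. *)
Definition Ws2_tilde s Omega u : Prop :=
  [/\ forall x, ~ Omega x -> u x = 0, Ws2 s Omega u & Ws2 s setT u].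

Definition L2_loc u : Prop :=
  measurable_fun setT u /\ forall C : set V, compact C -> L2 C u.

Definition Ws2_hat s Omega u : Prop :=
  [/\ L2_loc u,
      exists U : set V,
        [/\ open U, compact (closure Omega), closure Omega `<=` U & Ws2 s U u] &
      (\int[leb]_x (`|u x| / (1 + enorm x) `^ (n.+1%:R + 2 * s))%:E < +oo)%E].

(* The form K * (double integral) of the weak formulation. *)
Definition energy s e u v : R :=
  Kconst s e * \int[(leb \x leb)%E]_z
    ((u z.1 - u z.2) * (v z.1 - v z.2) / kernel_den s z).

Definition weak_solution s e Omega lambda f u : Prop :=
  [/\ Ws2_hat s Omega u,
      {ae leb, forall x, ~ Omega x -> u x = 0} &
      forall v, Ws2_tilde s Omega v ->
        energy s e u v = lambda * \int[leb]_(x in Omega) (u x * v x) +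
                         \int[leb]_(x in Omega) (f x * v x)].

Definition lambda1 s e Omega : R :=
  inf [set Kconst s e * fine (gagliardo2 s setT u) | u in
        [set u | Ws2_tilde s Omega u /\
                 ('N[leb]_2%:E[EFin \o (u \_ Omega)])%E = 1%E]].

Definition first_eigenfunction s e Omega w : Prop :=
  [/\ Ws2_tilde s Omega w,
      ~ {ae leb, forall x, w x = 0} &
      forall v, Ws2_tilde s Omega v ->
        energy s e w v =
        lambda1 s e Omega * \int[leb]_(x in Omega) (w x * v x)].

Definition continuous_representative Omega u u' : Prop :=
  {within closure Omega, continuous u'} /\
  {ae leb, forall x, Omega x -> u' x = u x}.

(* Weak solutions are functions up to null sets, identified with their
   continuous representatives on the closure of Omega: the sign holds almost
   everywhere, and everywhere in Omega for the continuous representative. *)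
Definition positive_in Omega u : Prop :=
  {ae leb, forall x, Omega x -> 0 < u x} /\
  forall u', continuous_representative Omega u u' ->
    forall x, Omega x -> 0 < u' x.

Definition negative_in Omega u : Prop :=
  {ae leb, forall x, Omega x -> u x < 0} /\
  forall u', continuous_representative Omega u u' ->
    forall x, Omega x -> u' x < 0.

End fractional.

(* Main.v *)
(* Write k(x,y) = |x-y|^-(N+2s), B for the associated bilinear form and w = w_1.
   No regularity up to the boundary is used: u is compared with w itself.

   Testing an equation with a positive part g^+ of some g gives
     B(g, g^+) >= 2 \int g^+(x) (\int g^-(y) k(x,y) dy) dx + B(g^+, g^+),
   and on a bounded domain the nonlocal tail alone beats bounded right-hand
   sides.  With g = v - c this bounds weak solutions by their L^2 norm; with
   g = v - C w it shows that a bounded v with K (-Delta)^s v bounded satisfies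
   v <= C w; with g = eps h - w, h a truncated paraboloid, it bounds w below
   near each interior point.  Testing the equation of w with v^2 / (w + eps)
   (Picone) gives K B(v,v) - lambda_1 |v|^2 >= gamma |v|^2 for v orthogonal to w.

   Hence u = t w + v with t = \int f w / ((lambda_1 - lambda) \int w^2) and v
   orthogonal to w, where v is bounded in L^2 by the gap, then in L^oo, then by
   C w, uniformly for lambda near lambda_1.  As |t| > C when lambda is close to
   lambda_1, u has the sign of t.

   Two points are implicit in the notation of the problem.  A weak solution
   vanishing off Omega and of finite seminorm only near Omega has finite seminorm
   on the whole space, because min(|h|^2, 1) / |h|^(N+2s) is integrable.  And the
   constant K is positive because H^(N-1) is a metric outer measure for which
   the sphere has finite measure and a spherical cap positive measure. *)
Require Import Defs.
From mathcomp Require Import all_boot all_order all_algebra.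
From mathcomp Require Import all_classical all_reals all_analysis.
From mathcomp Require Import measurable_realfun.
From mathcomp Require Import ring lra.

Set Implicit Arguments.
Unset Strict Implicit.
Unset Printing Implicit Defensive.

Import Order.TTheory GRing.Theory Num.Theory.
Import numFieldNormedType.Exports.

Local Open Scope classical_set_scope.
Local Open Scope ring_scope.

(** * Euclidean norm, integrals and Lebesgue measure *)

(** The order of the bounds is forced. Picone's test function v^2 / (w + eps) is admissible only for
    bounded v, so each solution is first shown bounded with a constant depending on that solution.
    Only then does the gap apply; its L^2 bound is free of that constant, and the uniform L^oo bound
    and the uniform comparison with w follow from it. The gap uses no compact embedding: on a
    bounded domain the kernel has a positive lower bound, which turns the square in Picone's
    identity into a multiple of \int w^2 \int v^2 - (\int v w)^2, and orthogonality removes the last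
    term. Positivity of w almost everywhere would only make a continuous representative of u
    nonnegative; strict positivity at every point is the reason for the local lower bound on w.
    Polar coordinates never appear: integrability of the kernel weight is read off from the finite
    seminorm of w, and besides sigma-finiteness the analysis asks of the measure only translation
    invariance and the volume of cubes. *)

Section enorm_theory.
Context {R : realType} {n : nat}.
Implicit Types (x y z : 'rV[R]_n) (a : R).

Lemma edotC x y : edot x y = edot y x.
Proof. by apply: eq_bigr => i _; rewrite mulrC. Qed.

Lemma edotDl x y z : edot (x + y) z = edot x z + edot y z.
Proof. by rewrite -big_split; apply: eq_bigr => i _; rewrite mxE mulrDl. Qed.

Lemma edotZl a x y : edot (a *: x) y = a * edot x y.
Proof. by rewrite mulr_sumr; apply: eq_bigr => i _; rewrite mxE mulrA. Qed.

Lemma edotNl x y : edot (- x) y = - edot x y.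
Proof. by rewrite -scaleN1r edotZl mulN1r. Qed.

Lemma edotDr x y z : edot z (x + y) = edot z x + edot z y.
Proof. by rewrite edotC edotDl !(edotC z). Qed.

Lemma edotZr a x y : edot y (a *: x) = a * edot y x.
Proof. by rewrite edotC edotZl (edotC y). Qed.

Lemma edotNr x y : edot x (- y) = - edot x y.
Proof. by rewrite edotC edotNl (edotC y). Qed.

Lemma edot_ge0 x : 0 <= edot x x.
Proof. by apply: sumr_ge0 => i _; rewrite -expr2 sqr_ge0. Qed.

Lemma enorm_ge0 x : 0 <= enorm x.
Proof. exact: sqrtr_ge0. Qed.

Lemma enorm_sqr x : enorm x ^+ 2 = edot x x.
Proof. by rewrite sqr_sqrtr// edot_ge0. Qed.

Lemma enormN x : enorm (- x) = enorm x.
Proof. by rewrite /enorm edotNl edotNr opprK. Qed.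

Lemma enormZ a x : enorm (a *: x) = `|a| * enorm x.
Proof.
by rewrite /enorm edotZl edotZr mulrA -expr2 sqrtrM ?sqr_ge0// sqrtr_sqr.
Qed.

Lemma enorm0 : enorm (0 : 'rV[R]_n) = 0.
Proof. by rewrite -(scale0r (0 : 'rV[R]_n)) enormZ normr0 mul0r. Qed.

Lemma enormB_sym x y : enorm (x - y) = enorm (y - x).
Proof. by rewrite -enormN opprB. Qed.

Lemma normr_coord_le_enorm x i : `|x 0 i| <= enorm x.
Proof.
rewrite -sqrtr_sqr ler_sqrt ?edot_ge0// /edot (bigD1 i)//= -expr2 lerDl.
by apply: sumr_ge0 => j _; rewrite -expr2 sqr_ge0.
Qed.

Lemma enorm_eq0 x : enorm x = 0 -> x = 0.
Proof.
move=> x0; apply/rowP => i; rewrite mxE; apply/eqP.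
by rewrite -normr_le0 -x0 normr_coord_le_enorm.
Qed.

Lemma cauchy_schwarz_edot x y : edot x y ^+ 2 <= edot x x * edot y y.
Proof.
have [y0|yn0] := eqVneq (edot y y) 0.
  have -> : y = 0 by apply: enorm_eq0; rewrite /enorm y0 sqrtr0.
  by rewrite -(scale0r (0 : 'rV[R]_n)) !edotZr !mul0r mulr0 expr0n.
have b0 : 0 < edot y y by rewrite lt_def yn0 edot_ge0.
have := edot_ge0 (edot y y *: x - edot x y *: y).
rewrite edotDl !edotDr !edotNr !edotNl !edotZl !edotZr (edotC y x).
rewrite (_ : _ + _ = edot y y * (edot x x * edot y y - edot x y ^+ 2)); last by ring.
by rewrite pmulr_rge0// subr_ge0.
Qed.

Lemma ler_normr_edot x y : `|edot x y| <= enorm x * enorm y.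
Proof.
rewrite -(ler_pXn2r (n := 2))// ?nnegrE ?mulr_ge0 ?enorm_ge0//.
by rewrite exprMn !enorm_sqr real_normK ?num_real// cauchy_schwarz_edot.
Qed.

Lemma ler_enormD x y : enorm (x + y) <= enorm x + enorm y.
Proof.
rewrite -(ler_pXn2r (n := 2))// ?nnegrE ?addr_ge0 ?enorm_ge0//.
rewrite enorm_sqr sqrrD !enorm_sqr edotDl !edotDr (edotC y x).
have := ler_normr_edot x y; have := ler_norm (edot x y); lra.
Qed.

Lemma ler_enorm_sum x : enorm x <= \sum_(i < n) `|x 0 i|.
Proof.
have s0 : 0 <= \sum_(i < n) `|x 0 i| by apply: sumr_ge0.
rewrite -(ler_pXn2r (n := 2))// ?nnegrE ?enorm_ge0// enorm_sqr /edot.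
rewrite expr2 mulr_sumr ler_sum// => i _.
rewrite -expr2 -real_normK ?num_real// expr2 ler_wpM2r//.
by rewrite (bigD1 i)//= lerDl sumr_ge0.
Qed.

Lemma enorm_le_coord x a : (forall i, `|x 0 i| <= a) -> enorm x <= n%:R * a.
Proof.
move=> xa; rewrite (le_trans (ler_enorm_sum x))//.
by rewrite (le_trans (ler_sum _ (fun i _ => xa i)))// sumr_const card_ord mulr_natl.
Qed.

Lemma measurable_enorm : measurable_fun setT (@enorm R n).
Proof.
apply: (@measurableT_comp _ _ _ _ _ _ (@Num.sqrt R)).
  by apply: continuous_measurable_fun; exact: sqrt_continuous.
by rewrite /edot; apply: measurable_sum => i; apply: measurable_funM; exact: measurable_coord.
Qed.

End enorm_theory.

Lemma ler_of_cvg0 (R : realType) (a b : R) (r : nat -> R) :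
  r k @[k --> \oo] --> (0 : R) -> (forall k, a <= b + r k) -> a <= b.
Proof.
move=> r0 ab; rewrite -subr_le0.
have <- := cvg_lim (@Rhausdorff R) r0.
apply: limr_ge; first by apply/cvg_ex; exists 0.
by apply: nearW => k; rewrite lerBlDl.
Qed.

Section levels.
Context d (T : measurableType d) (R : realType).
Implicit Types (f : T -> R) (a : R).

Lemma measurable_sublevel f a : measurable_fun setT f ->
  measurable [set x | f x <= a].
Proof.
move=> mf; have := mf measurableT _ (measurable_itv `]-oo, a]).
by rewrite setTI (_ : _ @^-1` _ = [set x | f x <= a])//;
  apply/seteqP; split => x /=; rewrite in_itv.
Qed.

Lemma measurable_ssuperlevel f a : measurable_fun setT f ->
  measurable [set x | a < f x].
Proof.
move=> mf; rewrite (_ : [set _ | _] = ~` [set x | f x <= a]).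
  by apply: measurableC; exact: measurable_sublevel.
by apply/seteqP; split => x /=; rewrite ltNge => /negP.
Qed.

Lemma measurable_superlevel f a : measurable_fun setT f ->
  measurable [set x | a <= f x].
Proof.
move=> mf; rewrite (_ : [set _ | _] = [set x | (- f x) <= - a]).
  by apply: (@measurable_sublevel (fun x => - f x)); exact: measurableT_comp.
by apply/seteqP; split => x /=; rewrite lerN2.
Qed.

Lemma measurable_indic_le f a : measurable_fun setT f ->
  measurable_fun setT (fun x => (f x <= a)%R%:R : R).
Proof.
move=> mf; rewrite (_ : (fun _ => _) = \1_[set x | f x <= a] :> (T -> R)).
  by apply: measurable_indic; exact: measurable_sublevel.
apply/funext => x; rewrite indicE; case: (boolP (f x <= a)) => h.
  by rewrite mem_set.
by rewrite memNset//; exact/negP.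
Qed.

Lemma measurable_EFin f : measurable_fun setT f ->
  measurable_fun setT (fun x => (f x)%:E).
Proof. by move=> mf; apply/measurable_EFinP. Qed.

End levels.

(** * Real-valued integrals over the whole space *)

Section real_integral.
Context d (T : measurableType d) (R : realType).
Context (mu : {measure set T -> \bar R}).
Implicit Types f g : T -> R.
Local Notation integ f := (mu.-integrable setT (EFin \o f)).

Lemma integ_measurable f : integ f -> measurable_fun setT f.
Proof. by move=> /measurable_int/measurable_EFinP. Qed.

Lemma integ_le g f : integ g -> measurable_fun setT f ->
  (forall x, `|f x| <= g x) -> integ f.
Proof.
move=> ig mf fg; apply: (le_integrable _ _ _ ig) => //.
  exact/measurable_EFinP.
by move=> x _ /=; rewrite lee_fin (le_trans (fg x))// ler_norm.
Qed.

Lemma integD f g : integ f -> integ g -> integ (fun x => f x + g x).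
Proof. by move=> ? ?; exact: (@integrableD _ _ _ _ _ measurableT (EFin \o f) (EFin \o g)). Qed.

Lemma integB f g : integ f -> integ g -> integ (fun x => f x - g x).
Proof. by move=> ? ?; exact: (@integrableB _ _ _ _ _ measurableT (EFin \o f) (EFin \o g)). Qed.

Lemma integZ a f : integ f -> integ (fun x => a * f x).
Proof. exact: (@integrableZl _ _ _ _ _ measurableT a (EFin \o f)). Qed.

Lemma integ_norm f : integ f -> integ (fun x => `|f x|).
Proof. exact: integrable_norm. Qed.

Lemma integ_ge0 f : measurable_fun setT f -> (forall x, 0 <= f x) ->
  (\int[mu]_x (f x)%:E < +oo)%E -> integ f.
Proof.
move=> mf f0 fi; apply/integrableP; split; first exact/measurable_EFinP.
by under eq_integral => x _ do rewrite /= ger0_norm//.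
Qed.

Lemma RintegralE f : integ f -> (\int[mu]_x f x)%:E = (\int[mu]_x (f x)%:E)%E.
Proof. by move=> fi; rewrite /Rintegral fineK// integrable_fin_num. Qed.

Lemma integ_lty f : integ f -> (\int[mu]_x (f x)%:E < +oo)%E.
Proof. by move=> fi; rewrite -RintegralE// ltry. Qed.

Lemma le_RintegralT f g : integ f -> integ g -> (forall x, f x <= g x) ->
  \int[mu]_x f x <= \int[mu]_x g x.
Proof. by move=> *; apply: le_Rintegral. Qed.

Lemma Rintegral_le0_ae f : integ f -> (forall x, 0 <= f x) ->
  \int[mu]_x f x <= 0 -> {ae mu, forall x, f x = 0}.
Proof.
move=> fi f0 fle.
have : (\int[mu]_x `|(EFin \o f) x| = 0)%E.
  under eq_integral => x _ do rewrite /= ger0_norm//.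
  rewrite -RintegralE//; congr EFin; apply/eqP; rewrite eq_le fle.
  exact: Rintegral_ge0.
move=> /(ae_eq_integral_abs mu measurableT (measurable_int _ fi)).1.
by apply: filterS => x /(_ I)[].
Qed.

Lemma integ_ae f g : integ g -> measurable_fun setT f ->
  {ae mu, forall x, f x = g x} -> integ f.
Proof.
move=> /integrableP[mg gi] mf fg; apply/integrableP; split.
  exact/measurable_EFinP.
rewrite (@ae_eq_integral _ _ _ mu setT (fun x => `|(EFin \o g) x|)%E)//.
- by apply: measurableT_comp => //; exact/measurable_EFinP.
- exact: measurableT_comp.
- by apply: filterS fg => x /= -> _.
Qed.

Lemma ae_eq_Rintegral f g : measurable_fun setT f -> measurable_fun setT g ->
  {ae mu, forall x, f x = g x} -> \int[mu]_x f x = \int[mu]_x g x.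
Proof.
move=> mf mg fg; rewrite /Rintegral; congr fine.
apply: ae_eq_integral => //; try exact/measurable_EFinP.
by apply: filterS fg => x /= -> _.
Qed.

Lemma ae_le_Rintegral f g : integ f -> integ g ->
  {ae mu, forall x, f x <= g x} -> \int[mu]_x f x <= \int[mu]_x g x.
Proof.
(* Passing to min(f, g) turns the almost everywhere inequality into a pointwise one. *)
move=> fi gi fg; rewrite (@ae_eq_Rintegral f (fun x => Num.min (f x) (g x))).
- apply: le_RintegralT => //; last by move=> x; rewrite ge_min lexx orbT.
  apply: (@integ_le (fun x => `|f x| + `|g x|)).
  + by apply: integD; exact: integ_norm.
  + by apply: measurable_minr; exact: integ_measurable.
  + by move=> x; case: (leP (f x) (g x)) => _; rewrite ?lerDl ?lerDr.
- exact: integ_measurable.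
- by apply: measurable_minr; exact: integ_measurable.
- by apply: filterS fg => x h; rewrite min_l.
Qed.

Lemma integ_mul f g : measurable_fun setT f -> measurable_fun setT g ->
  integ (fun x => f x ^+ 2) -> integ (fun x => g x ^+ 2) ->
  integ (fun x => f x * g x).
Proof.
move=> mf mg f2 g2; apply: (integ_le (integD f2 g2)).
  exact: measurable_funM.
move=> x; rewrite ler_norml; have := sqr_ge0 (f x - g x).
have := sqr_ge0 (f x + g x); have := sqr_ge0 (f x); have := sqr_ge0 (g x).
by rewrite !sqrrD; move=> *; apply/andP; split; lra.
Qed.

Lemma integ_indic (A : set T) : measurable A -> (mu A < +oo)%E ->
  integ (\1_A : T -> R).
Proof.
move=> mA Aoo; apply: integ_ge0; first exact: measurable_indic.
  by move=> x; rewrite indicE.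
by rewrite integral_indic// setIT.
Qed.

Lemma ge0_integral_lin a b f g : 0 <= a -> 0 <= b ->
  measurable_fun setT f -> measurable_fun setT g ->
  (forall x, 0 <= f x) -> (forall x, 0 <= g x) ->
  (\int[mu]_x (a * f x + b * g x)%:E =
   a%:E * \int[mu]_x (f x)%:E + b%:E * \int[mu]_x (g x)%:E)%E.
Proof.
move=> a0 b0 mf mg f0 g0.
rewrite -!ge0_integralZl//; try (by move=> x _; rewrite lee_fin);
  try exact: measurable_EFin.
rewrite -ge0_integralD//.
- by move=> x _; rewrite -EFinM lee_fin mulr_ge0.
- by apply: measurable_EFin; exact: measurable_funM.
- by move=> x _; rewrite -EFinM lee_fin mulr_ge0.
- by apply: measurable_EFin; exact: measurable_funM.
Qed.

(** On a set of finite measure L^2 embeds in L^1, through |f| <= 1 + f^2. *)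
Lemma integ_sqr_supp (Q : set T) f : measurable Q -> (mu Q < +oo)%E ->
  measurable_fun setT f -> (forall x, ~ Q x -> f x = 0) ->
  integ (fun x => f x ^+ 2) -> integ f.
Proof.
move=> mQ Qoo mf f0 f2; apply: (@integ_le (fun x => \1_Q x + f x ^+ 2)) => //.
  by apply: integD => //; exact: integ_indic.
move=> x; rewrite indicE; have [xQ|xQ] := pselect (Q x).
  rewrite mem_set//= ler_norml; have := sqr_ge0 (f x - 1); have := sqr_ge0 (f x + 1).
  by rewrite !sqrrD; move=> *; apply/andP; split; lra.
by rewrite f0// normr0 expr0n/= addr0 ler0n.
Qed.

End real_integral.

Lemma measurable_swap_pair d (T : measurableType d) :
  measurable_fun setT (fun z : T * T => (z.2, z.1)).
Proof.
by apply/measurable_fun_pairP; split; [exact: measurable_snd|exact: measurable_fst].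
Qed.

Lemma ge0_integral_swap d (T : measurableType d) (R : realType)
    (mu : {sigma_finite_measure set T -> \bar R}) (f : T * T -> R) :
  measurable_fun setT f -> (forall z, 0 <= f z) ->
  (\int[mu \x mu]_z (f (z.2, z.1))%:E = \int[mu \x mu]_z (f z)%:E)%E.
Proof.
move=> mf f0.
have mf' : measurable_fun setT (fun z => (f (z.2, z.1))%:E).
  by apply: measurable_EFin; exact: (measurableT_comp mf (@measurable_swap_pair _ T)).
rewrite (fubini_tonelli2 _ mf'); last by move=> z; rewrite lee_fin.
rewrite (fubini_tonelli1 _ (measurable_EFin mf)); last by move=> z; rewrite lee_fin.
by [].
Qed.

(** Swapping the variables preserves the integral of h, so the symmetrized h integrates to twice
    that of h. The bound on h is stated for the extended integral, so that Tonelli can supply it. *)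
Lemma Rintegral_symmetrized_ge d (T : measurableType d) (R : realType)
    (mu : {sigma_finite_measure set T -> \bar R}) (f h : T * T -> R) (c : R) :
  (mu \x mu)%E.-integrable setT (EFin \o f) ->
  measurable_fun setT h -> (forall z, 0 <= h z) ->
  (forall x y, h (x, y) + h (y, x) <= f (x, y)) ->
  (c%:E <= \int[mu \x mu]_z (h z)%:E)%E ->
  2 * c <= \int[(mu \x mu)%E]_z f z.
Proof.
move=> fi mh h0 hf ch.
have mh' : measurable_fun setT (fun z => h (z.2, z.1)).
  exact: (measurableT_comp mh (@measurable_swap_pair _ T)).
rewrite -lee_fin (RintegralE fi).
apply: (@le_trans _ _ (\int[mu \x mu]_z ((h z)%:E + (h (z.2, z.1))%:E))%E).
  rewrite ge0_integralD//; try (by move=> z _; rewrite lee_fin);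
    try exact: measurable_EFin.
  by rewrite (ge0_integral_swap mu mh h0) (_ : 2 * c = c + c) ?EFinD ?leeD//; ring.
apply: ge0_le_integral => //.
- by move=> z _; rewrite -EFinD lee_fin addr_ge0.
- by apply: emeasurable_funD; exact: measurable_EFin.
- exact: measurable_int fi.
- by move=> [x y] _; rewrite -EFinD lee_fin.
Qed.

(** * Invariance of integrals, applied below to the swap, translations and the shear *)

Section measure_preserving.
Context d (T : measurableType d) (R : realType).
Variables (mu : {measure set T -> \bar R}) (phi : T -> T).
Hypothesis mphi : measurable_fun setT phi.
Hypothesis phi_ge0 : forall f : T -> R, measurable_fun setT f ->
  (forall x, 0 <= f x) ->
  (\int[mu]_x (f (phi x))%:E = \int[mu]_x (f x)%:E)%E.

Lemma integ_preserving (f : T -> R) : mu.-integrable setT (EFin \o f) ->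
  mu.-integrable setT (EFin \o (f \o phi)).
Proof.
move=> fi; have mf := integ_measurable fi.
apply/integrableP; split.
  by apply: measurable_EFin; exact: (measurableT_comp mf mphi).
have := integ_lty (integ_norm fi).
by rewrite -(phi_ge0 (f := fun x => `|f x|))//; exact: measurableT_comp.
Qed.

(** Invariance is known for nonnegative functions; a signed one is split into its positive and
    negative parts. *)
Lemma Rintegral_preserving (f : T -> R) : mu.-integrable setT (EFin \o f) ->
  \int[mu]_x f (phi x) = \int[mu]_x f x.
Proof.
move=> fi; have mf := integ_measurable fi.
have ig (g : T -> R) : measurable_fun setT g -> (forall x, `|g x| <= `|f x|) ->
    mu.-integrable setT (EFin \o g).
  by move=> mg gf; exact: (integ_le (integ_norm fi)).
have key (g : T -> R) : mu.-integrable setT (EFin \o g) -> (forall x, 0 <= g x) ->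
    \int[mu]_x g (phi x) = \int[mu]_x g x.
  move=> gi g0; rewrite /Rintegral; congr fine.
  by apply: phi_ge0 => //; exact: (integ_measurable gi).
have [fp [fn [ip inn fp0 fn0 ->]]] : exists fp fn : T -> R,
    [/\ mu.-integrable setT (EFin \o fp), mu.-integrable setT (EFin \o fn),
        forall x, 0 <= fp x, forall x, 0 <= fn x & f = fun x => fp x - fn x].
  exists (fun x => Num.max (f x) 0), (fun x => Num.max (- f x) 0); split.
  - apply: ig; first exact: measurable_maxr.
    by move=> x; case: (leP (f x) 0) => // _; rewrite normr0.
  - apply: ig; first by apply: measurable_maxr => //; exact: measurableT_comp.
    move=> x; case: (leP (- f x) 0) => // _; first by rewrite normr0.
    by rewrite normrN.
  - by move=> x; rewrite le_max lexx orbT.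
  - by move=> x; rewrite le_max lexx orbT.
  - apply/funext => x; case: (leP (f x) 0) => h.
      by rewrite max_l ?oppr_ge0// sub0r opprK.
    by rewrite max_r ?subr0// oppr_le0 ltW.
rewrite RintegralB//; [|exact: (integ_preserving ip)|exact: (integ_preserving inn)].
by rewrite !key// RintegralB.
Qed.

End measure_preserving.
Lemma integ_swap d (T : measurableType d) (R : realType)
    (mu : {sigma_finite_measure set T -> \bar R}) (f : T * T -> R) :
  (mu \x mu)%E.-integrable setT (EFin \o f) ->
  (mu \x mu)%E.-integrable setT (EFin \o (fun z => f (z.2, z.1))).
Proof.
exact: (integ_preserving (@measurable_swap_pair _ T) (@ge0_integral_swap _ _ _ mu)).
Qed.

Lemma integ_prod_mul d (T : measurableType d) (R : realType)
    (mu : {sigma_finite_measure set T -> \bar R}) (a b : T -> R) :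
  mu.-integrable setT (EFin \o a) -> mu.-integrable setT (EFin \o b) ->
  (mu \x mu)%E.-integrable setT (EFin \o (fun z => a z.1 * b z.2)).
Proof.
move=> ia ib.
have ma := integ_measurable ia; have mb := integ_measurable ib.
have mf : measurable_fun setT (fun z : T * T => a z.1 * b z.2).
  apply: measurable_funM; first exact: (measurableT_comp ma measurable_fst).
  exact: (measurableT_comp mb measurable_snd).
apply/(integrable12ltyP _ _ _).
  exact: measurable_EFin mf.
have iB := RintegralE (integ_norm ib).
rewrite (eq_integral (fun x => (`|a x| * \int[mu]_y `|b y|)%:E)).
  have := integ_lty (integZ (\int[mu]_y `|b y|) (integ_norm ia)).
  by under eq_integral do rewrite mulrC.
move=> x _; rewrite -RintegralZl//; last exact: integ_norm.
rewrite RintegralE; last exact: integZ (integ_norm ib).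
by apply: eq_integral => y _ /=; rewrite normrM.
Qed.

Lemma Rintegral_prod_mul d (T : measurableType d) (R : realType)
    (mu : {sigma_finite_measure set T -> \bar R}) (a b : T -> R) :
  mu.-integrable setT (EFin \o a) -> mu.-integrable setT (EFin \o b) ->
  \int[(mu \x mu)%E]_z (a z.1 * b z.2) = (\int[mu]_x a x) * \int[mu]_x b x.
Proof.
move=> ia ib; apply: EFin_inj; rewrite (RintegralE (integ_prod_mul ia ib)).
have := integral12_prod_meas1 (integ_prod_mul ia ib); rewrite /= => <-.
rewrite mulrC -RintegralZl// RintegralE; last exact: integZ.
apply: eq_integral => x _; rewrite /fubini_F/=.
by rewrite mulrC -RintegralZl// RintegralE//; exact: integZ.
Qed.

Arguments lebesgue_rV : simpl never.

(** * Lebesgue measure of R^n: translations and cubes *)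

Section lebesgue_rV_theory.
Context {R : realType}.

Lemma measurable_addr_rV n (x : 'rV[R]_n) :
  measurable_fun setT (fun y : 'rV[R]_n => y + x).
Proof.
apply: measurable_fun_rVP => i.
rewrite (_ : (fun _ => _) = (fun y : 'rV[R]_n => y 0 i + x 0 i)).
  by apply: measurable_funD => //; exact: measurable_coord.
by apply/funext => y; rewrite mxE.
Qed.

(** The translated measure agrees with Lebesgue measure on half-open intervals, which determine
    it. *)
Lemma lebesgue_measure_addr (a : R) (A : set (measurableTypeR R)) :
  measurable A -> @lebesgue_measure R [set y | A (y + a)] = lebesgue_measure A.
Proof.
move=> mA.
pose f (y : measurableTypeR R) : measurableTypeR R := y + a.
have mf : measurable_fun setT f by exact: measurable_funD.
have := @lebesgue_measure_unique R (pushforward (@lebesgue_measure R) f).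
move=> /(_ mf _ A mA) -> // X [[b c] _ <-] /=.
rewrite /pushforward (_ : f @^-1` _ = `]b - a, c - a]%classic); last first.
  by apply/seteqP; split => y /=; rewrite !in_itv/= ltrBlDr lerBrDr.
rewrite !lebesgue_measure_itv/= !lte_fin ltrD2r.
by case: ifP => // _; rewrite -!EFinB; congr EFin; ring.
Qed.

Lemma consrV0 n (z : measurableTypeR R * 'rV[R]_n) : consrV z 0 0 = z.1.
Proof. by have /(congr1 fst) := consrVK z. Qed.

Lemma consrV_lift n (z : measurableTypeR R * 'rV[R]_n) i :
  consrV z 0 (lift ord0 i) = z.2 0 i.
Proof. by have /(congr1 snd)/rowP/(_ i) := consrVK z; rewrite mxE. Qed.

Lemma consrV_addr n (z : measurableTypeR R * 'rV[R]_n) (x : 'rV[R]_n.+1) :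
  consrV z + x = consrV (z.1 + x 0 0, z.2 + behead_rV x).
Proof.
apply/rowP => i; rewrite mxE; case: (unliftP ord0 i) => [j|] ->.
  by rewrite !consrV_lift !mxE.
by rewrite !consrV0.
Qed.

Lemma lebesgue_rVS n (A : set 'rV[R]_n.+1) :
  lebesgue_rV n.+1 A =
  (@lebesgue_measure R \x lebesgue_rV n)%E (@consrV R n @^-1` A).
Proof. by []. Qed.

Lemma lebesgue_rV_addr n (x : 'rV[R]_n) (A : set 'rV[R]_n) :
  measurable A -> lebesgue_rV n [set y | A (y + x)] = lebesgue_rV n A.
Proof.
elim: n x A => [|n ih] x A mA.
  by congr (lebesgue_rV 0 _); apply/seteqP; split => y /=; rewrite [_ + _]thinmx0 [y]thinmx0.
pose f (z : measurableTypeR R * 'rV[R]_n) : measurableTypeR R * 'rV[R]_n :=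
  (z.1 + x 0 0, z.2 + behead_rV x).
have mf : measurable_fun setT f.
  apply/measurable_fun_pairP; split; first exact: measurable_funD.
  exact: (measurableT_comp (measurable_addr_rV _) measurable_snd).
rewrite !lebesgue_rVS.
have mA' : measurable (@consrV R n @^-1` A).
  by rewrite -[X in measurable X]setTI; exact: measurable_consrV.
have := @product_measure_unique _ _ _ _ R (@lebesgue_measure R) (lebesgue_rV n)
  (pushforward (@lebesgue_measure R \x lebesgue_rV n)%E f).
move=> /(_ mf _ _ mA') ->.
  by congr (_ _); apply/seteqP; split => z /=; rewrite consrV_addr.
move=> B C mB mC; 
have mB' : measurable [set y : measurableTypeR R | B (y + x 0 0)].
  have : measurable_fun setT (fun y : measurableTypeR R => y + x 0 0 : measurableTypeR R).
    exact: measurable_funD.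
  by move=> /(_ measurableT B mB); rewrite setTI.
have mC' : measurable [set y | C (y + behead_rV x)].
  by have := measurable_addr_rV (behead_rV x) measurableT mC; rewrite setTI.
transitivity ((@lebesgue_measure R \x lebesgue_rV n)%E
  ([set y : measurableTypeR R | B (y + x 0 0)] `*` [set y | C (y + behead_rV x)])).
  by [].
rewrite product_measure1E//; congr (_ * _)%E; last exact: ih.
exact: lebesgue_measure_addr.
Qed.

(** Closed balls of the sup norm: their volume is explicit for a product measure, so they replace
    Euclidean balls in the volume estimates. *)
Definition cube n (x : 'rV[R]_n) (r : R) : set 'rV[R]_n :=
  [set y | forall i, `|y 0 i - x 0 i| <= r].

Lemma measurable_cube n (x : 'rV[R]_n) (r : R) : measurable (cube x r).
Proof.
rewrite (_ : cube x r =
    \bigcap_(i in [set: 'I_n]) [set y : 'rV[R]_n | `|y 0 i - x 0 i| <= r]).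
  apply: fin_bigcap_measurable => // i _.
  have mg : measurable_fun setT (fun y : 'rV[R]_n => `|y 0 i - x 0 i|).
    apply: measurableT_comp => //; apply: measurable_funB => //.
    exact: measurable_coord.
  exact: measurable_sublevel.
by apply/seteqP; split => y /= yx i; [move=> _; exact: yx|exact: yx].
Qed.

Lemma lebesgue_rV_cube n (x : 'rV[R]_n) (r : R) : 0 <= r ->
  lebesgue_rV n (cube x r) = ((2 * r) ^+ n)%:E.
Proof.
move=> r0; elim: n x => [|n ih] x.
  transitivity (@dirac _ 'rV[R]_0 0 R (cube x r)); first by [].
  by rewrite diracE mem_set// => -[].
rewrite lebesgue_rVS (_ : _ @^-1` _ =
    `[x 0 0 - r, x 0 0 + r]%classic `*` cube (behead_rV x) r); last first.
  apply/seteqP; split => [z /= zx|z /= [zx1 zx2] i].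
    split; first by have := zx 0; rewrite consrV0 /= in_itv/= ler_distl.
    by move=> i; have := zx (lift ord0 i); rewrite consrV_lift mxE.
  case: (unliftP ord0 i) => [j|] ->.
    by have := zx2 j; rewrite consrV_lift mxE.
  by move: zx1; rewrite in_itv/= -ler_distl consrV0.
rewrite product_measure1E ?ih//; last exact: measurable_cube.
have E : @lebesgue_measure R `[x 0 0 - r, x 0 0 + r]%classic = (2 * r)%:E.
  rewrite lebesgue_measure_itv/= lte_fin; case: ifPn => [_|].
    by rewrite -EFinB; congr EFin; ring.
  by rewrite -leNgt => h; congr EFin; lra.
by rewrite exprS EFinM -E.
Qed.

End lebesgue_rV_theory.

(** * The Gagliardo form *)

Section gagliardo_form.
Context {R : realType} {n : nat} (s : R).
Hypothesis hs0 : 0 < s.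
Local Notation V := 'rV[R]_n.+1.
Implicit Types u v f g : V -> R.
Variable leb : {sigma_finite_measure set V -> \bar R}.
Local Notation leb2 := (leb \x leb)%E.
Local Notation integ f := (leb.-integrable setT (EFin \o f)).
Local Notation integ2 f := (leb2.-integrable setT (EFin \o f)).
Local Notation p := (n.+1%:R + 2 * s).

(** On the diagonal this is 0 rather than infinite, which is why lower bounds on it assume
    [x != y]. *)
Definition kern (z : V * V) : R := (kernel_den s z)^-1.

Lemma kern_exp_gt0 : 0 < p.
Proof. by rewrite addr_gt0// mulr_gt0. Qed.

Lemma kern_ge0 z : 0 <= kern z.
Proof. by rewrite invr_ge0 powR_ge0. Qed.

Lemma kern_sym x y : kern (y, x) = kern (x, y).
Proof. by rewrite /kern /kernel_den /= enormB_sym. Qed.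

Lemma measurable_rV_sub : measurable_fun setT (fun z : V * V => z.1 - z.2).
Proof.
apply: measurable_fun_rVP => i.
rewrite (_ : (fun _ => _) = (fun z : V * V => z.1 0 i - z.2 0 i)); last first.
  by apply/funext => z; rewrite !mxE.
apply: measurable_funB.
  exact: (measurableT_comp (measurable_coord i) measurable_fst).
exact: (measurableT_comp (measurable_coord i) measurable_snd).
Qed.

Lemma measurable_kern : measurable_fun setT kern.
Proof.
rewrite (_ : kern = (fun a => a `^ (- p)) \o (@enorm R n.+1 \o (fun z : V * V => z.1 - z.2))).
  apply: measurableT_comp; first exact: measurable_powR.
  exact: measurableT_comp measurable_enorm measurable_rV_sub.
by apply/funext => z; rewrite /kern /kernel_den/= powRN.
Qed.

Lemma kern_lower (a : R) (x y : V) : x != y -> enorm (x - y) <= a ->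
  (a `^ p)^-1 <= kern (x, y).
Proof.
move=> xy xya; rewrite /kern /kernel_den/=.
have e0 : 0 < enorm (x - y).
  rewrite lt_def enorm_ge0 andbT; apply: contra xy => /eqP e0.
  by rewrite -subr_eq0; apply/eqP/enorm_eq0.
rewrite lef_pV2 ?posrE ?powR_gt0//; last exact: lt_le_trans xya.
by rewrite ge0_ler_powR ?nnegrE ?enorm_ge0 ?(ltW kern_exp_gt0) ?(le_trans (enorm_ge0 _) xya).
Qed.

Definition form_density (u v : V -> R) (z : V * V) : R :=
  (u z.1 - u z.2) * (v z.1 - v z.2) / kernel_den s z.

Definition form (u v : V -> R) : R := \int[leb2]_z form_density u v z.

Definition finite_gagliardo (u : V -> R) : Prop := integ2 (form_density u u).

Lemma form_densityE u v x y :
  form_density u v (x, y) = (u x - u y) * (v x - v y) * kern (x, y).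
Proof. by []. Qed.

Lemma measurable_form_density u v : measurable_fun setT u ->
  measurable_fun setT v -> measurable_fun setT (form_density u v).
Proof.
move=> mu mv; apply: measurable_funM; last exact: measurable_kern.
by apply: measurable_funM; apply: measurable_funB;
  try exact: (measurableT_comp _ measurable_fst);
  exact: (measurableT_comp _ measurable_snd).
Qed.

Lemma integ_form u v : measurable_fun setT u -> measurable_fun setT v ->
  finite_gagliardo u -> finite_gagliardo v -> integ2 (form_density u v).
Proof.
move=> mu mv fu fv; apply: (integ_le (integD fu fv)).
  exact: measurable_form_density.
move=> [x y]; rewrite !form_densityE normrM (ger0_norm (kern_ge0 _)) -mulrDl.
apply: ler_wpM2r; first exact: kern_ge0.
rewrite ler_norml; have := sqr_ge0 ((u x - u y) - (v x - v y)).
have := sqr_ge0 ((u x - u y) + (v x - v y)).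
have := sqr_ge0 (u x - u y); have := sqr_ge0 (v x - v y).
by rewrite !(sqrrD, sqrrB) !expr2; move=> *; apply/andP; split; lra.
Qed.

(** Two reference functions are allowed because Picone's test function is Lipschitz in the pair (v,
    w), not in v alone. *)
Lemma finite_gagliardo_lip (L : R) u v f : measurable_fun setT f ->
  finite_gagliardo u -> finite_gagliardo v ->
  (forall x y, `|f x - f y| <= L * (`|u x - u y| + `|v x - v y|)) ->
  finite_gagliardo f.
Proof.
move=> mf fu fv fL; apply: (integ_le (integZ (2 * L ^+ 2) (integD fu fv))).
  exact: measurable_form_density.
move=> [x y]; rewrite !form_densityE -mulrDl mulrA normrM (ger0_norm (kern_ge0 _)).
apply: ler_wpM2r; first exact: kern_ge0.
rewrite -!expr2 normrX -(real_normK (num_real (u x - u y))).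
rewrite -(real_normK (num_real (v x - v y))).
move: (fL x y) (normr_ge0 (f x - f y)).
move: `|f x - f y| `|u x - u y| `|v x - v y| => a b c ab a0.
have h : a ^+ 2 <= (L * (b + c)) ^+ 2 by rewrite ler_pXn2r ?nnegrE ?(le_trans a0 ab).
apply: (le_trans h); rewrite exprMn.
rewrite (_ : 2 * _ * _ = L ^+ 2 * (2 * (b ^+ 2 + c ^+ 2))); last by ring.
apply: ler_wpM2l; first exact: sqr_ge0.
by have := sqr_ge0 (b - c); rewrite sqrrB sqrrD; lra.
Qed.

Lemma finite_gagliardoZ a u : measurable_fun setT u ->
  finite_gagliardo u -> finite_gagliardo (fun x => a * u x).
Proof.
move=> mu fu; apply: (finite_gagliardo_lip (L := `|a|) _ fu fu).
  exact: measurable_funM.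
by move=> x y; rewrite -mulrBr normrM ler_wpM2l// lerDl.
Qed.

Lemma formC u v : form u v = form v u.
Proof. by apply: eq_Rintegral => z _; rewrite /form_density [X in X / _]mulrC. Qed.

Lemma formDl u u' v : measurable_fun setT u -> measurable_fun setT u' ->
  measurable_fun setT v ->
  finite_gagliardo u -> finite_gagliardo u' -> finite_gagliardo v ->
  form (fun x => u x + u' x) v = form u v + form u' v.
Proof.
move=> mu mu' mv fu fu' fv; rewrite /form -RintegralD//; try exact: integ_form.
by apply: eq_Rintegral => -[x y] _; rewrite /form_density/=; ring.
Qed.

Lemma formZl a u v : measurable_fun setT u -> measurable_fun setT v ->
  finite_gagliardo u -> finite_gagliardo v ->
  form (fun x => a * u x) v = a * form u v.
Proof.
move=> mu mv fu fv; rewrite /form -RintegralZl//; try exact: integ_form.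
by apply: eq_Rintegral => -[x y] _; rewrite /form_density/=; ring.
Qed.

Definition pos_part (g : V -> R) x : R := Num.max (g x) 0.

Lemma pos_part_ge0 g x : 0 <= pos_part g x.
Proof. by rewrite le_max lexx orbT. Qed.

Lemma measurable_pos_part g : measurable_fun setT g ->
  measurable_fun setT (pos_part g).
Proof. by move=> mg; apply: measurable_maxr. Qed.

Lemma pos_part_lip g x y : `|pos_part g x - pos_part g y| <= `|g x - g y|.
Proof.
rewrite /pos_part; case: (leP (g x) 0) => hx; case: (leP (g y) 0) => hy;
  rewrite ?subrr ?normr0//; rewrite ?sub0r ?subr0 ?normrN.
- by rewrite (gtr0_norm hy) ler0_norm; lra.
- by rewrite (gtr0_norm hx) ger0_norm; lra.
Qed.

Lemma finite_gagliardo_pos_part g : measurable_fun setT g ->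
  finite_gagliardo g -> finite_gagliardo (pos_part g).
Proof.
move=> mg fg; apply: (finite_gagliardo_lip (L := 1) _ fg fg).
  exact: measurable_pos_part.
by move=> x y; rewrite mul1r (le_trans (pos_part_lip _ _ _))// lerDl.
Qed.

(** Only pairs of opposite sign count. If g(x) > 0 >= g(y), both sides are g(x)^2 + g(x) g^-(y)
    times the kernel; if the signs agree, the left side is 0 and the right side is a square or 0. *)
Lemma form_pos_part_density g x y :
  (pos_part g x ^+ 2 * (g y <= 0)%R%:R + pos_part g x * pos_part (\- g) y +
   (pos_part g y ^+ 2 * (g x <= 0)%R%:R + pos_part g y * pos_part (\- g) x)) * kern (x, y)
  <= form_density g (pos_part g) (x, y).
Proof.
rewrite form_densityE; apply: ler_wpM2r; first exact: kern_ge0.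
rewrite /pos_part /=; move: (g x) (g y) => a b.
have neg (c : R) : c <= 0 -> Num.max (- c) 0 = - c by move=> c0; rewrite max_l ?oppr_ge0.
have pos (c : R) : 0 < c -> Num.max (- c) 0 = 0.
  by move=> c0; rewrite max_r// oppr_le0 ltW.
have := sqr_ge0 (a - b); rewrite !expr2.
case: (leP a 0) => ha; case: (leP b 0) => hb /=;
  rewrite ?(neg _ ha) ?(neg _ hb) ?(pos _ ha) ?(pos _ hb);
  rewrite ?mulr0 ?mul0r ?mulr1 ?subr0 ?sub0r ?addr0 ?add0r; lra.
Qed.

(** [al] bounds the kernel mass of {g <= 0} and [be] the nonlocal tail of g^-, both seen from points
    of {g > 0} only. The factor 2 comes from the symmetry of the form. *)
Lemma form_pos_part_ge (g : V -> R) (al be : R) : 0 <= al -> 0 <= be ->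
  measurable_fun setT g -> finite_gagliardo g ->
  integ (pos_part g) -> integ (fun x => pos_part g x ^+ 2) ->
  (forall x, 0 < g x ->
     (al%:E <= \int[leb]_y ((g y <= 0)%R%:R * kern (x, y))%:E)%E) ->
  (forall x, 0 < g x ->
     (be%:E <= \int[leb]_y (pos_part (\- g) y * kern (x, y))%:E)%E) ->
  2 * (al * \int[leb]_x (pos_part g x ^+ 2) + be * \int[leb]_x pos_part g x)
  <= form g (pos_part g).
Proof.
move=> al0 be0 mg fg i1 i2 hal hbe.
have mgp := measurable_pos_part mg.
have mgn : measurable_fun setT (pos_part (\- g)).
  by apply: measurable_pos_part; exact: measurableT_comp.
have mle0 := measurable_indic_le 0 mg.
have mfst h : measurable_fun setT h -> measurable_fun setT (fun z : V * V => h z.1 : R).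
  by move=> mh; exact: (measurableT_comp mh measurable_fst).
have msnd h : measurable_fun setT h -> measurable_fun setT (fun z : V * V => h z.2 : R).
  by move=> mh; exact: (measurableT_comp mh measurable_snd).
(* One half of the symmetric density: x is the point where g > 0, so Tonelli can integrate in y
   first. *)
pose H (z : V * V) : R :=
  (pos_part g z.1 ^+ 2 * (g z.2 <= 0)%R%:R + pos_part g z.1 * pos_part (\- g) z.2) * kern z.
have H0 z : 0 <= H z.
  by rewrite /H mulr_ge0 ?kern_ge0// addr_ge0// mulr_ge0 ?sqr_ge0 ?pos_part_ge0.
have mH : measurable_fun setT H.
  apply: measurable_funM; last exact: measurable_kern.
  apply: measurable_funD; apply: measurable_funM;
    try exact: (mfst _ mgp); try exact: (msnd _ mgn).
    by apply: measurable_funX; exact: (mfst _ mgp).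
  exact: (msnd _ mle0).
have mHE := measurable_EFin mH.
have HE0 z : (0 <= (H z)%:E)%E by rewrite lee_fin.
pose c := (al * \int[leb]_x (pos_part g x ^+ 2) + be * \int[leb]_x pos_part g x).
have icx : integ (fun x => al * pos_part g x ^+ 2 + be * pos_part g x).
  by apply: integD; exact: integZ.
have cH : (c%:E <= \int[leb2]_z (H z)%:E)%E.
  rewrite (fubini_tonelli1 _ mHE HE0).
  have -> : c = \int[leb]_x (al * pos_part g x ^+ 2 + be * pos_part g x).
    by rewrite RintegralD//; [rewrite !RintegralZl|exact: integZ|exact: integZ].
  rewrite RintegralE//; apply: ge0_le_integral => //.
  - by move=> x _; rewrite lee_fin addr_ge0// mulr_ge0 ?sqr_ge0 ?pos_part_ge0.
  - exact: measurable_int icx.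
  - exact: measurable_fun_fubini_tonelli_F mHE HE0.
  move=> x _; rewrite /fubini_F/= /H/=.
  have [gx|gx] := leP (g x) 0.
    rewrite /pos_part max_r// expr0n/= !mulr0 addr0.
    by apply: integral_ge0 => y _; rewrite lee_fin !mul0r addr0 mul0r.
  have gpx : pos_part g x = g x by rewrite /pos_part max_l// ltW.
  rewrite gpx.
  have mk : measurable_fun setT (fun y => kern (x, y)).
    by apply: (measurableT_comp measurable_kern); exact: measurable_pair1.
  pose h1 y : R := (g y <= 0)%R%:R * kern (x, y).
  pose h2 y : R := pos_part (\- g) y * kern (x, y).
  have mh1 : measurable_fun setT h1 by exact: measurable_funM.
  have mh2 : measurable_fun setT h2 by exact: measurable_funM.
  have h10 y : 0 <= h1 y by rewrite mulr_ge0 ?kern_ge0.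
  have h20 y : 0 <= h2 y by rewrite mulr_ge0 ?pos_part_ge0 ?kern_ge0.
  have L := ge0_integral_lin leb (sqr_ge0 (g x)) (ltW gx) mh1 mh2 h10 h20.
  rewrite (eq_integral (fun y => (g x ^+ 2 * h1 y + g x * h2 y)%:E)); last first.
    by move=> y _; rewrite mulrDl -!mulrA.
  rewrite L EFinD !EFinM [(al%:E * _)%E]muleC [(be%:E * _)%E]muleC; apply: leeD.
    by apply: lee_wpmul2l; [rewrite -EFinM lee_fin mulr_ge0// ltW|exact: hal].
  by apply: lee_wpmul2l; [rewrite lee_fin ltW|exact: hbe].
have iF := integ_form mg mgp fg (finite_gagliardo_pos_part mg fg).
apply: (Rintegral_symmetrized_ge iF mH H0) cH => x y.
rewrite (le_trans _ (form_pos_part_density g x y))//.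
by rewrite /H/= (kern_sym x y) -mulrDl.
Qed.

End gagliardo_form.

(** * Translations and the shear of the product space *)

Section translation_invariant.
Context {R : realType} {n : nat} (s : R).
Local Notation V := 'rV[R]_n.+1.
Implicit Types u v f g w : V -> R.
Variable leb : {sigma_finite_measure set V -> \bar R}.
Hypothesis leb_addr : forall (x : V) (A : set V), measurable A ->
  leb [set y | A (y + x)] = leb A.
Local Notation leb2 := (leb \x leb)%E.
Local Notation integ f := (leb.-integrable setT (EFin \o f)).
Local Notation integ2 f := (leb2.-integrable setT (EFin \o f)).
Local Notation p := (n.+1%:R + 2 * s).

Lemma ge0_integral_addr (x : V) (f : V -> \bar R) :
  measurable_fun setT f -> (forall y, (0 <= f y)%E) ->
  (\int[leb]_y f (y + x)%R = \int[leb]_y f y)%E.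
Proof.
move=> mf f0.
have := @ge0_integral_pushforward _ _ _ _ R _ (measurable_addr_rV x)
  leb setT f measurableT mf.
rewrite preimage_setT => <- //.
apply: eq_measure_integral; first exact: measurable_addr_rV.
by move=> m A mA _; exact: leb_addr.
Qed.

Let addr_ge0_preserving (x : V) f : measurable_fun setT f ->
  (forall y, 0 <= f y) ->
  (\int[leb]_y (f (y + x)%R)%:E = \int[leb]_y (f y)%:E)%E.
Proof.
move=> mf f0; apply: (ge0_integral_addr x (f := fun y => (f y)%:E)).
  exact: measurable_EFin.
by move=> y; rewrite lee_fin.
Qed.

Lemma integ_addr (x : V) f : integ f -> integ (fun y : V => f (y + x)).
Proof. exact: (integ_preserving (measurable_addr_rV x) (@addr_ge0_preserving x)). Qed.

Lemma Rintegral_addr (x : V) f : integ f ->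
  \int[leb]_y f (y + x) = \int[leb]_y f y.
Proof. exact: (Rintegral_preserving (measurable_addr_rV x) (@addr_ge0_preserving x)). Qed.

(** The change of variables (x, h) -> (x, x + h), after which the kernel depends on the increment h
    alone. *)
Definition shear (z : V * V) : V * V := (z.1, z.1 + z.2).

Lemma measurable_shear : measurable_fun setT shear.
Proof.
apply/measurable_fun_pairP; split; first exact: measurable_fst.
apply: measurable_fun_rVP => i.
rewrite (_ : (fun _ => _) = (fun z : V * V => z.1 0 i + z.2 0 i)); last first.
  by apply/funext => z; rewrite mxE.
apply: measurable_funD.
  exact: (measurableT_comp (measurable_coord i) measurable_fst).
exact: (measurableT_comp (measurable_coord i) measurable_snd).
Qed.

Lemma ge0_integral_shear (f : V * V -> R) : measurable_fun setT f ->
  (forall z, 0 <= f z) ->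
  (\int[leb2]_z (f (shear z))%:E = \int[leb2]_z (f z)%:E)%E.
Proof.
move=> mf f0.
rewrite (fubini_tonelli1 _ (measurable_EFin mf)); last by move=> z; rewrite lee_fin.
rewrite (fubini_tonelli1 _
  (measurable_EFin (measurableT_comp mf measurable_shear))); last first.
  by move=> z; rewrite lee_fin; exact: f0.
apply: eq_integral => x _; rewrite /fubini_F/=.
rewrite -[RHS](ge0_integral_addr x).
- by apply: eq_integral => y _; rewrite /shear/= addrC.
- by apply: measurable_EFin; apply: (measurableT_comp mf); exact: measurable_pair1.
- by move=> y; rewrite lee_fin.
Qed.

Lemma integ_shear (f : V * V -> R) : integ2 f -> integ2 (f \o shear).
Proof. exact: (integ_preserving measurable_shear ge0_integral_shear). Qed.

Lemma Rintegral_shear (f : V * V -> R) : integ2 f ->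
  \int[leb2]_z f (shear z) = \int[leb2]_z f z.
Proof. exact: (Rintegral_preserving measurable_shear ge0_integral_shear). Qed.

End translation_invariant.

(** * Kernel estimates *)

Section kernel_estimates.
Context {R : realType} {n : nat} (s : R).
Hypothesis hs0 : 0 < s.
Local Notation V := 'rV[R]_n.+1.
Implicit Types u v f g w : V -> R.
Variable leb : {sigma_finite_measure set V -> \bar R}.
Hypothesis leb_addr : forall (x : V) (A : set V), measurable A ->
  leb [set y | A (y + x)] = leb A.
Hypothesis leb_cube : forall (x : V) (r : R), 0 <= r ->
  leb (cube x r) = ((2 * r) ^+ n.+1)%:E.
Local Notation leb2 := (leb \x leb)%E.
Local Notation integ f := (leb.-integrable setT (EFin \o f)).
Local Notation integ2 f := (leb2.-integrable setT (EFin \o f)).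
Local Notation p := (n.+1%:R + 2 * s).

Lemma kern_shear (x h : V) : kern s (x, x + h) = kern s (h, 0).
Proof.
by rewrite /kern /kernel_den /= opprD addrA subrr sub0r enormN subr0.
Qed.

Lemma kern_cube_ge (x y : V) (r : R) : 0 < r -> x != y -> cube x r y ->
  ((n.+1%:R * r) `^ p)^-1 <= kern s (x, y).
Proof.
move=> r0 xy yx; apply: kern_lower => //; rewrite enormB_sym.
by apply: enorm_le_coord => i; rewrite !mxE; exact: yx.
Qed.

Lemma lebesgue_setD_ge (A B : set V) (a b : R) : measurable A -> measurable B ->
  (leb A <= a%:E)%E -> (b%:E <= leb B)%E -> ((b - a)%:E <= leb (B `\` A))%E.
Proof.
move=> mA mB Aa bB; rewrite EFinB leeBlDr//.
apply: (le_trans bB); apply: (@le_trans _ _ (leb ((B `\` A) `|` A))).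
  apply: le_measure; rewrite ?inE//.
    by apply: measurableU => //; exact: measurableD.
  by move=> x Bx; have [Ax|nAx] := pselect (A x); [right|left].
apply: (le_trans (measureU2 _ (measurableD mB mA) mA)).
by rewrite leeD2l.
Qed.

Lemma ge0_integral_cst_indic (b : R) (B : set V) : 0 <= b -> measurable B ->
  (\int[leb]_y (b * \1_B y)%:E = b%:E * leb B)%E.
Proof.
move=> b0 mB; under eq_integral do rewrite EFinM.
rewrite ge0_integralZl//; first by rewrite integral_indic// setIT.
  by apply: measurable_EFin; exact: measurable_indic.
Qed.

(** If A has at most half the volume of a cube of radius r, it leaves at least half of the cube
    about x uncovered. The kernel mass of that half is at least a multiple of r^(-2s), which is as
    large as desired for small r. *)
Lemma kern_compl_ge (L : R) : exists2 m : R, 0 < m &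
  forall A : set V, measurable A -> (leb A <= m%:E)%E ->
  forall x, A x -> (L%:E <= \int[leb]_y (\1_(~` A) y * kern s (x, y))%:E)%E.
Proof.
wlog L0 : L / 0 < L.
  move=> hL; have [|m m0 hm] := hL (Num.max L 1); first by rewrite lt_max ltr01 orbT.
  exists m => // A mA Am x Ax; apply: le_trans (hm A mA Am x Ax).
  by rewrite lee_fin le_max lexx.
have p0 := @kern_exp_gt0 R n s hs0.
have N0 : 0 < n.+1%:R `^ p :> R by rewrite powR_gt0.
pose c : R := (n.+1%:R `^ p)^-1 * 2 ^+ n.
have c0 : 0 < c by rewrite mulr_gt0 ?invr_gt0 ?exprn_gt0.
(* Half the volume of the cube times the lower bound ((n+1) r)^-(N+2s) of the kernel is c r^(-2s); r
   is chosen to make this L. *)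
pose r : R := (c / L) `^ ((2 * s)^-1).
have r0 : 0 < r by rewrite powR_gt0// divr_gt0.
have rs : r `^ (2 * s) = c / L.
  rewrite /r -powRrM mulVf ?powRr1 ?ltW ?divr_gt0//.
  by rewrite mulf_neq0// gt_eqF.
have rp : r `^ p = r ^+ n.+1 * (c / L).
  rewrite powRD; last by apply/implyP => /eqP h; rewrite gt_eqF.
  by rewrite powR_mulrn ?(ltW r0)// rs.
pose m : R := (2 * r) ^+ n.+1 / 2.
have m0 : 0 < m by rewrite divr_gt0// exprn_gt0// mulr_gt0.
exists m => // A mA Am x Ax.
pose b : R := ((n.+1%:R * r) `^ p)^-1.
have b0 : 0 <= b by rewrite invr_ge0 powR_ge0.
have mC : measurable (cube x r `\` A).
  by apply: measurableD => //; exact: measurable_cube.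
apply: (@le_trans _ _ (\int[leb]_y (b * \1_(cube x r `\` A) y)%:E)%E).
  rewrite ge0_integral_cst_indic//.
  apply: (@le_trans _ _ (b%:E * m%:E)%E).
    rewrite -EFinM lee_fin /b /m powRM ?ler0n ?(ltW r0)//.
    rewrite rp exprMn !exprS.
    rewrite (_ : (_ * _)^-1 * _ = L); first by [].
    rewrite /c; move: N0 (exprn_gt0 n r0) (exprn_gt0 n (ltr0n R 2)) => /=.
    move: (n.+1%:R `^ _) (r ^+ n) (2 ^+ n) => X Y Z X0 Y0 Z0.
    by field; rewrite !gt_eqF.
  apply: lee_wpmul2l; first by rewrite lee_fin.
  rewrite (_ : m = (2 * r) ^+ n.+1 - m); last by rewrite /m; field.
  apply: lebesgue_setD_ge => //; first exact: measurable_cube.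
  by rewrite leb_cube// ltW.
apply: ge0_le_integral => //.
- by move=> y _; rewrite lee_fin mulr_ge0// indicE.
- by apply: measurable_EFin; apply: measurable_funM => //; exact: measurable_indic.
- apply: measurable_EFin; apply: measurable_funM.
    by apply: measurable_indic; exact: measurableC.
  by apply: (measurableT_comp (measurable_kern s)); exact: measurable_pair1.
move=> y _; rewrite lee_fin !indicE.
have [[yx yA]|h] := pselect ((cube x r `\` A) y).
  rewrite mem_set//= mulr1 mem_set//= mul1r; apply: kern_cube_ge => //.
  by apply/eqP => xy; apply: yA; rewrite -xy.
by rewrite memNset//= mulr0 mulr_ge0// kern_ge0.
Qed.

Definition sqr_diff w (h : V) : R := \int[leb]_x (w x - w (x + h)) ^+ 2.

Lemma integ_sqr_diff w h : measurable_fun setT w ->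
  integ (fun x => w x ^+ 2) -> integ (fun x => (w x - w (x + h)) ^+ 2).
Proof.
move=> mw w2; have w2h := integ_addr leb_addr h w2.
apply: (integ_le (integZ 2 (integD w2 w2h))).
  apply: measurable_funX; apply: measurable_funB => //.
  exact: (measurableT_comp mw (measurable_addr_rV h)).
move=> x; rewrite ger0_norm ?sqr_ge0//; have := sqr_ge0 (w x + w (x + h)).
by rewrite sqrrB sqrrD; lra.
Qed.

Lemma sqr_diff_ge0 w h : 0 <= sqr_diff w h.
Proof. by apply: Rintegral_ge0 => x _; exact: sqr_ge0. Qed.

Lemma sqr_diff_far w h : measurable_fun setT w -> integ (fun x => w x ^+ 2) ->
  (forall x, w x * w (x + h) = 0) ->
  sqr_diff w h = 2 * \int[leb]_x (w x ^+ 2).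
Proof.
move=> mw w2 w0; have w2h := integ_addr leb_addr h w2.
transitivity (\int[leb]_x (w x ^+ 2 + w (x + h) ^+ 2)).
  by apply: eq_Rintegral => x _; rewrite sqrrB w0 mul0rn subr0.
rewrite RintegralD//.
by rewrite (Rintegral_addr leb_addr h w2) mulrDl mul1r.
Qed.

(** The squared triangle inequality in L^2 for j+1 successive translations. With t = j+1, the Young
    weights 1 + 1/t and 1 + t reproduce the square exactly: (1 + 1/t) t^2 + (1 + t) = (t + 1)^2. *)
Lemma sqr_diff_iter w h j : measurable_fun setT w ->
  integ (fun x => w x ^+ 2) ->
  sqr_diff w (h *+ j.+1) <= j.+1%:R ^+ 2 * sqr_diff w h.
Proof.
move=> mw w2; elim: j => [|j ih]; first by rewrite mulr1n expr1n mul1r.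
have t0 : 0 < j.+1%:R :> R by [].
set t : R := j.+1%:R in t0 ih *; set k := h *+ j.+1 in ih *.
have i1 := integ_sqr_diff k mw w2.
have i2 := integ_addr leb_addr k (integ_sqr_diff h mw w2).
apply: (@le_trans _ _ (\int[leb]_x ((1 + t^-1) * (w x - w (x + k)) ^+ 2 +
    (1 + t) * (w (x + k) - w (x + k + h)) ^+ 2))).
  apply: le_RintegralT; first exact: integ_sqr_diff.
    by apply: integD; exact: integZ.
  move=> x; rewrite mulrSr addrA -/k.
  move: (w x) (w (x + k)) (w (x + k + h)) => a b c.
  rewrite -subr_ge0 (_ : _ - _ = (a - b - t * (b - c)) ^+ 2 / t).
    by rewrite divr_ge0 ?sqr_ge0// ltW.
  by field; rewrite gt_eqF.
rewrite RintegralD//; [|exact: integZ|exact: integZ].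
rewrite !RintegralZl// (Rintegral_addr leb_addr k (integ_sqr_diff h mw w2)).
rewrite -/(sqr_diff w k) -/(sqr_diff w h).
have -> : j.+2%:R = 1 + t :> R by rewrite -natr1 addrC.
apply: (@le_trans _ _ ((1 + t^-1) * (t ^+ 2 * sqr_diff w h) + (1 + t) * sqr_diff w h)).
  by rewrite lerD2r ler_wpM2l// addr_ge0// invr_ge0 ltW.
by rewrite le_eqVlt; apply/orP; left; apply/eqP; field; rewrite gt_eqF.
Qed.

(** Beyond distance D the products w(x) w(x + h) vanish and the difference is 2 \int w^2. A shorter
    h is repeated until it passes D, and [sqr_diff_iter] bounds the cost of the repetition. *)
Lemma sqr_diff_ge w (D : R) : measurable_fun setT w ->
  integ (fun x => w x ^+ 2) -> 0 < D -> 0 < \int[leb]_x (w x ^+ 2) ->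
  (forall x h, D < enorm h -> w x * w (x + h) = 0) ->
  exists2 c : R, 0 < c & forall h, c * Num.min (enorm h ^+ 2) 1 <= sqr_diff w h.
Proof.
move=> mw w2 D0 W0 wD; set W := \int[leb]_x (w x ^+ 2) in W0 *.
pose c := Num.min (2 * W) (W / (2 * D ^+ 2)).
have c0 : 0 < c by rewrite lt_min mulr_gt0//= divr_gt0// mulr_gt0// exprn_gt0.
exists c => // h; have [hD|hD] := ltP D (enorm h).
  rewrite (sqr_diff_far mw w2) => [|x]; last exact: wD.
  apply: (@le_trans _ _ (c * 1)); first by rewrite ler_pM2l// ge_min lexx orbT.
  by rewrite mulr1 ge_min lexx.
have [h0|h0] := eqVneq (enorm h) 0.
  by rewrite h0 expr0n/= min_l// mulr0 sqr_diff_ge0.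
have hp : 0 < enorm h by rewrite lt_def h0 enorm_ge0.
(* Then (j+1) |h| > D, while j+1 <= 2 D / |h| because |h| <= D. *)
pose j := Num.truncn (D / enorm h).
have jl : j%:R <= D / enorm h by rewrite truncn_le// divr_ge0// ltW.
have jg : D / enorm h < j.+1%:R by exact: truncnS_gt.
have jle : j.+1%:R <= 2 * D / enorm h.
  rewrite -natr1 -mulrA mulrDl mul1r lerD// ler_pdivlMr// mul1r.
  exact: hD.
have := sqr_diff_iter h j mw w2.
rewrite (sqr_diff_far mw w2) => [|x]; last first.
  apply: wD; rewrite -scaler_nat enormZ ger0_norm//.
  by rewrite -ltr_pdivrMr.
rewrite -/W => le1.
have le2 : 2 * W <= (2 * D / enorm h) ^+ 2 * sqr_diff w h.
  apply: (le_trans le1); apply: ler_wpM2r; first exact: sqr_diff_ge0.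
  by rewrite ler_pXn2r ?nnegrE// !mulr_ge0 ?invr_ge0 ?(ltW D0) ?(ltW hp).
apply: (@le_trans _ _ (W / (2 * D ^+ 2) * enorm h ^+ 2)).
  apply: ler_pM; rewrite ?(ltW c0)//.
  - by rewrite le_min sqr_ge0 ler01.
  - by rewrite ge_min lexx orbT.
  - by rewrite ge_min lexx.
rewrite -(ler_pM2l (x := (2 * D / enorm h) ^+ 2)); last first.
  by rewrite exprn_gt0// !(mulr_gt0, divr_gt0, invr_gt0).
apply: le_trans le2; rewrite le_eqVlt; apply/orP; left; apply/eqP.
by field; rewrite !gt_eqF.
Qed.

Definition kern_weight (h : V) : R := Num.min (enorm h ^+ 2) 1 * kern s (h, 0).

Lemma measurable_kern_weight : measurable_fun setT kern_weight.
Proof.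
apply: measurable_funM.
  apply: measurable_minr => //; apply: measurable_funX; exact: measurable_enorm.
by apply: (measurableT_comp (measurable_kern s)); exact: measurable_pair2.
Qed.

Lemma kern_weight_ge0 h : 0 <= kern_weight h.
Proof. by rewrite mulr_ge0 ?kern_ge0// le_min sqr_ge0 ler01. Qed.

(* A nonzero compactly supported function of finite Gagliardo seminorm forces
   the integrability of [min(|h|^2, 1) / |h|^(N+2s)], since its translates move
   in [L^2] by at least [c min(|h|, 1)]. *)
Lemma integ_kern_weight w (D : R) : measurable_fun setT w ->
  integ (fun x => w x ^+ 2) -> finite_gagliardo s leb w ->
  0 < D -> 0 < \int[leb]_x (w x ^+ 2) ->
  (forall x h, D < enorm h -> w x * w (x + h) = 0) ->
  integ kern_weight.
Proof.
move=> mw w2 gw D0 W0 wD.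
have [c c0 hc] := sqr_diff_ge mw w2 D0 W0 wD.
(* After the shear, Fubini writes the squared seminorm as an integral over the increments h. *)
have i1 : integ (fun h => sqr_diff w h * kern s (h, 0)).
  apply: eq_integrable (integrable_fubini_F (integ_swap (integ_shear leb_addr gw))) => //.
  move=> h _; rewrite /fubini_F /= /shear/=; symmetry.
  have i2 : integ (fun x => kern s (h, 0) * (w x - w (x + h)) ^+ 2).
    by apply: integZ; exact: integ_sqr_diff.
  transitivity (\int[leb]_x (kern s (h, 0) * (w x - w (x + h)) ^+ 2))%:E.
    by rewrite (RintegralZl _ measurableT (integ_sqr_diff h mw w2)) mulrC.
  rewrite (RintegralE i2).
  by apply: eq_integral => x _; rewrite form_densityE/= kern_shear expr2 mulrC.
apply: (integ_le (integZ c^-1 i1)); first exact: measurable_kern_weight.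
move=> h; rewrite ger0_norm ?kern_weight_ge0// mulrA ler_wpM2r ?kern_ge0//.
by rewrite ler_pdivlMl.
Qed.

Lemma kernE (x y : V) : kern s (x, y) = kern s (y - x, 0).
Proof. by rewrite -(kern_shear x) addrC subrK. Qed.

Lemma integ_shear_inv (f : V * V -> R) : measurable_fun setT f ->
  integ2 (f \o shear) -> integ2 f.
Proof.
move=> mf fi; apply/integrableP; split; first exact: measurable_EFin.
have mn : measurable_fun setT (fun z => `|f z|) by exact: measurableT_comp.
have := integ_lty (integ_norm fi).
by rewrite /= (ge0_integral_shear leb_addr mn).
Qed.

(** Sheared, the integrand is the tensor product a(x) b(h). *)
Lemma integ_convol (a b : V -> R) : integ a -> integ b ->
  integ2 (fun z => a z.1 * b (z.2 - z.1)).
Proof.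
move=> ia ib; apply: integ_shear_inv.
  apply: measurable_funM.
    exact: (measurableT_comp (integ_measurable ia) measurable_fst).
  apply: (measurableT_comp (integ_measurable ib)).
  exact: (measurableT_comp (@measurable_rV_sub R n) (@measurable_swap_pair _ V)).
apply: eq_integrable (integ_prod_mul ia ib) => //.
by move=> [x h] _; rewrite /shear/= addrC addKr.
Qed.

Lemma integ_convol_sym (a b : V -> R) : integ a -> integ b ->
  integ2 (fun z => a z.1 * b (z.2 - z.1) + a z.2 * b (z.1 - z.2)).
Proof.
move=> ia ib; have ic := integ_convol ia ib.
exact: (integD ic (integ_swap ic)).
Qed.

Hypothesis ikw : integ kern_weight.

Lemma integ_kern_tail (rho : R) : 0 < rho ->
  integ (fun h => \1_[set h | rho < enorm h] h * kern s (h, 0)).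
Proof.
move=> r0; pose c := Num.min (rho ^+ 2) 1.
have c0 : 0 < c by rewrite lt_min exprn_gt0// ltr01.
apply: (integ_le (integZ c^-1 ikw)).
  apply: measurable_funM.
    by apply: measurable_indic; apply: measurable_ssuperlevel; exact: measurable_enorm.
  by apply: (measurableT_comp (measurable_kern s)); exact: measurable_pair2.
move=> h; rewrite indicE.
have [hr|hr] := ltP rho (enorm h).
  rewrite mem_set//= mul1r ger0_norm ?kern_ge0// mulrA ler_peMl ?kern_ge0//.
  rewrite ler_pdivlMl// mulr1 le_min /c.
  rewrite ge_min ler_pXn2r ?nnegrE ?enorm_ge0 ?(ltW r0) ?(ltW hr)//=.
  by rewrite ge_min lexx orbT.
rewrite memNset/=; last by apply/negP; rewrite -leNgt.
by rewrite mul0r normr0 mulr_ge0 ?kern_weight_ge0// invr_ge0 ltW.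
Qed.

(** For pairs farther apart than rho, (f(x) - f(y))^2 <= 2 f(x)^2 + 2 f(y)^2, and the tail of the
    kernel is integrable. *)
Lemma finite_gagliardo_near f (rho : R) : 0 < rho -> measurable_fun setT f ->
  integ (fun x => f x ^+ 2) ->
  integ2 (fun z => \1_[set z | enorm (z.1 - z.2) <= rho] z * form_density s f f z) ->
  finite_gagliardo s leb f.
Proof.
move=> r0 mf f2 near.
have far := integZ 2 (integ_convol_sym f2 (integ_kern_tail r0)).
apply: (integ_le (integD near far)); first exact: measurable_form_density.
move=> [x y]; rewrite form_densityE -expr2 ger0_norm; last first.
  by rewrite mulr_ge0 ?sqr_ge0 ?kern_ge0.
rewrite /= !indicE -!kernE (kern_sym s x y).
have k0 := kern_ge0 s (x, y).
have [xy|xy] := leP (enorm (x - y)) rho.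
  rewrite mem_set//= mul1r lerDl.
  by rewrite mulr_ge0// addr_ge0// mulr_ge0 ?sqr_ge0// mulr_ge0.
rewrite memNset//=; last by apply/negP; rewrite -ltNge.
have yx : rho < enorm (y - x) by rewrite enormB_sym.
rewrite mul0r add0r !mem_set//=.
rewrite !mul1r -mulrDl mulrA ler_wpM2r//.
have := sqr_ge0 (f x + f y); rewrite sqrrB sqrrD; lra.
Qed.

(** * A truncated paraboloid as a lower barrier *)

Section hat.
Variables (x0 : V) (r : R).
Hypothesis r0 : 0 < r.

Definition hat (x : V) : R := Num.max (r ^+ 2 - enorm (x - x0) ^+ 2) 0.

Lemma hat_ge0 x : 0 <= hat x.
Proof. by rewrite le_max lexx orbT. Qed.

Lemma hat_le x : hat x <= r ^+ 2.
Proof. by rewrite ge_max sqr_ge0 andbT lerBlDr lerDl sqr_ge0. Qed.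

Lemma measurable_hat : measurable_fun setT hat.
Proof.
apply: measurable_maxr => //; apply: measurable_funB => //.
apply: measurable_funX; apply: (measurableT_comp (@measurable_enorm R n.+1)).
exact: measurable_addr_rV.
Qed.

Lemma hat_out x : r <= enorm (x - x0) -> hat x = 0.
Proof.
move=> h; rewrite /hat max_r// subr_le0 ler_pXn2r ?nnegrE ?enorm_ge0//.
exact: ltW.
Qed.

Lemma hat_outside_cube x : ~ cube x0 r x -> hat x = 0.
Proof.
move=> h; apply: hat_out; rewrite leNgt; apply/negP => xr; apply: h => i.
have := normr_coord_le_enorm (x - x0) i; rewrite !mxE => /le_trans; apply.
exact: ltW.
Qed.

Lemma hat_lip x y : `|hat x - hat y| <= 2 * r * enorm (x - y).
Proof.
have key a b : enorm (a - x0) <= enorm (b - x0) ->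
    `|hat a - hat b| <= 2 * r * enorm (a - b).
  move=> ab; have tri : enorm (b - x0) <= enorm (a - x0) + enorm (a - b).
    by have := ler_enormD (a - x0) (b - a); rewrite addrC addrA subrK (enormB_sym b a).
  have [ar|ar] := leP r (enorm (a - x0)).
    rewrite !hat_out ?(le_trans ar)// subrr normr0 mulr_ge0 ?enorm_ge0//.
    by rewrite mulr_ge0// ltW.
  move: (enorm_ge0 (a - x0)) (enorm_ge0 (a - b)) ab tri ar; rewrite /hat.
  move: (enorm (a - x0)) (enorm (b - x0)) (enorm (a - b)) => A B D A0 D0 AB BAD Ar.
  rewrite (max_l (x := r ^+ 2 - A ^+ 2)); last first.
    by rewrite subr_ge0 ler_pXn2r ?nnegrE ?(ltW r0) ?(ltW Ar).
  have [Br|Br] := ltP B r.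
    rewrite max_l; last first.
      by rewrite subr_ge0 ler_pXn2r ?nnegrE ?(ltW r0) ?(ltW Br) ?(le_trans A0 AB).
    rewrite ger0_norm; last first.
      rewrite subr_ge0 lerD2l lerN2 ler_pXn2r ?nnegrE ?(le_trans A0 AB)//.
    rewrite (_ : _ - _ = (B - A) * (B + A)); last by ring.
    have B0 := le_trans A0 AB.
    by rewrite mulrC; apply: ler_pM; lra.
  rewrite max_r; last first.
    by rewrite subr_le0 ler_pXn2r ?nnegrE ?(ltW r0) ?(le_trans A0 AB).
  rewrite subr0 ger0_norm; last by rewrite subr_ge0 ler_pXn2r ?nnegrE ?(ltW r0) ?(ltW Ar).
  rewrite (_ : _ - _ = (r + A) * (r - A)); last by ring.
  by apply: ler_pM; lra.
have [h|h] := leP (enorm (x - x0)) (enorm (y - x0)); first exact: key.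
by rewrite distrC enormB_sym; apply: key; exact: ltW.
Qed.

(** By the parallelogram identity the untruncated paraboloid gives exactly 2 |h|^2. Truncation
    changes nothing at x and can only raise the values at x + h and x - h, so the one-sided bound
    survives. For |h| > 1 the bound [hat] <= r^2 suffices. *)
Lemma hat_second_difference x h : enorm (x - x0) < r ->
  2 * hat x - hat (x + h) - hat (x - h) <= 2 * (1 + r ^+ 2) * Num.min (enorm h ^+ 2) 1.
Proof.
move=> xr.
have hx : hat x = r ^+ 2 - enorm (x - x0) ^+ 2.
  by rewrite /hat max_l// subr_ge0 ler_pXn2r ?nnegrE ?enorm_ge0 ?(ltW r0) ?(ltW xr).
have [h1|h1] := leP (enorm h ^+ 2) 1.
  apply: (@le_trans _ _ (2 * enorm h ^+ 2)); last first.
    by rewrite ler_wpM2r ?sqr_ge0// ler_peMr// lerDl sqr_ge0.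
  have l1 : r ^+ 2 - enorm (x + h - x0) ^+ 2 <= hat (x + h) by rewrite le_max lexx.
  have l2 : r ^+ 2 - enorm (x - h - x0) ^+ 2 <= hat (x - h) by rewrite le_max lexx.
  have par : enorm (x + h - x0) ^+ 2 + enorm (x - h - x0) ^+ 2 =
      2 * enorm (x - x0) ^+ 2 + 2 * enorm h ^+ 2.
    rewrite !enorm_sqr (addrAC x h) (addrAC x (- h)).
    rewrite !edotDl !edotDr !edotNl !edotNr !opprK; ring.
  by rewrite hx; lra.
have := hat_le x; have := hat_ge0 (x + h); have := hat_ge0 (x - h).
by have := sqr_ge0 r; lra.
Qed.

Lemma cube_lty x a : 0 <= a -> (leb (cube x a) < +oo)%E.
Proof. by move=> a0; rewrite leb_cube// ltry. Qed.

Lemma integ_cube : integ (\1_(cube x0 r) : V -> R).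
Proof.
apply: integ_indic; first exact: measurable_cube.
by apply: cube_lty; exact: ltW.
Qed.

Lemma integ_hat : integ hat.
Proof.
apply: (integ_le (g := fun x => r ^+ 2 * \1_(cube x0 r) x)).
- by apply: integZ; exact: integ_cube.
- exact: measurable_hat.
move=> x; rewrite ger0_norm ?hat_ge0// indicE.
have [xq|xq] := pselect (cube x0 r x); first by rewrite mem_set//= mulr1 hat_le.
by rewrite memNset//= mulr0 hat_outside_cube.
Qed.

Lemma finite_gagliardo_hat : finite_gagliardo s leb hat.
Proof.
have iq := integ_cube.
(* 4 r^2 is the squared Lipschitz constant, used for |x - y| <= 1; r^4 squares the range of [hat],
   used beyond. The difference vanishes unless x or y lies in the cube. *)
pose C := 4 * r ^+ 2 + r ^+ 4.
have C0 : 0 <= C by rewrite addr_ge0 ?mulr_ge0 ?exprn_ge0// ltW.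
apply: (integ_le (integZ C (integ_convol_sym iq ikw))).
  by apply: measurable_form_density; exact: measurable_hat.
move=> [x y]; rewrite form_densityE -expr2 ger0_norm; last first.
  by rewrite mulr_ge0 ?sqr_ge0 ?kern_ge0.
rewrite /kern_weight -!kernE (kern_sym s x y) /= (enormB_sym y x) -!mulrDl !mulrA.
rewrite ler_wpM2r ?kern_ge0//.
set m := Num.min _ _.
have m0 : 0 <= m by rewrite le_min sqr_ge0 ler01.
have d1 : (hat x - hat y) ^+ 2 <= C * m.
  rewrite /m; case: (leP (enorm (x - y) ^+ 2) 1) => xy1.
    apply: (@le_trans _ _ ((2 * r * enorm (x - y)) ^+ 2)).
      rewrite -real_normK ?num_real// ler_pXn2r ?nnegrE ?hat_lip//.
      by rewrite mulr_ge0 ?enorm_ge0// mulr_ge0// ltW.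
    rewrite exprMn ler_wpM2r ?sqr_ge0// /C exprMn -natrX lerDl.
    by rewrite exprn_ge0// ltW.
  rewrite mulr1 (@le_trans _ _ (r ^+ 4))// /C ?lerDr ?mulr_ge0 ?sqr_ge0 ?(ltW r0)//.
  rewrite (_ : 4 = 2 * 2)%N// exprM -real_normK ?num_real// ler_pXn2r ?nnegrE ?sqr_ge0//.
  rewrite ler_norml; have := hat_le x; have := hat_le y.
  by have := hat_ge0 x; have := hat_ge0 y; move=> *; apply/andP; split; lra.
rewrite !indicE.
have [xq|xq] := pselect (cube x0 r x).
  rewrite (mem_set xq)/= (le_trans d1)// ler_wpM2r// ler_peMr//.
  by rewrite lerDl ler0n.
have [yq|yq] := pselect (cube x0 r y).
  rewrite (mem_set yq)/= (le_trans d1)// ler_wpM2r// ler_peMr//.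
  by rewrite lerDr ler0n.
by rewrite !hat_outside_cube// subrr expr0n/= mulr_ge0// mulr_ge0.
Qed.

Lemma integ_bounded_mul (M : R) f g : measurable_fun setT f ->
  (forall x, `|f x| <= M) -> integ g -> integ (fun x => f x * g x).
Proof.
move=> mf fM ig; apply: (integ_le (integZ M (integ_norm ig))).
  by apply: measurable_funM => //; exact: (integ_measurable ig).
by move=> x; rewrite normrM ler_wpM2r.
Qed.

Lemma normr_hat_le x : `|hat x| <= r ^+ 2.
Proof. by rewrite ger0_norm ?hat_ge0 ?hat_le. Qed.

Lemma measurable_hat_addr h : measurable_fun setT (fun x : V => hat (x + h)).
Proof. exact: (measurableT_comp measurable_hat (measurable_addr_rV h)). Qed.

Lemma integ_hat_difference v h : integ v ->
  integ (fun x => (hat x - hat (x + h)) * (v x - v (x + h))).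
Proof.
move=> iv; apply: (integ_bounded_mul (M := 2 * r ^+ 2)).
- by apply: measurable_funB; [exact: measurable_hat|exact: measurable_hat_addr].
- move=> x; rewrite (le_trans (ler_normB _ _))// mulrDl mul1r.
  by rewrite lerD// normr_hat_le.
- by apply: integB => //; exact: (integ_addr leb_addr h iv).
Qed.

(** Discrete integration by parts: a translation by h moves the shift from v onto [hat]. *)
Lemma Rintegral_hat_difference v h : integ v ->
  \int[leb]_x ((hat x - hat (x + h)) * (v x - v (x + h))) =
  \int[leb]_x ((2 * hat x - hat (x + h) - hat (x - h)) * v x).
Proof.
move=> iv; have ivh := integ_addr leb_addr h iv.
have mhh := measurable_hat_addr.
have b1 : integ (fun x => hat x * v x).
  by apply: integ_bounded_mul iv; [exact: measurable_hat|exact: normr_hat_le].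
have b2 k : integ (fun x => hat (x + k) * v x).
  by apply: integ_bounded_mul iv; [exact: mhh|move=> x; exact: normr_hat_le].
have b3 : integ (fun x => hat (x + h) * v (x + h)) by exact: (integ_addr leb_addr h b1).
have b4 : integ (fun x => hat x * v (x + h)).
  by apply: integ_bounded_mul ivh; [exact: measurable_hat|exact: normr_hat_le].
transitivity (\int[leb]_x ((hat x * v x + hat (x + h) * v (x + h)) -
    (hat (x + h) * v x + hat x * v (x + h)))).
  by apply: eq_Rintegral => x _; ring.
rewrite RintegralB//; [|exact: integD|exact: integD].
rewrite RintegralD// RintegralD//.
have -> : \int[leb]_x (hat (x + h) * v (x + h)) = \int[leb]_x (hat x * v x).
  exact: (Rintegral_addr leb_addr h b1).
have -> : \int[leb]_x (hat x * v (x + h)) = \int[leb]_x (hat (x - h) * v x).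
  rewrite -(Rintegral_addr leb_addr h (b2 (- h))).
  by apply: eq_Rintegral => x _; rewrite addrK.
transitivity (\int[leb]_x (2 * (hat x * v x) - (hat (x + h) * v x + hat (x - h) * v x))).
  rewrite RintegralB//; [|exact: integZ|exact: integD].
  rewrite (RintegralZl _ measurableT b1) (RintegralD measurableT (b2 h) (b2 (- h))).
  by rewrite mulr_natl mulr2n.
by apply: eq_Rintegral => x _; ring.
Qed.

(* For each fixed [h], translation invariance moves the difference quotient
   onto a second difference of [hat], which is one-sidedly of order [|h|^2]
   where [hat] is positive; so no principal value is needed. *)
Lemma form_hat_le v : measurable_fun setT v -> integ v -> (forall x, 0 <= v x) ->
  finite_gagliardo s leb v -> (forall x, r <= enorm (x - x0) -> v x = 0) ->
  form s leb hat v <=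
  2 * (1 + r ^+ 2) * (\int[leb]_h kern_weight h) * \int[leb]_x v x.
Proof.
move=> mv iv v0 gv vout.
have iF := integ_form measurable_hat mv finite_gagliardo_hat gv.
have iG := integ_swap (integ_shear leb_addr iF).
(* The integral over x for a fixed increment h, where the kernel is a constant factor. *)
pose J (h : V) := kern s (h, 0) *
  \int[leb]_x ((hat x - hat (x + h)) * (v x - v (x + h))).
have JE (h : V) : (J h)%:E = (\int[leb]_x (form_density s hat v (x, x + h))%:E)%E.
  have i2 := integZ (kern s (h, 0)) (integ_hat_difference h iv).
  rewrite /J -(RintegralZl _ measurableT (integ_hat_difference h iv)) (RintegralE i2).
  by apply: eq_integral => x _; rewrite form_densityE kern_shear mulrC.
have iJ : integ J.
  by apply: eq_integrable (integrable_fubini_F iG) => // h _; rewrite /= JE.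
have -> : form s leb hat v = \int[leb]_h J h.
  rewrite /form -(Rintegral_shear leb_addr iF).
  have -> : \int[leb2]_z form_density s hat v (shear z) =
      \int[leb2]_z form_density s hat v (shear (z.2, z.1)).
    symmetry; exact: (Rintegral_preserving (@measurable_swap_pair _ V)
      (@ge0_integral_swap _ _ _ leb) (integ_shear leb_addr iF)).
  apply: EFin_inj; rewrite (RintegralE iG) (RintegralE iJ).
  have := integral12_prod_meas1 iG; rewrite /= => <-.
  by apply: eq_integral => h _; rewrite JE.
have iw := integZ (2 * (1 + r ^+ 2) * \int[leb]_x v x) ikw.
apply: (@le_trans _ _ (\int[leb]_h (2 * (1 + r ^+ 2) * (\int[leb]_x v x) * kern_weight h))).
  apply: le_RintegralT => // h.
  rewrite /J /kern_weight mulrA [leRHS]mulrC; apply: ler_wpM2l; first exact: kern_ge0.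
  rewrite (Rintegral_hat_difference h iv) mulrAC -RintegralZl//.
  have b : integ (fun x => (2 * hat x - hat (x + h) - hat (x - h)) * v x).
    apply: (integ_bounded_mul (M := 4 * r ^+ 2)) iv.
      apply: measurable_funB; last exact: measurable_hat_addr.
      apply: measurable_funB; last exact: measurable_hat_addr.
      by apply: measurable_funM => //; exact: measurable_hat.
    move=> x; rewrite ler_norml.
    have := hat_ge0 x; have := hat_ge0 (x + h); have := hat_ge0 (x - h).
    have := hat_le x; have := hat_le (x + h); have := hat_le (x - h).
    by move=> *; apply/andP; split; lra.
  apply: le_RintegralT => //; first exact: integZ.
  move=> x; have [xr|xr] := ltP (enorm (x - x0)) r; last by rewrite vout// !mulr0.
  by rewrite ler_wpM2r// hat_second_difference.
by rewrite (RintegralZl _ measurableT ikw) mulrAC.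
Qed.

End hat.

End kernel_estimates.

(** * The Dirichlet problem near the first eigenvalue *)

Section dirichlet_problem.
Context {R : realType} {n : nat} (s : R).
Hypothesis hs0 : 0 < s.
Local Notation V := 'rV[R]_n.+1.
Implicit Types u v f g w phi : V -> R.
Variable leb : {sigma_finite_measure set V -> \bar R}.
Hypothesis leb_addr : forall (x : V) (A : set V), measurable A ->
  leb [set y | A (y + x)] = leb A.
Hypothesis leb_cube : forall (x : V) (r : R), 0 <= r ->
  leb (cube x r) = ((2 * r) ^+ n.+1)%:E.
Local Notation leb2 := (leb \x leb)%E.
Local Notation integ f := (leb.-integrable setT (EFin \o f)).
Local Notation integ2 f := (leb2.-integrable setT (EFin \o f)).
Variables (Omega : set V) (D K : R).
Hypothesis D0 : 0 < D.
Hypothesis OmegaD : Omega `<=` cube 0 D.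
Hypothesis K0 : 0 < K.
Local Notation Q := (cube (0 : V) D).

(** The concrete form of [Ws2_tilde] for an abstract measure; [Ws2_tildeP] identifies the two. *)
Definition test_space u : Prop :=
  [/\ measurable_fun setT u, forall x, ~ Omega x -> u x = 0,
      integ (fun x => u x ^+ 2) & finite_gagliardo s leb u].

Lemma cube_finite : (leb Q < +oo)%E.
Proof. by rewrite leb_cube ?ltry// ltW. Qed.

Lemma test_space_integ u : test_space u -> integ u.
Proof.
move=> [mu u0 u2 _]; apply: (integ_sqr_supp (measurable_cube _ _) cube_finite) => //.
by move=> x xQ; apply: u0 => /OmegaD.
Qed.

Lemma test_space_integM u v : test_space u -> test_space v ->
  integ (fun x => u x * v x).
Proof. by move=> [mu _ u2 _] [mv _ v2 _]; exact: integ_mul. Qed.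

Lemma test_spaceZ a u : test_space u -> test_space (fun x => a * u x).
Proof.
move=> [mu u0 u2 gu]; split; first exact: measurable_funM.
- by move=> x /u0 ->; rewrite mulr0.
- by apply: eq_integrable (integZ (a ^+ 2) u2) => // x _; rewrite /= exprMn.
- exact: finite_gagliardoZ.
Qed.

Lemma test_space_lip (L : R) u v f : test_space u -> test_space v ->
  measurable_fun setT f -> (forall x, ~ Omega x -> f x = 0) ->
  (forall x, `|f x| <= L * (`|u x| + `|v x|)) ->
  (forall x y, `|f x - f y| <= L * (`|u x - u y| + `|v x - v y|)) ->
  test_space f.
Proof.
move=> [mu u0 u2 gu] [mv v0 v2 gv] mf f0 fL fL'; split => //.
  apply: (integ_le (integZ (2 * L ^+ 2) (integD u2 v2))).
    exact: measurable_funX.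
  move=> x; rewrite ger0_norm ?sqr_ge0// -real_normK ?num_real//.
  rewrite -(real_normK (num_real (u x))) -(real_normK (num_real (v x))).
  have l0 := le_trans (normr_ge0 _) (fL x).
  apply: (@le_trans _ _ ((L * (`|u x| + `|v x|)) ^+ 2)).
    by rewrite ler_pXn2r ?nnegrE.
  rewrite exprMn (_ : 2 * _ * _ = L ^+ 2 * (2 * (`|u x| ^+ 2 + `|v x| ^+ 2))); last by ring.
  apply: ler_wpM2l; first exact: sqr_ge0.
  by have := sqr_ge0 (`|u x| - `|v x|); rewrite sqrrB sqrrD; lra.
exact: (finite_gagliardo_lip mf gu gv fL').
Qed.

Lemma test_spaceD u v : test_space u -> test_space v ->
  test_space (fun x => u x + v x).
Proof.
move=> hu hv; have [mu u0 _ _] := hu; have [mv v0 _ _] := hv.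
apply: (test_space_lip (L := 1) hu hv); first exact: measurable_funD.
- by move=> x xO; rewrite u0// v0// addr0.
- by move=> x; rewrite mul1r ler_normD.
- by move=> x y; rewrite mul1r opprD addrACA ler_normD.
Qed.

Lemma test_spaceN u : test_space u -> test_space (fun x => - u x).
Proof.
move=> /(test_spaceZ (-1)); congr test_space; apply/funext => x.
by rewrite mulN1r.
Qed.

Lemma test_space_form_integ u v : test_space u -> test_space v ->
  integ2 (form_density s u v).
Proof. by move=> [mu _ _ gu] [mv _ _ gv]; exact: integ_form. Qed.

Lemma test_formDl u u' v : test_space u -> test_space u' -> test_space v ->
  form s leb (fun x => u x + u' x) v = form s leb u v + form s leb u' v.
Proof. by move=> [? _ _ ?] [? _ _ ?] [? _ _ ?]; exact: formDl. Qed.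

Lemma test_formZl a u v : test_space u -> test_space v ->
  form s leb (fun x => a * u x) v = a * form s leb u v.
Proof. by move=> [? _ _ ?] [? _ _ ?]; exact: formZl. Qed.

Lemma test_space_pos_part g u : test_space u -> measurable_fun setT g ->
  (forall x, ~ Omega x -> g x <= 0) ->
  (forall x, pos_part g x <= `|u x|) ->
  (forall x y, `|g x - g y| <= `|u x - u y|) ->
  test_space (pos_part g).
Proof.
move=> hu mg g0 gu gl.
apply: (test_space_lip (L := 1) hu hu); first exact: measurable_pos_part.
- by move=> x /g0 gx; rewrite /pos_part max_r.
- move=> x; rewrite mul1r ger0_norm ?pos_part_ge0// (le_trans (gu x))//.
  by rewrite lerDl.
- move=> x y; rewrite mul1r (le_trans (pos_part_lip _ _ _))//.
  by rewrite (le_trans (gl x y))// lerDl.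
Qed.

Lemma pos_part_eq0_le g x : pos_part g x = 0 -> g x <= 0.
Proof. by move=> h; rewrite -h le_max lexx. Qed.

Lemma pos_part_norm_le g x : pos_part g x <= `|g x|.
Proof. by rewrite /pos_part ge_max ler_norm normr_ge0. Qed.

Lemma Rintegral_pos_part_le0 g : integ (pos_part g) ->
  \int[leb]_x pos_part g x <= 0 -> {ae leb, forall x, g x <= 0}.
Proof.
move=> ig le0; have := Rintegral_le0_ae ig (pos_part_ge0 g) le0.
by apply: filterS => x; exact: pos_part_eq0_le.
Qed.

(** The weak form of (-Delta)^s u <= lam u + M, with K times the form standing for the operator. *)
Definition subsolution (lam M : R) u : Prop :=
  forall phi, test_space phi -> (forall x, 0 <= phi x) ->
  K * form s leb u phi <= lam * \int[leb]_x (u x * phi x) + M * \int[leb]_x phi x.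

(* Testing with [(u - c)^+], the nonlocal tail alone (no iteration) absorbs the
   right-hand side once [u > c/2] on a sufficiently small set only. *)
Lemma subsolution_bounded (Lam M W : R) : 0 <= Lam -> 0 <= M -> 0 <= W ->
  exists2 c : R, 0 < c & forall (lam : R) u, lam <= Lam -> test_space u ->
    subsolution lam M u -> \int[leb]_x (u x ^+ 2) <= W ->
    {ae leb, forall x, u x <= c}.
Proof.
(* K [kap] exceeds Lam + M by 1, so the kernel mass seen from {u > c} dominates the right-hand
   side. *)
move=> Lam0 M0 W0; pose kap := (Lam + M + 1) / K.
have kap0 : 0 < kap by rewrite divr_gt0// ltr_wpDl ?addr_ge0.
have [m m0 hm] := @kern_compl_ge R n s hs0 leb leb_cube kap.
(* As c >= 1, c^2 >= c >= 4 W / m, and Chebyshev's inequality gives {u > c/2} measure at most 4 W /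
   c^2 <= m. *)
pose c := 1 + 4 * W / m.
have Wm0 : 0 <= 4 * W / m by rewrite divr_ge0 ?mulr_ge0// ltW.
have c1 : 1 <= c by rewrite /c lerDl.
have c0 : 0 < c := lt_le_trans ltr01 c1.
exists c => // lam u lamLam hu hsub uW; have [mu u0 u2 gu] := hu.
pose A := [set x | c / 2 < u x].
have mA : measurable A by exact: measurable_ssuperlevel.
have Am : (leb A <= m%:E)%E.
  have : ((c ^+ 2 / 4)%:E * leb A <= W%:E)%E.
    rewrite -ge0_integral_cst_indic//; last by rewrite divr_ge0 ?sqr_ge0.
    apply: (@le_trans _ _ (\int[leb]_x (u x ^+ 2))%:E); last by rewrite lee_fin.
    rewrite (RintegralE u2); apply: ge0_le_integral => //.
    - by move=> x _; rewrite lee_fin mulr_ge0 ?divr_ge0 ?sqr_ge0// indicE.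
    - by apply: measurable_EFin; apply: measurable_funM => //; exact: measurable_indic.
    - by apply: measurable_EFin; exact: measurable_funX.
    move=> x _; rewrite lee_fin indicE; have [xA|xA] := pselect (A x).
      rewrite mem_set//= mulr1 (_ : _ / 4 = (c / 2) ^+ 2); last by field.
      have c2 : 0 <= c / 2 by rewrite divr_ge0// ltW.
      by rewrite ler_pXn2r ?nnegrE ?(le_trans c2)// ltW.
    by rewrite memNset//= mulr0 sqr_ge0.
  rewrite -lee_pdivlMl ?divr_gt0 ?exprn_gt0// -EFinM => /le_trans; apply.
  rewrite lee_fin ler_pdivrMl ?divr_gt0 ?exprn_gt0//.
  rewrite -ler_pdivrMr// (_ : W / m = (4 * W / m) / 4); last by field; rewrite gt_eqF.
  rewrite ler_pM2r ?invr_gt0// (@le_trans _ _ c)//; first by rewrite /c lerDr.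
  by rewrite expr2 ler_peMr// ltW.
pose g x := u x - c.
have mg : measurable_fun setT g by exact: measurable_funB.
have gE x y : g x - g y = u x - u y by rewrite /g; ring.
have hg : test_space (pos_part g).
  apply: (test_space_pos_part hu) => //.
  - by move=> x /u0 ux; rewrite /g ux sub0r oppr_le0 ltW.
  - move=> x; rewrite /pos_part /g ge_max normr_ge0 andbT.
    by rewrite lerBlDr (le_trans (ler_norm _))// lerDl ltW.
  - by move=> x y; rewrite gE.
have formE : form s leb g (pos_part g) = form s leb u (pos_part g).
  by apply: eq_Rintegral => -[x y] _; rewrite /form_density/= gE.
have ggag : finite_gagliardo s leb g.
  by apply: (finite_gagliardo_lip (L := 1) mg gu gu) => x y; rewrite gE mul1r lerDl.
have [mgp _ gp2 _] := hg; have igp := test_space_integ hg.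
have gA x : 0 < g x -> A x.
  rewrite /g subr_gt0 => /(le_lt_trans _); apply.
  by rewrite ler_pdivrMr// mulr_natr mulr2n lerDl ltW.
have mk x : measurable_fun setT (fun y => kern s (x, y)).
  by apply: (measurableT_comp (measurable_kern s)); exact: measurable_pair1.
have mAC : measurable_fun setT (\1_(~` A) : V -> R).
  by apply: measurable_indic; exact: measurableC.
have mng : measurable_fun setT (pos_part (\- g)).
  by apply: measurable_pos_part; exact: measurableT_comp.
(* The level c/2, rather than c, defines A so that g^- is at least c/2 off A: this feeds the tail
   term, not just the kernel mass. *)
have gneg y : (~` A) y -> g y <= - (c / 2).
  rewrite /g => /negP; rewrite -leNgt => uy; lra.
have hA x : 0 < g x ->
    (kap%:E <= \int[leb]_y ((g y <= 0)%R%:R * kern s (x, y))%:E)%E.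
  move=> gx; apply: (le_trans (hm A mA Am x (gA x gx))).
  apply: ge0_le_integral => //.
  + by move=> y _; rewrite lee_fin mulr_ge0 ?kern_ge0// indicE.
  + apply: measurable_EFin; apply: measurable_funM; [exact: mAC|exact: mk].
  + apply: measurable_EFin; apply: measurable_funM; [exact: measurable_indic_le|exact: mk].
  + move=> y _; rewrite lee_fin ler_wpM2r ?kern_ge0// indicE.
    have [yA|yA] := pselect ((~` A) y); last by rewrite memNset.
    by rewrite mem_set//= (le_trans (gneg _ yA))// oppr_le0 divr_ge0// ltW.
have hB x : 0 < g x ->
    ((kap * (c / 2))%:E <= \int[leb]_y (pos_part (\- g) y * kern s (x, y))%:E)%E.
  move=> gx; apply: (@le_trans _ _
    ((c / 2)%:E * \int[leb]_y (\1_(~` A) y * kern s (x, y))%:E)%E).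
    rewrite EFinM muleC; apply: lee_wpmul2l; first by rewrite lee_fin divr_ge0// ltW.
    exact: (hm A mA Am x (gA x gx)).
  rewrite -ge0_integralZl//.
  + apply: ge0_le_integral => //.
    * by move=> y _; rewrite -EFinM lee_fin !mulr_ge0 ?kern_ge0 ?invr_ge0 ?(ltW c0)// indicE.
    * by apply: emeasurable_funM => //; apply: measurable_EFin;
        apply: measurable_funM; [exact: mAC|exact: mk].
    * apply: measurable_EFin; apply: measurable_funM; [exact: mng|exact: mk].
    * move=> y _; rewrite -EFinM lee_fin mulrA ler_wpM2r ?kern_ge0// indicE.
      have [yA|yA] := pselect ((~` A) y); last by rewrite memNset// mulr0 pos_part_ge0.
      by rewrite mem_set//= mulr1 /pos_part le_max lerNr gneg.
  + apply: measurable_EFin; apply: measurable_funM; [exact: mAC|exact: mk].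
  + by move=> y _; rewrite lee_fin mulr_ge0 ?kern_ge0// indicE.
  + by rewrite lee_fin divr_ge0// ltW.
have := form_pos_part_ge (ltW kap0) (mulr_ge0 (ltW kap0) (divr_ge0 (ltW c0) (ler0n R 2)))
  mg ggag igp gp2 hA hB.
rewrite formE => core.
have := hsub _ hg (pos_part_ge0 g).
have -> : \int[leb]_x (u x * pos_part g x) =
    \int[leb]_x (pos_part g x ^+ 2) + c * \int[leb]_x pos_part g x.
  rewrite -(RintegralZl _ measurableT igp) -(RintegralD measurableT gp2 (integZ c igp)).
  apply: eq_Rintegral => x _; rewrite /pos_part /g; case: (leP (u x - c) 0) => _.
    by rewrite !mulr0 expr0n addr0.
  by ring.
set P2 := (\int[leb]_x (pos_part g x ^+ 2)) in core *.
set P1 := (\int[leb]_x pos_part g x) in core *.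
have P20 : 0 <= P2 by apply: Rintegral_ge0 => x _; exact: sqr_ge0.
have P10 : 0 <= P1 by apply: Rintegral_ge0 => x _; exact: pos_part_ge0.
move=> sub; suff : P1 <= 0.
  by move=> /(Rintegral_pos_part_le0 igp); apply: filterS => x; rewrite /g subr_le0.
(* The left side is at least (Lam + M + 1) (2 P2 + c P1), the right side at most Lam (P2 + c P1) + M
   c P1 since c >= 1; they differ by at least c P1 > 0. *)
rewrite leNgt; apply/negP => P1p.
have Kk : K * kap = Lam + M + 1 by rewrite /kap mulrC divfK// gt_eqF.
have h1 : K * (2 * (kap * P2 + kap * (c / 2) * P1)) <= K * form s leb u (pos_part g).
  by rewrite ler_pM2l.
have h1E : K * (2 * (kap * P2 + kap * (c / 2) * P1)) =
    (Lam + M + 1) * (2 * P2) + (Lam + M + 1) * (c * P1).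
  by rewrite -Kk; field.
have cP : 0 < c * P1 by rewrite mulr_gt0.
have h2 : lam * (P2 + c * P1) <= Lam * (P2 + c * P1).
  by rewrite ler_wpM2r// addr_ge0// ltW.
have h3 : M * P1 <= M * (c * P1) by rewrite ler_wpM2l// ler_peMl.
have LP : 0 <= Lam * P2 by rewrite mulr_ge0.
have MP : 0 <= M * P2 by rewrite mulr_ge0.
rewrite h1E in h1; have h4 := le_trans h1 sub.
move: (c * P1) cP h2 h3 h4 => X X0 h2 h3 h4.
by rewrite !mulrDr in h2; rewrite !mulrDr !mulrDl in h4; lra.
Qed.

Local Notation diamQ := (n.+1%:R * (2 * D)).
Local Notation kmin := ((diamQ `^ (n.+1%:R + 2 * s))^-1).

Lemma enorm_cube_le x y : Q x -> Q y -> enorm (x - y) <= diamQ.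
Proof.
move=> Qx Qy; apply: enorm_le_coord => i; rewrite !mxE.
have := Qx i; have := Qy i; rewrite !mxE !subr0 mulrDl mul1r => hy hx.
by rewrite (le_trans (ler_normB _ _))// lerD.
Qed.

Lemma kern_cube_lower x y : Q x -> Q y -> x != y -> kmin <= kern s (x, y).
Proof. by move=> Qx Qy xy; apply: kern_lower => //; exact: enorm_cube_le. Qed.

Lemma kmin_gt0 : 0 < kmin.
Proof. by rewrite invr_gt0 powR_gt0// !mulr_gt0. Qed.

(** E need not be close to x: every part of the bounded cube is seen from x through a kernel of at
    least [kmin]. *)
Lemma ge0_integral_kern_ge (E : set V) (h : V -> R) (a e0 : R) x :
  measurable E -> E `<=` Q -> Q x -> ~ E x ->
  measurable_fun setT h -> (forall y, 0 <= h y) -> 0 <= a ->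
  (forall y, E y -> a <= h y) -> (e0%:E <= leb E)%E ->
  ((a * kmin * e0)%:E <= \int[leb]_y (h y * kern s (x, y))%:E)%E.
Proof.
move=> mE EQ Qx Ex mh h0 a0 ha e0E.
have ak : 0 <= a * kmin by rewrite mulr_ge0// ltW// kmin_gt0.
apply: (@le_trans _ _ (\int[leb]_y (a * kmin * \1_E y)%:E)%E).
  by rewrite ge0_integral_cst_indic// EFinM lee_wpmul2l.
apply: ge0_le_integral => //.
- by move=> y _; rewrite lee_fin mulr_ge0// indicE.
- by apply: measurable_EFin; apply: measurable_funM => //; exact: measurable_indic.
- apply: measurable_EFin; apply: measurable_funM => //.
  by apply: (measurableT_comp (measurable_kern s)); exact: measurable_pair1.
move=> y _; rewrite lee_fin indicE; have [yE|yE] := pselect (E y).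
  rewrite mem_set//= mulr1; apply: ler_pM => //; first by rewrite ltW// kmin_gt0.
    exact: ha.
  apply: kern_cube_lower => //; first exact: EQ.
  by apply/eqP => xy; apply: Ex; rewrite xy.
by rewrite memNset//= mulr0 mulr_ge0 ?kern_ge0.
Qed.

(** * The eigenfunction as a comparison function *)

Section eigenfunction.
Variables (w : V -> R) (lam1 : R).
Hypothesis hw : test_space w.
Hypothesis w0 : forall x, 0 <= w x.
Hypothesis lam10 : 0 <= lam1.
Hypothesis eig : forall phi, test_space phi ->
  K * form s leb w phi = lam1 * \int[leb]_x (w x * phi x).
Hypothesis W0 : 0 < \int[leb]_x (w x ^+ 2).

Lemma form_eigen_ge0 phi : test_space phi -> (forall x, 0 <= phi x) ->
  0 <= form s leb w phi.
Proof.
move=> hphi phi0; rewrite -(pmulr_rge0 _ K0) eig// mulr_ge0//.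
by apply: Rintegral_ge0 => x _; rewrite mulr_ge0.
Qed.

Lemma eigen_supp x : w x != 0 -> Q x.
Proof.
move=> wx; apply: OmegaD; have [//|xO] := pselect (Omega x).
by have [_ /(_ _ xO) h _ _] := hw; rewrite h eqxx in wx.
Qed.

(** w(x) and w(x + h) cannot both be nonzero once |h| exceeds the diameter bound of the cube
    containing Omega. *)
Lemma eigen_integ_kern_weight : integ (kern_weight s).
Proof.
have [mw _ w2 gw] := hw.
apply: (integ_kern_weight leb_addr (D := diamQ) mw w2 gw) => //.
  by rewrite !mulr_gt0.
move=> x h hD; have [->|wx] := eqVneq (w x) 0; first by rewrite mul0r.
have [->|wxh] := eqVneq (w (x + h)) 0; first by rewrite mulr0.
have := enorm_cube_le (eigen_supp wx) (eigen_supp wxh).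
by rewrite opprD addrA subrr sub0r enormN leNgt hD.
Qed.

(** If {w >= a} were null, \int w^2 would be at most a^2 times the volume q of the cube; a is chosen
    to make that product half of \int w^2. *)
Lemma eigen_superlevel : exists2 a : R, 0 < a &
  exists2 e0 : R, 0 < e0 & (e0%:E <= leb [set x : V | (a <= w x)%R])%E.
Proof.
have [mw _ w2 _] := hw.
pose W := \int[leb]_x (w x ^+ 2); have W0' : 0 < W := W0.
pose q : R := (2 * D) ^+ n.+1.
have q0 : 0 < q by rewrite exprn_gt0// mulr_gt0.
pose a := Num.sqrt (W / (2 * q)).
have a0 : 0 < a by rewrite sqrtr_gt0 divr_gt0// mulr_gt0.
have a2 : a ^+ 2 = W / (2 * q) by rewrite sqr_sqrtr// divr_ge0 ?mulr_ge0// ltW.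
exists a => //; pose E := [set x | a <= w x].
have mE : measurable E by exact: measurable_superlevel.
have EQ : E `<=` Q by move=> x ax; apply: eigen_supp; rewrite gt_eqF// (lt_le_trans a0).
have Efin : leb E \is a fin_num.
  rewrite ge0_fin_numE//; apply: le_lt_trans cube_finite.
  by apply: le_measure; rewrite ?inE//; exact: measurable_cube.
exists (fine (leb E)); last by rewrite fineK.
rewrite lt_def fine_ge0// andbT; apply/negP => /eqP E0.
have E0' : leb E = 0%E by rewrite -(fineK Efin) E0.
have : W <= a ^+ 2 * q.
  have iq : integ (\1_Q : V -> R).
    by apply: integ_indic; [exact: measurable_cube|exact: cube_finite].
  have -> : q = \int[leb]_x (\1_Q x).
    apply: EFin_inj; rewrite (RintegralE iq) integral_indic//; last exact: measurable_cube.
    by rewrite setIT; exact: (esym (leb_cube _ (ltW D0))).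
  rewrite -(RintegralZl _ measurableT iq); apply: ae_le_Rintegral => //.
    exact: integZ.
  exists E; split => // x /= h; apply: contrapT => xE; apply: h.
  have [xQ|xQ] := pselect (Q x).
    rewrite indicE mem_set//= mulr1 ler_pXn2r ?nnegrE ?(ltW a0)//.
    by rewrite leNgt; apply/negP => /ltW.
  have -> : w x = 0 by apply/eqP; apply/negPn/negP => /eigen_supp.
  by rewrite expr0n/= mulr_ge0 ?sqr_ge0// indicE.
rewrite a2 (_ : W / (2 * q) * q = W / 2); last by field; rewrite gt_eqF.
by rewrite leNgt ltr_pdivrMr// mulr_natr mulr2n ltrDl W0'.
Qed.

(** Tested with (v - C w)^+. The term in w has a favourable sign because w is a supersolution of the
    homogeneous equation; the tail comes from {w >= a}, where v - C w is very negative. *)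
Lemma comparison (M1 Mv : R) : 0 <= M1 -> 0 <= Mv ->
  exists2 C : R, 0 < C & forall v, test_space v ->
    {ae leb, forall x, v x <= Mv} -> subsolution 0 M1 v ->
    {ae leb, forall x, v x <= C * w x}.
Proof.
move=> M10 Mv0; have [a a0 [e0 e00 he]] := eigen_superlevel.
have k0 := kmin_gt0; have [mw w_out w2 gw] := hw.
(* Where w >= a and v <= Mv, this makes v - C w at most -(M1 + 1) / (K kmin e0). The tail is then at
   least (M1 + 1) / K, which beats the right-hand side M1. *)
pose C := (Mv + (M1 + 1) / (K * kmin * e0)) / a.
have B0 : 0 < (M1 + 1) / (K * kmin * e0) by rewrite divr_gt0 ?mulr_gt0// ltr_wpDl.
have C0 : 0 < C by rewrite divr_gt0// ltr_wpDl.
have Ca : C * a = Mv + (M1 + 1) / (K * kmin * e0) by rewrite /C divfK// gt_eqF.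
exists C => // v hv vM vsub; have [mv v_out v2 gv] := hv.
have hg : test_space (fun x => v x + - C * w x).
  by apply: test_spaceD => //; exact: test_spaceZ.
set g := (fun x => v x + - C * w x) in hg.
have [mg g_out g2 gg] := hg.
have hgp : test_space (pos_part g).
  by apply: (test_space_pos_part hg) => // [x /g_out ->//|x]; exact: pos_part_norm_le.
have igp := test_space_integ hgp; have [mgp _ gp2 _] := hgp.
have gQ x : 0 < g x -> Q x.
  by move=> gx; apply: OmegaD; apply: contrapT => /g_out gx0; rewrite gx0 ltxx in gx.
pose E := [set x | a <= w x] `&` [set x | v x <= Mv].
have mE1 : measurable [set x | a <= w x] by exact: measurable_superlevel.
have mE : measurable E by apply: measurableI => //; exact: measurable_sublevel.
have EQ : E `<=` Q.
  by move=> x [/= ax _]; apply: eigen_supp; rewrite gt_eqF// (lt_le_trans a0).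
have hE : (e0%:E <= leb E)%E.
  rewrite (le_trans he)//; have mB : measurable [set x | Mv < v x].
    exact: measurable_ssuperlevel.
  have B00 : leb [set x | Mv < v x] = 0%E.
    apply/eqP; rewrite -measure_le0; case: vM => N [mN N0 vN].
    rewrite -N0; apply: le_measure; rewrite ?inE// => x /= vx; apply: vN => /=.
    by apply/negP; rewrite -ltNge.
  apply: (@le_trans _ _ (leb (E `|` [set x | Mv < v x]))).
    apply: le_measure; rewrite ?inE//; first exact: measurableU.
    by move=> x /= ax; have [|] := leP (v x) Mv; [left|right].
  apply: (le_trans (measureU2 _ mE mB)).
  have B00' : (leb [set x | (Mv < v x)%R] <= 0)%E by rewrite B00.
  by rewrite -[leRHS]adde0; exact: leeD.
have gE y : E y -> g y <= - ((M1 + 1) / (K * kmin * e0)).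
  move=> [/= ay vy]; rewrite /g mulNr.
  have : C * a <= C * w y by rewrite ler_pM2l.
  by rewrite Ca; lra.
have hA x : 0 < g x -> (0%:E <= \int[leb]_y ((g y <= 0)%R%:R * kern s (x, y))%:E)%E.
  by move=> _; apply: integral_ge0 => y _; rewrite lee_fin mulr_ge0 ?kern_ge0.
pose be := (M1 + 1) / (K * kmin * e0) * kmin * e0.
have beE : be = (M1 + 1) / K.
  by rewrite /be; move: (kmin) k0 => kk k0; field; rewrite !gt_eqF.
have be0 : 0 <= be by rewrite beE divr_ge0 ?addr_ge0// ltW.
have hB x : 0 < g x ->
    (be%:E <= \int[leb]_y (pos_part (\- g) y * kern s (x, y))%:E)%E.
  move=> gx; apply: (ge0_integral_kern_ge mE EQ (gQ x gx)) => //.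
  - by move=> /gE; rewrite leNgt (lt_trans _ gx)// oppr_lt0.
  - by apply: measurable_pos_part; exact: measurableT_comp.
  - exact: pos_part_ge0.
  - exact: ltW.
  - by move=> y yE; rewrite /pos_part le_max lerNr gE.
have := form_pos_part_ge (lexx 0) be0 mg gg igp gp2 hA hB.
rewrite [X in _ <= X](test_formDl hv (test_spaceZ (- C) hw) hgp).
rewrite (test_formZl (- C) hw hgp) mul0r add0r => core.
have := vsub _ hgp (pos_part_ge0 g); rewrite mul0r add0r.
have := form_eigen_ge0 hgp (pos_part_ge0 g).
set P1 := \int[leb]_x pos_part g x in core *.
have P10 : 0 <= P1 by apply: Rintegral_ge0 => x _; exact: pos_part_ge0.
move=> ew sub; suff : P1 <= 0.
  move=> /(Rintegral_pos_part_le0 igp); apply: filterS => x.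
  by rewrite /g mulNr subr_le0.
have h1 : 2 * (be * P1) <= form s leb v (pos_part g).
  by rewrite (le_trans core)// mulNr gerDl oppr_le0 mulr_ge0// ltW.
have : K * (2 * (be * P1)) <= M1 * P1 by rewrite (le_trans _ sub)// ler_pM2l.
rewrite (_ : K * _ = 2 * (M1 + 1) * P1); last by rewrite beE; field; rewrite gt_eqF.
rewrite leNgt => h; apply/negP => P1p; move: h; apply/negP; rewrite negbK.
by rewrite ltr_pM2r//; lra.
Qed.

(** Tested with (eps [hat] - w)^+, supported in a small ball. The part of {w >= a} outside the cube
    of radius r, where [hat] vanishes, supplies a tail that outweighs eps times the form of
    [hat]. *)
Lemma eigen_locally_ge (x0 : V) (rho : R) : 0 < rho -> cube x0 rho `<=` Omega ->
  exists2 r : R, 0 < r & exists2 c : R, 0 < c &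
    {ae leb, forall x, enorm (x - x0) < r -> c <= w x}.
Proof.
move=> rho0 rhoO; have [a a0 [e0 e00 he]] := eigen_superlevel.
have k0 := kmin_gt0; have [mw w_out w2 gw] := hw.
have ikw := eigen_integ_kern_weight.
(* Removing the cube of radius r must leave at least half of the measure e0; 2 r <= 1 reduces its
   volume to the bound 2 r <= e0 / 2. *)
have [r [r0 rrho re]] : exists r : R, [/\ 0 < r, r <= rho & (2 * r) ^+ n.+1 <= e0 / 2].
  pose r := Num.min rho (Num.min (2^-1) (e0 / 4)).
  have r0 : 0 < r by rewrite !lt_min rho0 invr_gt0 ltr0n divr_gt0.
  exists r; split => //; first by rewrite ge_min lexx.
  have r1 : 2 * r <= 1.
    by rewrite -ler_pdivlMl// mulr1 /r !ge_min lexx orbT.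
  apply: (@le_trans _ _ (2 * r)).
    by rewrite exprS ler_piMr ?exprn_ile1// mulr_ge0// ltW.
  have : r <= e0 / 4 by rewrite /r !ge_min lexx !orbT.
  lra.
pose E := [set x | a <= w x] `\` cube x0 r.
have mE1 : measurable [set x | a <= w x] by exact: measurable_superlevel.
have mE : measurable E by apply: measurableD => //; exact: measurable_cube.
have EQ : E `<=` Q.
  by move=> x [/= ax _]; apply: eigen_supp; rewrite gt_eqF// (lt_le_trans a0).
have hE : ((e0 / 2)%:E <= leb E)%E.
  rewrite (_ : e0 / 2 = e0 - e0 / 2); last by field.
  apply: lebesgue_setD_ge => //; first exact: measurable_cube.
  by rewrite leb_cube ?lee_fin// ltW.
pose C := 2 * (1 + r ^+ 2) * \int[leb]_h kern_weight s h.
have C0 : 0 <= C.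
  rewrite !mulr_ge0 ?addr_ge0 ?sqr_ge0//.
  by apply: Rintegral_ge0 => x _; exact: kern_weight_ge0.
pose be := a * kmin * (e0 / 2).
have be0 : 0 < be by rewrite !mulr_gt0.
(* eps C <= be, so [hat] consumes at most half of the gain 2 be \int g^+. *)
pose eps := be / (C + 1).
have eps0 : 0 < eps by rewrite divr_gt0// ltr_wpDl.
have epsC : eps * C <= be.
  by rewrite /eps mulrAC ler_pdivrMr ?ltr_wpDl// ler_pM2l// lerDl.
have cO : cube x0 r `<=` Omega.
  by move=> x xr; apply: rhoO => i; rewrite (le_trans (xr i)).
have hh : test_space (hat x0 r).
  split; [exact: measurable_hat|move=> x xO| |exact: finite_gagliardo_hat].
    by apply: hat_outside_cube => // /cO.
  apply: (integ_le (integZ (r ^+ 2) (integ_hat leb_cube x0 r0))).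
    by apply: measurable_funX; exact: measurable_hat.
  by move=> x; rewrite ger0_norm ?sqr_ge0// expr2 ler_wpM2r ?hat_ge0 ?hat_le.
have hg : test_space (fun x => eps * hat x0 r x + -1 * w x).
  by apply: test_spaceD; exact: test_spaceZ.
set g := (fun x => eps * hat x0 r x + -1 * w x) in hg.
have [mg g_out g2 gg] := hg.
have hgp : test_space (pos_part g).
  by apply: (test_space_pos_part hg) => // [x /g_out ->//|x]; exact: pos_part_norm_le.
have igp := test_space_integ hgp; have [mgp _ gp2 ggp] := hgp.
have gQ x : 0 < g x -> Q x.
  by move=> gx; apply: OmegaD; apply: contrapT => /g_out gx0; rewrite gx0 ltxx in gx.
have g_far x : hat x0 r x = 0 -> g x <= 0.
  by move=> h; rewrite /g h mulr0 add0r mulN1r oppr_le0.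
have gE y : E y -> g y <= - a.
  by move=> [/= ay yr]; rewrite /g hat_outside_cube// mulr0 add0r mulN1r lerN2.
have hA x : 0 < g x -> (0%:E <= \int[leb]_y ((g y <= 0)%R%:R * kern s (x, y))%:E)%E.
  by move=> _; apply: integral_ge0 => y _; rewrite lee_fin mulr_ge0 ?kern_ge0.
have hB x : 0 < g x ->
    (be%:E <= \int[leb]_y (pos_part (\- g) y * kern s (x, y))%:E)%E.
  move=> gx; apply: (ge0_integral_kern_ge mE EQ (gQ x gx)) => //.
  - by move=> /gE; rewrite leNgt (lt_trans _ gx)// oppr_lt0.
  - by apply: measurable_pos_part; exact: measurableT_comp.
  - exact: pos_part_ge0.
  - exact: ltW.
  - by move=> y yE; rewrite /pos_part le_max lerNr gE.
have := form_pos_part_ge (lexx 0) (ltW be0) mg gg igp gp2 hA hB.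
rewrite [X in _ <= X](test_formDl (test_spaceZ eps hh) (test_spaceZ (-1) hw) hgp).
rewrite (test_formZl eps hh hgp) (test_formZl (-1) hw hgp) mul0r add0r => core.
have ew := form_eigen_ge0 hgp (pos_part_ge0 g).
have hh_le : form s leb (hat x0 r) (pos_part g) <= C * \int[leb]_x pos_part g x.
  apply: (form_hat_le leb_addr leb_cube ikw r0 mgp igp (pos_part_ge0 g) ggp).
  by move=> x xr; rewrite /pos_part max_r// g_far// hat_out.
set P1 := \int[leb]_x pos_part g x in core hh_le *.
have P1le0 : P1 <= 0.
  rewrite leNgt; apply/negP => P1p.
  have h1 : eps * form s leb (hat x0 r) (pos_part g) <= be * P1.
    apply: (@le_trans _ _ (eps * (C * P1))); first by rewrite ler_pM2l.
    by rewrite mulrA ler_pM2r.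
  have h2 : 0 < be * P1 by rewrite mulr_gt0.
  by move: core; lra.
have r20 : 0 < r / 2 by rewrite divr_gt0.
exists (r / 2) => //; exists (eps * (3 * r ^+ 2 / 4)).
  by rewrite mulr_gt0// divr_gt0// mulr_gt0// exprn_gt0.
apply: filterS (Rintegral_pos_part_le0 igp P1le0) => x gx xr.
apply: (@le_trans _ _ (eps * hat x0 r x)); last first.
  by move: gx; rewrite /g mulN1r subr_le0.
rewrite ler_pM2l// /hat le_max; apply/orP; left.
have : enorm (x - x0) ^+ 2 <= (r / 2) ^+ 2.
  by rewrite ler_pXn2r ?nnegrE ?enorm_ge0 ?(ltW r20)// ltW.
by rewrite (_ : (r / 2) ^+ 2 = r ^+ 2 / 4); [lra|field].
Qed.

(** * Picone's inequality and the spectral gap *)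

Section gap.
Variables (Mw : R).
Hypothesis Mw0 : 0 < Mw.
Hypothesis wM : forall x, w x <= Mw.

Lemma measurable_eigen_inv (e : R) : 0 < e ->
  measurable_fun setT (fun x => (w x + e)^-1).
Proof.
move=> e0; have [mw _ _ _] := hw.
rewrite (_ : (fun x => _) = (fun a => a `^ (-1)) \o (fun x => w x + e)).
  apply: measurableT_comp; first exact: measurable_powR.
  exact: measurable_funD.
apply/funext => x /=; rewrite powR_inv1// addr_ge0//.
exact: ltW.
Qed.

(** The shift e keeps the quotient Lipschitz in (v, w), hence a test function, although w has no
    positive lower bound. *)
Definition picone_test (e : R) v x := v x ^+ 2 * (w x + e)^-1.

Lemma picone_test_space (e Mv : R) v : 0 < e -> test_space v ->
  (forall x, `|v x| <= Mv) -> test_space (picone_test e v).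
Proof.
move=> e0 hv vM; have [mv v_out v2 gv] := hv.
have Mv0 : 0 <= Mv := le_trans (normr_ge0 _) (vM 0).
have we x : 0 < w x + e by rewrite ltr_wpDl.
have ewe x : (w x + e)^-1 <= e^-1 by rewrite lef_pV2 ?posrE// lerDr.
pose L := 2 * Mv / e + (Mv / e) ^+ 2.
have L1 : 0 <= 2 * Mv / e by rewrite divr_ge0 ?mulr_ge0// ltW.
have L2 : 0 <= (Mv / e) ^+ 2 by rewrite sqr_ge0.
have Me0 : 0 <= Mv / e by rewrite divr_ge0// ltW.
apply: (test_space_lip (L := L) hv hw).
- apply: measurable_funM; first exact: measurable_funX.
  exact: measurable_eigen_inv.
- by move=> x /v_out vx; rewrite /picone_test vx expr0n mul0r.
- move=> x; rewrite /picone_test normrM normrX.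
  rewrite (ger0_norm (x := (_ + _)^-1)) ?invr_ge0 ?(ltW (we _))//.
  apply: (@le_trans _ _ (Mv / e * `|v x|)).
    rewrite expr2 mulrAC; apply: ler_wpM2r => //.
    by apply: ler_pM => //; rewrite invr_ge0 ltW.
  apply: (@le_trans _ _ (L * `|v x|)); last by rewrite ler_wpM2l ?addr_ge0// lerDl.
  apply: ler_wpM2r => //; rewrite /L -[leLHS]addr0 lerD//.
  by rewrite -mulrA ler_peMl// ler1n.
move=> x y; rewrite /picone_test.
move: (vM x) (vM y) (we x) (we y) (ewe x) (ewe y) => a1 b1 B0 C0 Be Ce.
have -> : w x - w y = (w x + e) - (w y + e) by ring.
move: (v x) (v y) (w x + e) (w y + e) a1 b1 B0 C0 Be Ce => a b B C a1 b1 B0 C0 Be Ce.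
(* This splitting isolates the increments of v and of w; with |v| <= Mv and denominators at least e,
   the coefficients are the two summands of L. *)
rewrite (_ : _ - _ = (a - b) * ((a + b) / B) + (b / B) * (b / C) * (C - B)); last first.
  by field; rewrite !gt_eqF.
apply: (le_trans (ler_normD _ _)); rewrite [X in _ <= X]mulrDr; apply: lerD.
  rewrite normrM mulrC; apply: ler_wpM2r => //.
  rewrite normrM (ger0_norm (x := B^-1)) ?invr_ge0 ?(ltW B0)//.
  apply: (@le_trans _ _ (2 * Mv / e)); last by rewrite lerDl.
  apply: ler_pM => //; first by rewrite invr_ge0 ltW.
  by rewrite (le_trans (ler_normD _ _))// mulrDl mul1r lerD.
rewrite normrM (distrC C); apply: ler_wpM2r => //.
apply: (@le_trans _ _ ((Mv / e) ^+ 2)); last by rewrite lerDr.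
rewrite normrM expr2 !normrM (ger0_norm (x := B^-1)) ?invr_ge0 ?(ltW B0)//.
rewrite (ger0_norm (x := C^-1)) ?invr_ge0 ?(ltW C0)//.
by apply: ler_pM; rewrite ?mulr_ge0 ?invr_ge0 ?(ltW B0) ?(ltW C0)//;
  apply: ler_pM; rewrite ?invr_ge0 ?(ltW B0) ?(ltW C0).
Qed.

(* Picone's identity, with the kernel bounded below on the bounded domain. *)
Lemma picone_ge (e Mv : R) v : 0 < e -> e <= Mw -> test_space v ->
  (forall x, `|v x| <= Mv) -> \int[leb]_x (v x * w x) = 0 ->
  kmin / (2 * Mw) ^+ 2 * (2 * (\int[leb]_x (w x ^+ 2) * \int[leb]_x (v x ^+ 2) -
     e ^+ 2 * (\int[leb]_x v x) ^+ 2)) <=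
  form s leb v v - form s leb w (picone_test e v).
Proof.
move=> e0 eM hv vM vw; have [mv v_out v2 gv] := hv; have [mw w_out w2 gw] := hw.
have hphi := picone_test_space e0 hv vM.
have k0 := kmin_gt0.
(* w + e is not square integrable on the whole space; cutting it to the cube changes no product with
   v. *)
pose om x := \1_Q x * (w x + e).
have iQ : integ (\1_Q : V -> R).
  by apply: integ_indic; [exact: measurable_cube|exact: cube_finite].
have mom : measurable_fun setT om.
  apply: measurable_funM; first by apply: measurable_indic; exact: measurable_cube.
  exact: measurable_funD.
have v_outQ x : ~ Q x -> v x = 0 by move=> xQ; apply: v_out => /OmegaD.
have w_outQ x : ~ Q x -> w x = 0 by move=> xQ; apply: w_out => /OmegaD.
have omE x : Q x -> om x = w x + e by move=> xQ; rewrite /om indicE mem_set//= mul1r.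
have om0 x : ~ Q x -> om x = 0 by move=> xQ; rewrite /om indicE memNset//= mul0r.
have iom2 : integ (fun x => om x ^+ 2).
  apply: (integ_le (integZ ((2 * Mw) ^+ 2) iQ)); first exact: measurable_funX.
  move=> x; rewrite ger0_norm ?sqr_ge0//; have [xQ|xQ] := pselect (Q x).
    rewrite omE// indicE mem_set//= mulr1.
    rewrite ler_pXn2r ?nnegrE ?addr_ge0 ?mulr_ge0 ?(ltW e0) ?(ltW Mw0)//.
    by rewrite mulrDl mul1r lerD.
  by rewrite om0// expr0n/= indicE memNset//= mulr0.
have ivom : integ (fun x => v x * om x) by exact: integ_mul.
have iv := test_space_integ hv; have iw := test_space_integ hw.
(* Orthogonality of v and w leaves only the contribution of the shift e, which disappears as e tends
   to 0. *)
have ivom_val : \int[leb]_x (v x * om x) = e * \int[leb]_x v x.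
  rewrite -[RHS]add0r -vw -(RintegralZl _ measurableT iv).
  rewrite -(RintegralD measurableT (test_space_integM hv hw) (integZ e iv)).
  apply: eq_Rintegral => x _; have [xQ|xQ] := pselect (Q x).
    by rewrite omE//; ring.
  by rewrite v_outQ// !mul0r mulr0 addr0.
have om2_ge : \int[leb]_x (w x ^+ 2) <= \int[leb]_x (om x ^+ 2).
  apply: le_RintegralT => // x; have [xQ|xQ] := pselect (Q x).
    rewrite omE// ler_pXn2r ?nnegrE ?addr_ge0 ?(ltW e0)//.
    by rewrite lerDl ltW.
  by rewrite om0// w_outQ.
have i1 := integ_prod_mul v2 iom2; have i2 := integ_prod_mul ivom ivom.
have i1' := integ_prod_mul iom2 v2.
have iG := integZ (kmin / (2 * Mw) ^+ 2) (integB (integD i1 i1') (integZ 2 i2)).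
have iF := integB (test_space_form_integ hv hv) (test_space_form_integ hw hphi).
have F_ge z : kmin / (2 * Mw) ^+ 2 * (v z.1 ^+ 2 * om z.2 ^+ 2 + om z.1 ^+ 2 * v z.2 ^+ 2 -
      2 * (v z.1 * om z.1 * (v z.2 * om z.2))) <=
    form_density s v v z - form_density s w (picone_test e v) z.
  case: z => x y /=.
  have wxe : 0 < w x + e by rewrite ltr_wpDl.
  have wye : 0 < w y + e by rewrite ltr_wpDl.
  (* Picone's identity for the discrete differences: the defect is a perfect square. *)
  have -> : form_density s v v (x, y) - form_density s w (picone_test e v) (x, y) =
      (v x * (w y + e) - v y * (w x + e)) ^+ 2 / ((w x + e) * (w y + e)) * kern s (x, y).
    rewrite !form_densityE /picone_test -mulrBl; congr (_ * _).
    have -> : w x - w y = (w x + e) - (w y + e) by ring.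
    move: (v x) (v y) (w x + e) (w y + e) wxe wye => a b B C B0 C0.
    by field; rewrite !gt_eqF.
  have -> : v x ^+ 2 * om y ^+ 2 + om x ^+ 2 * v y ^+ 2 - 2 * (v x * om x * (v y * om y)) =
      (v x * om y - v y * om x) ^+ 2 by ring.
  have rhs0 : 0 <= (v x * (w y + e) - v y * (w x + e)) ^+ 2 / ((w x + e) * (w y + e)) *
      kern s (x, y).
    by rewrite mulr_ge0 ?kern_ge0// divr_ge0 ?sqr_ge0// mulr_ge0// ltW.
  have [xQ|xQ] := pselect (Q x); last first.
    rewrite (_ : v x * om y - v y * om x = 0) ?expr0n ?mulr0//.
    by rewrite (v_outQ x xQ) (om0 x xQ) mul0r mulr0 subr0.
  have [yQ|yQ] := pselect (Q y); last first.
    rewrite (_ : v x * om y - v y * om x = 0) ?expr0n ?mulr0//.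
    by rewrite (v_outQ y yQ) (om0 y yQ) mul0r mulr0 subr0.
  rewrite !omE//; have [->|xy] := eqVneq x y.
    by rewrite subrr expr0n/= mulr0 !mul0r.
  rewrite -mulrA [leRHS]mulrC; apply: ler_pM.
  - exact: ltW.
  - by rewrite mulr_ge0 ?invr_ge0 ?sqr_ge0.
  - exact: kern_cube_lower.
  rewrite mulrC; apply: ler_wpM2l; first exact: sqr_ge0.
  rewrite lef_pV2 ?posrE ?mulr_gt0 ?exprn_gt0 ?mulr_gt0// expr2.
  by apply: ler_pM; rewrite ?(ltW wxe) ?(ltW wye)// mulrDl mul1r lerD.
have := le_RintegralT iG iF F_ge.
rewrite (RintegralB measurableT (test_space_form_integ hv hv) (test_space_form_integ hw hphi)).
rewrite (RintegralZl _ measurableT (integB (integD i1 i1') (integZ 2 i2))).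
rewrite (RintegralB measurableT (integD i1 i1') (integZ 2 i2)).
rewrite (RintegralD measurableT i1 i1') (RintegralZl _ measurableT i2).
rewrite (Rintegral_prod_mul v2 iom2) (Rintegral_prod_mul iom2 v2).
rewrite (Rintegral_prod_mul ivom ivom).
rewrite ivom_val; apply: le_trans; apply: ler_wpM2l.
  by rewrite divr_ge0 ?sqr_ge0// ltW.
have V0 : 0 <= \int[leb]_x (v x ^+ 2) by apply: Rintegral_ge0 => x _; exact: sqr_ge0.
have := ler_wpM2r V0 om2_ge.
move: (\int[leb]_x (v x ^+ 2)) (\int[leb]_x (w x ^+ 2)) (\int[leb]_x (om x ^+ 2)) => A B C.
move: (\int[leb]_x v x) => E h.
rewrite (_ : 2 * (e * E * (e * E)) = 2 * (e ^+ 2 * E ^+ 2)); last by ring.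
lra.
Qed.

(** The shift tends to 0 in [picone_ge]. The bound Mv makes v admissible but does not enter [gam],
    so merely qualitative bounds on solutions suffice. *)
Lemma spectral_gap : exists2 gam : R, 0 < gam &
  forall v (Mv : R), test_space v -> (forall x, `|v x| <= Mv) ->
    (forall x, w x = 0 -> v x = 0) -> \int[leb]_x (v x * w x) = 0 ->
    gam * \int[leb]_x (v x ^+ 2) <=
    K * form s leb v v - lam1 * \int[leb]_x (v x ^+ 2).
Proof.
have k0 := kmin_gt0; have [mw w_out w2 gw] := hw.
pose c := K * (kmin / (2 * Mw) ^+ 2) * 2.
have c0 : 0 < c by rewrite mulr_gt0// mulr_gt0// divr_gt0// exprn_gt0// mulr_gt0.
pose W := \int[leb]_x (w x ^+ 2).
exists (c * W); first by rewrite mulr_gt0.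
move=> v Mv hv vM wv vw; have [mv v_out v2 gv] := hv.
pose eps (k : nat) : R := Mw * k.+1%:R^-1.
have eps0 k : 0 < eps k by rewrite mulr_gt0// invr_gt0.
have epsM k : eps k <= Mw by rewrite ler_piMr ?(ltW Mw0)// invf_le1// ler1n.
(* The error v^2 - w v^2 / (w + eps). It is dominated by v^2 and tends to 0 pointwise, at the zeros
   of w because v vanishes there too. *)
pose d k x := v x ^+ 2 * (eps k * (w x + eps k)^-1).
have we k x : 0 < w x + eps k by rewrite ltr_wpDl.
have md k : measurable_fun setT (d k).
  apply: measurable_funM; first exact: measurable_funX.
  by apply: measurable_funM => //; exact: measurable_eigen_inv.
have d_ge0 k x : 0 <= d k x.
  by rewrite mulr_ge0 ?sqr_ge0// mulr_ge0 ?invr_ge0// ltW.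
have d_le k x : d k x <= v x ^+ 2.
  rewrite ler_piMr ?sqr_ge0// ler_pdivrMr// mul1r.
  by rewrite lerDr.
have id k : integ (d k).
  by apply: (integ_le v2) => // x; rewrite ger0_norm.
have eps_cvg : eps k @[k --> \oo] --> (0 : R).
  rewrite -[X in _ --> X](mulr0 Mw); apply: cvgM; first exact: cvg_cst.
  exact: cvg_harmonic.
have d_cvg : \int[leb]_x d k x @[k --> \oo] --> (0 : R).
  have := @dominated_convergence _ _ R leb setT measurableT
    (fun k x => (d k x)%:E) (cst 0%E) (fun x => (v x ^+ 2)%:E)
    (fun k => measurable_EFin (md k)) (measurable_cst _).
  move=> /(_ _ v2 _)[].
  - apply: aeW => x _; apply/fine_cvgP; split; first exact: nearW.
    have [wx|wx] := eqVneq (w x) 0.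
      rewrite (_ : _ \o _ = cst 0); first exact: cvg_cst.
      by apply/funext => k /=; rewrite /d wv// expr0n mul0r.
    rewrite /comp/= -[X in _ --> X](mulr0 (v x ^+ 2)).
    apply: cvgM; first exact: cvg_cst.
    rewrite -[X in _ --> X](mul0r (w x)^-1); apply: cvgM => //.
    apply: cvgV => //; rewrite -[X in _ --> X]addr0.
    by apply: cvgD => //; exact: cvg_cst.
  - apply: aeW => x k _ /=; rewrite lee_fin ger0_norm//.
  move=> _ _; rewrite integral0 => /fine_cvgP[_]; apply: cvg_trans.
  by apply: near_eq_cvg; apply: nearW => k /=.
pose E := \int[leb]_x v x.
have key k : c * W * \int[leb]_x (v x ^+ 2) <=
    K * form s leb v v - lam1 * \int[leb]_x (v x ^+ 2) +
    (lam1 * \int[leb]_x d k x + c * E ^+ 2 * (eps k * eps k)).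
  have hphi := picone_test_space (eps0 k) hv vM.
  have := picone_ge (eps0 k) (epsM k) hv vM vw.
  move/(ler_wpM2l (ltW K0)); rewrite [X in _ <= X]mulrBr (eig hphi).
  have -> : \int[leb]_x (w x * picone_test (eps k) v x) =
      \int[leb]_x (v x ^+ 2) - \int[leb]_x d k x.
    rewrite -(RintegralB measurableT v2 (id k)); apply: eq_Rintegral => x _.
    by rewrite /picone_test /d; field; rewrite gt_eqF.
  rewrite -/E -/W /c.
  move: (\int[leb]_x (v x ^+ 2)) (\int[leb]_x d k x) => A B.
  move: (form s leb v v) (kmin / (2 * Mw) ^+ 2) (eps k) => F kk e h.
  rewrite (_ : K * kk * 2 * W * A = K * (kk * (2 * (W * A - e ^+ 2 * E ^+ 2))) +
    K * kk * 2 * E ^+ 2 * (e * e)); last by ring.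
  by move: h; lra.
apply: (ler_of_cvg0 _ key).
rewrite -[X in _ --> X](addr0 0); apply: cvgD.
  by rewrite -[X in _ --> X](mulr0 lam1); apply: cvgM => //; exact: cvg_cst.
rewrite -[X in _ --> X](mulr0 (c * E ^+ 2)); apply: cvgM; first exact: cvg_cst.
by rewrite -[X in _ --> X](mulr0 0); exact: cvgM.
Qed.

End gap.

End eigenfunction.

(** The weak form of |(-Delta)^s u - lam u| <= M, by duality with L^1. Unlike [subsolution] it is
    invariant under u -> -u. *)
Definition bounded_rhs (lam M : R) u : Prop := forall phi, test_space phi ->
  `|K * form s leb u phi - lam * \int[leb]_x (u x * phi x)| <= M * \int[leb]_x `|phi x|.

Lemma bounded_rhs_subsolution lam M u : bounded_rhs lam M u -> subsolution lam M u.
Proof.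
move=> hu phi hphi phi0; rewrite -lerBlDl; apply: le_trans (ler_norm _) _.
rewrite (_ : \int[leb]_x phi x = \int[leb]_x `|phi x|); first exact: hu.
by apply: eq_Rintegral => x _; rewrite ger0_norm.
Qed.

Lemma bounded_rhsN lam M u : test_space u -> bounded_rhs lam M u ->
  bounded_rhs lam M (fun x => - u x).
Proof.
move=> hu hb phi hphi; rewrite (_ : _ - _ =
  - (K * form s leb u phi - lam * \int[leb]_x (u x * phi x))) ?normrN; first exact: hb.
have -> : form s leb (fun x => - u x) phi = - form s leb u phi.
  rewrite -mulN1r -(test_formZl (-1) hu hphi); congr (form s leb _ _).
  by apply/funext => x; rewrite mulN1r.
have -> : \int[leb]_x (- u x * phi x) = - \int[leb]_x (u x * phi x).
  rewrite -mulN1r -(RintegralZl _ measurableT (test_space_integM hu hphi)).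
  by apply: eq_Rintegral => x _; ring.
by ring.
Qed.

Lemma ae_pair (P : V -> Prop) : {ae leb, forall x, P x} ->
  {ae leb2, forall z, P z.1 /\ P z.2}.
Proof.
move=> [N [mN N0 hN]].
exists ((N `*` setT) `|` (setT `*` N)); split.
- by apply: measurableU; exact: measurableX.
- apply/eqP; rewrite -measure_le0.
  apply: le_trans (measureU2 _ (measurableX mN measurableT) (measurableX measurableT mN)) _.
  have E1 : (leb2 (N `*` setT) <= 0)%E.
    have -> : leb2 (N `*` setT) = (leb N * leb setT)%E by exact: product_measure1E.
    by rewrite N0 mul0e.
  have E2 : (leb2 (setT `*` N) <= 0)%E.
    have -> : leb2 (setT `*` N) = (leb setT * leb N)%E by exact: product_measure1E.
    by rewrite N0 mule0.
  by rewrite -[leRHS]adde0; exact: leeD.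
move=> [x y] /= h; apply: contrapT => hxy; apply: h; split; apply: contrapT => hP;
  apply: hxy; [left|right]; split => //; exact: hN.
Qed.

Lemma form_ae u u' phi : measurable_fun setT u -> measurable_fun setT u' ->
  measurable_fun setT phi -> {ae leb, forall x, u' x = u x} ->
  form s leb u' phi = form s leb u phi.
Proof.
move=> mu mu' mphi uu'; apply: ae_eq_Rintegral; try exact: measurable_form_density.
by apply: filterS (ae_pair uu') => -[x y] [/= hx hy]; rewrite /form_density/= hx hy.
Qed.

Lemma test_space_ae u u' : test_space u -> measurable_fun setT u' ->
  (forall x, ~ Omega x -> u' x = 0) -> {ae leb, forall x, u' x = u x} ->
  test_space u'.
Proof.
move=> [mu u0 u2 gu] mu' u'0 uu'; split => //.
  apply: (integ_ae u2); first exact: measurable_funX.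
  by apply: filterS uu' => x ->.
apply: (integ_ae gu); first exact: measurable_form_density.
by apply: filterS (ae_pair uu') => -[x y] [/= hx hy]; rewrite /form_density/= hx hy.
Qed.

(** The bound depends on the L^2 norm of u and is thus not uniform; it serves to pass to bounded
    representatives. *)
Lemma bounded_rhs_bounded lam M u : 0 <= M -> test_space u -> bounded_rhs lam M u ->
  exists2 Mu : R, 0 < Mu & {ae leb, forall x, `|u x| <= Mu}.
Proof.
move=> M0 hu hb.
have U0 : 0 <= \int[leb]_x (u x ^+ 2) by apply: Rintegral_ge0 => x _; exact: sqr_ge0.
have [c c0 hc] := subsolution_bounded (normr_ge0 lam) M0 U0.
exists c => //.
have h1 := hc lam u (ler_norm _) hu (bounded_rhs_subsolution hb) (lexx _).
have h2 := hc lam _ (ler_norm _) (test_spaceN hu)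
  (bounded_rhs_subsolution (bounded_rhsN hu hb)).
have : \int[leb]_x ((- u x) ^+ 2) <= \int[leb]_x (u x ^+ 2).
  by under eq_Rintegral do rewrite sqrrN.
move=> /h2; apply: filterS2 h1 => x; rewrite lerNl => a b.
by rewrite ler_norml b.
Qed.

Lemma integM_bounded (M : R) f phi : measurable_fun setT f ->
  (forall x, `|f x| <= M) -> test_space phi -> integ (fun x => f x * phi x).
Proof. by move=> mf fM hphi; apply: (integ_bounded_mul mf fM); exact: test_space_integ. Qed.

Lemma normr_Rintegral_bounded (M : R) f phi : measurable_fun setT f ->
  (forall x, `|f x| <= M) -> test_space phi ->
  `|\int[leb]_x (f x * phi x)| <= M * \int[leb]_x `|phi x|.
Proof.
move=> mf fM hphi; have iphi := integ_norm (test_space_integ hphi).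
have ifp := integM_bounded mf fM hphi.
apply: (le_trans (le_normr_Rintegral measurableT ifp)).
rewrite -(RintegralZl _ measurableT iphi); apply: le_RintegralT.
- exact: integ_norm ifp.
- exact: integZ.
- by move=> x; rewrite normrM ler_wpM2r.
Qed.

(** * Decomposition of solutions near resonance *)

Section antimaximum.
Variables (w : V -> R) (lam1 Mw : R).
Hypothesis hw : test_space w.
Hypothesis w0 : forall x, 0 <= w x.
Hypothesis lam10 : 0 <= lam1.
Hypothesis eig : forall phi, test_space phi ->
  K * form s leb w phi = lam1 * \int[leb]_x (w x * phi x).
Hypothesis W0 : 0 < \int[leb]_x (w x ^+ 2).
Hypothesis Mw0 : 0 < Mw.
Hypothesis wM : forall x, w x <= Mw.
Hypothesis w_pos : {ae leb, forall x, Omega x -> 0 < w x}.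

(** [spectral_gap] asks for pointwise bounds and for vanishing at every zero of w; both are reached
    by a change on a null set. *)
Lemma truncation_on_support (Mu : R) u : 0 < Mu -> test_space u ->
  {ae leb, forall x, `|u x| <= Mu} ->
  exists u', [/\ test_space u', forall x, `|u' x| <= Mu,
    forall x, w x = 0 -> u' x = 0 & {ae leb, forall x, u' x = u x}].
Proof.
move=> Mu0 hu uM; have [mu u0 u2 gu] := hu; have [mw w_out _ _] := hw.
pose u' x := \1_[set x | 0 < w x] x * Num.max (- Mu) (Num.min (u x) Mu).
have clip a : `|Num.max (- Mu) (Num.min a Mu)| <= Mu.
  have l : - Mu <= Mu by rewrite ge0_cp// ltW.
  by rewrite ler_norml le_max lexx/= ge_max l ge_min lexx orbT.
have u'E : {ae leb, forall x, u' x = u x}.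
  apply: filterS2 uM w_pos => x ux wx; rewrite /u' indicE.
  have [xO|xO] := pselect (Omega x).
    rewrite mem_set/= ?mul1r; last exact: wx.
    by move: ux; rewrite ler_norml => /andP[a b]; rewrite min_l// max_r.
  by rewrite memNset/= ?mul0r ?u0//= w_out// ltxx.
have wu' x : w x = 0 -> u' x = 0.
  by move=> wx; rewrite /u' indicE memNset/= ?mul0r// wx ltxx.
exists u'; split => //.
- apply: (test_space_ae hu) => //.
    apply: measurable_funM.
      by apply: measurable_indic; exact: measurable_ssuperlevel.
    by apply: measurable_maxr => //; exact: measurable_minr.
  by move=> x /w_out /wu'.
- move=> x; rewrite /u' indicE; case: (_ \in _); rewrite ?mul1r//.
  by rewrite mul0r normr0 ltW.
Qed.

(** The component of u along w carries the whole singularity at lam1; C and [del] depend on neither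
    lam nor u, which is what lets that component dominate. *)
Lemma resonant_decomposition (f : V -> R) (Mf : R) : 0 <= Mf ->
  measurable_fun setT f -> (forall x, `|f x| <= Mf) ->
  exists C del : R, [/\ 0 < C, 0 < del & forall lam u, `|lam - lam1| < del ->
    lam != lam1 -> test_space u ->
    (forall phi, test_space phi -> K * form s leb u phi =
       lam * \int[leb]_x (u x * phi x) + \int[leb]_x (f x * phi x)) ->
    {ae leb, forall x, `|u x - (\int[leb]_x (f x * w x)) /
       ((lam1 - lam) * \int[leb]_x (w x ^+ 2)) * w x| <= C * w x}].
Proof.
move=> Mf0 mf fM; have [mw w_out w2 gw] := hw.
pose W := \int[leb]_x (w x ^+ 2); have W0' : 0 < W := W0.
pose c0 := \int[leb]_x (f x * w x).
(* The part of f orthogonal to w, which is the right-hand side of the equation of v = u - t w. *)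
pose F x := f x - c0 / W * w x.
pose MF := Mf + `|c0 / W| * Mw.
have MF0 : 0 <= MF by rewrite addr_ge0// mulr_ge0// ltW.
have mF : measurable_fun setT F.
  by apply: measurable_funB => //; exact: measurable_funM.
have FM x : `|F x| <= MF.
  rewrite (le_trans (ler_normB _ _))// lerD// normrM ler_wpM2l//.
  by rewrite ger0_norm.
have [gam gam0 hgap] := spectral_gap hw w0 eig W0 Mw0 wM.
pose q : R := (2 * D) ^+ n.+1.
have q0 : 0 <= q by rewrite exprn_ge0// mulr_ge0// ltW.
(* With A = \int v^2, the gap and Young's inequality give gam A <= (gam/2) A + (gam/4) A + MF^2 q /
   gam; this is the resulting bound on A. *)
pose V2 := 4 * MF ^+ 2 * q / gam ^+ 2.
have V20 : 0 <= V2 by rewrite divr_ge0 ?sqr_ge0// mulr_ge0// mulr_ge0// sqr_ge0.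
have Lam0 : 0 <= lam1 + 1 by rewrite addr_ge0.
have [Mv Mv0 hMv] := subsolution_bounded Lam0 MF0 V20.
(* Once |v| <= Mv, the term lam v is moved to the bounded right-hand side, since [comparison] is
   stated for lam = 0. *)
have M10 : 0 <= (lam1 + 1) * Mv + MF by rewrite addr_ge0 ?mulr_ge0// ltW.
have [C C0 hC] := comparison hw w0 lam10 eig W0 M10 (ltW Mv0).
(* gam/2 lets the gap absorb (lam - lam1) \int v^2; the bound 1 keeps |lam| <= lam1 + 1. *)
exists C, (Num.min (gam / 2) 1); split => //.
  by rewrite lt_min ltr01 andbT divr_gt0.
move=> lam u; rewrite lt_min => /andP[lamg lam_1] lam_neq hu uf.
have [mu u_out u2 gu] := hu.
have [Mu Mu0 uMu] : exists2 Mu : R, 0 < Mu & {ae leb, forall x, `|u x| <= Mu}.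
  apply: (bounded_rhs_bounded (lam := lam) Mf0 hu) => phi hphi.
  by rewrite uf// addrC addKr; exact: normr_Rintegral_bounded.
have [u' [hu' u'M wu' uu']] := truncation_on_support Mu0 hu uMu.
have [mu' u'_out u'2 gu'] := hu'.
have u'f phi : test_space phi -> K * form s leb u' phi =
    lam * \int[leb]_x (u' x * phi x) + \int[leb]_x (f x * phi x).
  move=> hphi; have [mphi _ _ _] := hphi.
  rewrite (form_ae mu mu' mphi uu') uf//; congr (_ * _ + _).
  apply: ae_eq_Rintegral; try exact: measurable_funM.
  by apply: filterS uu' => x ->.
pose t := c0 / ((lam1 - lam) * W).
have lam_neq' : lam1 - lam != 0 by rewrite subr_eq0 eq_sym.
(* Testing the equation of u with w gives (lam1 - lam) \int u w = c0. *)
have uw : \int[leb]_x (u' x * w x) = t * W.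
  have := u'f w hw; rewrite formC eig// -/c0.
  rewrite (_ : \int[leb]_x (w x * u' x) = \int[leb]_x (u' x * w x)); last first.
    by apply: eq_Rintegral => x _; rewrite mulrC.
  move: (\int[leb]_x (u' x * w x)) => I h.
  have : (lam1 - lam) * I = c0 by rewrite mulrBl h addrC addKr.
  by move=> e; rewrite /t -e; field; rewrite lam_neq' gt_eqF.
pose v x := u' x + - t * w x.
have hv : test_space v by apply: test_spaceD => //; exact: test_spaceZ.
have vM x : `|v x| <= Mu + `|t| * Mw.
  rewrite (le_trans (ler_normD _ _))// lerD// normrM normrN ler_wpM2l//.
  by rewrite ger0_norm.
have wv x : w x = 0 -> v x = 0 by move=> wx; rewrite /v wu'// wx mulr0 addr0.
have iw2 : integ (fun x => w x * w x) by exact: test_space_integM.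
have vphi phi : test_space phi -> \int[leb]_x (v x * phi x) =
    \int[leb]_x (u' x * phi x) - t * \int[leb]_x (w x * phi x).
  move=> hphi; have i1 := test_space_integM hu' hphi.
  have i2 := test_space_integM hw hphi.
  rewrite -(RintegralZl _ measurableT i2) -(RintegralB measurableT i1 (integZ t i2)).
  by apply: eq_Rintegral => x _; rewrite /v; ring.
have vw : \int[leb]_x (v x * w x) = 0.
  by rewrite vphi// uw subrr.
have vF phi : test_space phi -> K * form s leb v phi =
    lam * \int[leb]_x (v x * phi x) + \int[leb]_x (F x * phi x).
  move=> hphi; rewrite (test_formDl hu' (test_spaceZ (- t) hw) hphi).
  rewrite (test_formZl (- t) hw hphi) mulrDr u'f// vphi//.
  have i1 := integM_bounded mf fM hphi; have i2 := test_space_integM hw hphi.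
  have -> : \int[leb]_x (F x * phi x) =
      \int[leb]_x (f x * phi x) - c0 / W * \int[leb]_x (w x * phi x).
    rewrite -(RintegralZl _ measurableT i2) -(RintegralB measurableT i1 (integZ _ i2)).
    by apply: eq_Rintegral => x _; rewrite /F; ring.
  have -> : K * (- t * form s leb w phi) = - t * (K * form s leb w phi) by ring.
  rewrite eig// /t; field.
  by rewrite lam_neq' gt_eqF.
have vb : bounded_rhs lam MF v.
  by move=> phi hphi; rewrite vF// addrC addKr; exact: normr_Rintegral_bounded.
have v2 : integ (fun x => v x ^+ 2) by case: hv.
have V_le : \int[leb]_x (v x ^+ 2) <= V2.
  have := hgap v _ hv vM wv vw.
  have vv : \int[leb]_x (v x * v x) = \int[leb]_x (v x ^+ 2).
    by apply: eq_Rintegral => x _; rewrite expr2.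
  rewrite vF// vv.
  have iQ : integ (\1_Q : V -> R).
    by apply: integ_indic; [exact: measurable_cube|exact: cube_finite].
  have qE : \int[leb]_x (\1_Q x) = q.
    apply: EFin_inj; rewrite (RintegralE iQ) integral_indic//; last exact: measurable_cube.
    by rewrite setIT; exact: (leb_cube _ (ltW D0)).
  have FV : \int[leb]_x (F x * v x) <= gam / 4 * \int[leb]_x (v x ^+ 2) + MF ^+ 2 / gam * q.
    rewrite -qE -(RintegralZl _ measurableT v2) -(RintegralZl _ measurableT iQ).
    rewrite -(RintegralD measurableT (integZ _ v2) (integZ _ iQ)).
    apply: le_RintegralT.
    - exact: integM_bounded mF FM hv.
    - by apply: integD; exact: integZ.
    move=> x; have [xQ|xQ] := pselect (Q x); last first.
      have [_ v_out _ _] := hv; rewrite v_out ?mulr0; last by move=> /OmegaD.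
      by rewrite expr0n/= mulr0 add0r mulr_ge0 ?divr_ge0 ?sqr_ge0 ?(ltW gam0)// indicE.
    rewrite indicE mem_set//= mulr1.
    apply: (@le_trans _ _ (MF * `|v x|)).
      by rewrite (le_trans (ler_norm _))// normrM ler_wpM2r.
    rewrite -(real_normK (num_real (v x))); move: `|v x| => a.
    rewrite -subr_ge0 (_ : _ - _ = (gam / 2 * a - MF) ^+ 2 / gam).
      by rewrite divr_ge0 ?sqr_ge0// ltW.
    by field; rewrite gt_eqF.
  move: FV; have : 0 <= \int[leb]_x (v x ^+ 2).
    by apply: Rintegral_ge0 => x _; exact: sqr_ge0.
  move: (\int[leb]_x (v x ^+ 2)) (\int[leb]_x (F x * v x)) => A B A0 h1 h2.
  have h3 : (lam - lam1) * A <= gam / 2 * A.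
    by rewrite ler_wpM2r// ltW// (le_lt_trans (ler_norm _)).
  have h4 : gam / 4 * A <= MF ^+ 2 / gam * q by rewrite mulrBl in h3; lra.
  rewrite -(ler_pM2l (x := gam / 4)) ?divr_gt0// (le_trans h4)//.
  rewrite le_eqVlt; apply/orP; left; apply/eqP; rewrite /V2; field.
  by rewrite gt_eqF.
have lamL : lam <= lam1 + 1.
  by rewrite -lerBlDl (le_trans (ler_norm _))// ltW.
have nlamL : `|lam| <= lam1 + 1.
  rewrite ler_norml lamL andbT; move: lam_1; rewrite ltr_norml => /andP[l1 _].
  by have := lam10; lra.
have final v' : test_space v' -> bounded_rhs lam MF v' ->
    \int[leb]_x (v' x ^+ 2) <= V2 -> {ae leb, forall x, `|v' x| <= Mv} ->
    {ae leb, forall x, v' x <= C * w x}.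
  move=> hv' vb' V' vM'; apply: hC => //.
    by apply: filterS vM' => x; exact: le_trans (ler_norm _).
  move=> phi hphi phi0; rewrite mul0r add0r.
  apply: (le_trans (bounded_rhs_subsolution vb' hphi phi0)).
  rewrite [X in _ <= X]mulrDl lerD2r; have iphi := test_space_integ hphi.
  have ivphi := test_space_integM hv' hphi.
  rewrite -(RintegralZl _ measurableT ivphi) -(RintegralZl _ measurableT iphi).
  apply: ae_le_Rintegral; [exact: integZ|exact: integZ|].
  apply: filterS vM' => x vx; rewrite mulrA ler_wpM2r//.
  rewrite (le_trans (ler_norm _))// normrM.
  by apply: ler_pM.
have vNb := bounded_rhsN hv vb; have hNv := test_spaceN hv.
have VN_le : \int[leb]_x ((- v x) ^+ 2) <= V2 by under eq_Rintegral do rewrite sqrrN.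
have v_le := hMv lam v lamL hv (bounded_rhs_subsolution vb) V_le.
have vN_le := hMv lam _ lamL hNv (bounded_rhs_subsolution vNb) VN_le.
have v_abs : {ae leb, forall x, `|v x| <= Mv}.
  by apply: filterS2 v_le vN_le => x a b; rewrite ler_norml a andbT lerNl.
have vN_abs : {ae leb, forall x, `|- v x| <= Mv}.
  by apply: filterS v_abs => x; rewrite normrN.
have e1 := final v hv vb V_le v_abs.
have e2 := final _ hNv vNb VN_le vN_abs.
apply: filterS3 uu' e1 e2 => x ux a b.
rewrite -ux -/W -/c0 -/t ler_norml.
by move: a b; rewrite /v => a b; apply/andP; split; lra.
Qed.

End antimaximum.

End dirichlet_problem.

(** * Hausdorff measure of the sphere *)

Section level_sets_of_outer_measure.
Context {R : realType} {T : Type} (mu : {outer_measure set T -> \bar R}).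
Variable g : T -> R.
Hypothesis mu_separated : forall (a b : R) (A B : set T), a < b ->
  (forall x, A x -> g x <= a) -> (forall x, B x -> b <= g x) ->
  (mu A + mu B <= mu (A `|` B))%E.

Variables (a : R) (X : set T).

Let F (m : nat) : set T := [set x | X x /\ a + m%:R^-1 <= g x].
Let S (m : nat) : set T :=
  [set x | [/\ X x, a + m.+2%:R^-1 <= g x & g x < a + m.+1%:R^-1]].

(** The two sets are separated by the levels a + 1/(m+1) < a + 1/m; m >= 1 excludes the convention
    0^-1 = 0. *)
Let le_annulus m : (1 <= m)%N -> (mu (F m) + mu (S m) <= mu (F m.+2))%E.
Proof.
move=> m1; rewrite addeC.
apply: (@le_trans _ _ (mu (S m `|` F m))).
  apply: (@mu_separated (a + m.+1%:R^-1) (a + m%:R^-1)).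
  - by rewrite ltrD2l ltf_pV2 ?posrE ?ltr0n// ltr_nat.
  - by move=> x [_ _ /ltW].
  - by move=> x [].
apply: le_outer_measure => x [[Xx h _]|[Xx h]]; split => //.
apply: le_trans h; rewrite lerD2l lef_pV2 ?posrE ?ltr0n// ler_nat.
by rewrite -addn2 leq_addr.
Qed.

(** Adjacent layers are not separated, but every second one is. Even and odd layers each total at
    most mu X; carrying two consecutive F in the induction replaces a split by parity. *)
Let sum_annuli k : (\sum_(0 <= m < k) mu (S m.+1) <= mu X + mu X)%E.
Proof.
have FX m : (mu (F m) <= mu X)%E by apply: le_outer_measure => x [].
suff : (\sum_(0 <= m < k) mu (S m.+1) <= mu (F k.+1) + mu (F k.+2))%E.
  by move=> /le_trans; apply; apply: leeD.
elim: k => [|k IH]; first by rewrite big_nil adde_ge0 ?outer_measure_ge0.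
rewrite big_nat_recr//=; apply: le_trans (leeD IH (le_refl _)) _.
rewrite (addeC (mu (F k.+1))) -addeA; apply: leeD => //.
exact: le_annulus.
Qed.

(* The layers of [X] between consecutive levels have finite total measure, so
   the part of [X] just above the level [a] is negligible in the limit. *)
Lemma superlevel_splits :
  (mu (X `&` [set x : T | (a < g x)%R]) +
   mu (X `&` ~` [set x : T | (a < g x)%R]) <= mu X)%E.
Proof.
set E := [set x : T | (a < g x)%R].
have [Xoo|Xfin] := eqVneq (mu X) +oo%E; first by rewrite Xoo leey.
have Xlt : (mu X < +oo)%E by rewrite ltey.
have Sfin : (\sum_(k <oo) mu (S k.+1) < +oo)%E.
  apply: (@le_lt_trans _ _ (mu X + mu X)%E); last exact: lte_add_pinfty.
  apply: lime_le.
    by apply: is_cvg_nneseries => i _ _; exact: outer_measure_ge0.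
  exact: nearW.
have sep k : (mu (F k.+1) + mu (X `&` ~` E) <= mu X)%E.
  rewrite addeC; apply: (@le_trans _ _ (mu ((X `&` ~` E) `|` F k.+1))).
    apply: (@mu_separated a (a + k.+1%:R^-1)).
    - by rewrite ltrDl invr_gt0 ltr0n.
    - by move=> x [_ /negP]; rewrite -leNgt.
    - by move=> x [].
  by apply: le_outer_measure => x [[]|[]].
have cover k : (mu (X `&` E) <=
    mu (F k.+2) + \sum_(k <= i <oo) mu (S i.+1))%E.
  have XES : X `&` E `<=` F k.+2 `|` \bigcup_(i in ~` `I_k) S i.+1.
    move=> x [Xx ax].
    have [h|h] := leP (a + k.+2%:R^-1) (g x); first by left; split.
    right.
    pose P i := (a + i.+1%:R^-1 <= g x).
    have [j0 Pj0] : exists j, P j.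
      exists (Num.truncn (g x - a)^-1).
      rewrite /P -lerBrDl invf_ple ?posrE ?ltr0n ?subr_gt0//.
      by apply/ltW/truncnS_gt; rewrite invr_ge0 subr_ge0 ltW.
    (* The least j with a + 1/(j+1) <= g(x) identifies the layer containing x. *)
    case: (ex_minnP (ex_intro P j0 Pj0)) => j Pj minj.
    have kj : (k.+1 < j)%N.
      rewrite ltnNge; apply/negP => jk; move: h; rewrite ltNge => /negP; apply.
      apply: le_trans Pj; rewrite lerD2l lef_pV2 ?posrE ?ltr0n// ler_nat.
      by rewrite ltnS.
    case: j kj Pj minj => [//|[//|j]] kj Pj minj.
    exists j; [by apply/negP; rewrite -leqNgt -ltnS|split => //].
    rewrite real_ltNge ?num_real//; apply/negP => h'.
    by have := minj j.+1 h'; rewrite ltnn.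
  apply: (@le_trans _ _ (mu (F k.+2 `|`
    \bigcup_(i in ~` `I_k) S i.+1))).
    exact: le_outer_measure.
  apply: le_trans (outer_measureU2 _ _ _) _.
  apply: leeD => //; exact: (outer_measure_sigma_subadditive_tail mu k (fun i => S i.+1)).
have tail : (\sum_(k <= i <oo) mu (S i.+1) @[k --> \oo] --> 0)%E.
  by apply: nneseries_tail_cvg => // i _; exact: outer_measure_ge0.
have le_tail k : (mu (X `&` E) + mu (X `&` ~` E) <=
    mu X + \sum_(k <= i <oo) mu (S i.+1))%E.
  apply: le_trans (leeD (cover k) (le_refl _)) _.
  by rewrite -addeA (addeC (limn _)) addeA; apply: leeD => //; exact: sep.
have cvgX : (mu X + \sum_(k <= i <oo) mu (S i.+1) @[k --> \oo] --> mu X)%E.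
  rewrite -[X in _ --> X]adde0; apply: cvgeD => //; last exact: cvg_cst.
  by rewrite fin_num_adde_defl.
by apply: cvge_ge cvgX; exact: nearW.
Qed.

End level_sets_of_outer_measure.

(** * Lipschitz functions are measurable for Hausdorff measure *)

Section hausdorff_measurability.
Context {R : realType} {N : nat} (k : nat).
Local Notation V := 'rV[R]_N.

Lemma diam_ge0 (C : set V) : 0 <= diam C.
Proof.
rewrite /diam; have [[[r [z Cz zr]] hub]|/sup_out ->//] := pselect (has_sup
  [set enorm (z.1 - z.2) | z in C `*` C]).
apply: (@le_trans _ _ r); first by rewrite -zr enorm_ge0.
by apply: ub_le_sup => //; exists z.
Qed.

Lemma unit_ball_volume_ge0 : 0 <= unit_ball_volume k :> R.
Proof. by rewrite fine_ge0. Qed.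

Lemma hausdorff_gauge_ge0 (d : R) (C : set V) :
  (0 <= hausdorff_gauge k d C)%E.
Proof.
rewrite /hausdorff_gauge; case: asboolP => // _; case: asboolP => // _.
rewrite lee_fin mulr_ge0 ?unit_ball_volume_ge0 ?exprn_ge0//.
by rewrite divr_ge0 ?diam_ge0.
Qed.

Lemma hausdorff_gauge0 (d : R) : hausdorff_gauge k d (set0 : set V) = 0%E.
Proof. by rewrite /hausdorff_gauge; case: asboolP. Qed.

Lemma le_hausdorff_gauge (d d' : R) (C : set V) : d' <= d ->
  (hausdorff_gauge k d C <= hausdorff_gauge k d' C)%E.
Proof.
move=> dd; rewrite /hausdorff_gauge; case: asboolP => // _.
case: asboolP => [_|nd]; case: asboolP => [h|_] //; first exact: leey.
by exfalso; apply: nd => x y Cx Cy; apply: le_trans dd; exact: h.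
Qed.

Lemma le_mu_ext_gauge (d d' : R) (A : set V) : d' <= d ->
  (mu_ext (hausdorff_gauge k d) A <= mu_ext (hausdorff_gauge k d') A)%E.
Proof.
move=> dd; apply: le_ereal_inf_tmp => _ [F [mF AF] <-].
apply: le_trans (_ : \sum_(i <oo) hausdorff_gauge k d (F i) <= _)%E.
  by apply: ereal_inf_lbound; exists F.
apply: lee_nneseries => [i _ _|i _]; first exact: hausdorff_gauge_ge0.
exact: le_hausdorff_gauge.
Qed.

Lemma mu_ext_le_hausdorff (d : R) (A : set V) : 0 < d ->
  (mu_ext (hausdorff_gauge k d) A <= hausdorff k A)%E.
Proof. by move=> d0; apply: ereal_sup_ubound; exists d. Qed.

Variables (g : V -> R).
Hypothesis glip : forall x y, g x - g y <= enorm (x - y).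

(** A set of finite gauge has diameter at most d < b - a and cannot meet both A and B, so each cover
    of the union splits into disjoint subfamilies covering A and B. *)
Lemma mu_ext_gauge_separated (d a b : R) (A B : set V) : d < b - a ->
  (forall x, A x -> g x <= a) -> (forall x, B x -> b <= g x) ->
  (mu_ext (hausdorff_gauge k d) A + mu_ext (hausdorff_gauge k d) B <=
   mu_ext (hausdorff_gauge k d) (A `|` B))%E.
Proof.
move=> dab gA gB; apply: le_ereal_inf_tmp => _ [F [mF ABF] <-].
(* Discarded members become empty, with gauge 0, so the indexing is unchanged. *)
pose restr (D : set V) i : set V :=
  if `[< F i `&` D !=set0 >] then F i else set0.
have cov (D : set V) : D `<=` A `|` B ->
    (mu_ext (hausdorff_gauge k d) D <=
     \sum_(i <oo) hausdorff_gauge k d (restr D i))%E.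
  move=> DAB; apply: ereal_inf_lbound; exists (restr D) => //; split.
    by move=> i; rewrite /restr; case: asboolP.
  move=> x Dx; have [i _ Fix] := ABF x (DAB x Dx).
  exists i => //; rewrite /restr; case: asboolP => // nD.
  by exfalso; apply: nD; exists x.
apply: le_trans (leeD (cov A _) (cov B _)) _ => [x Ax|x Bx|]; [by left|by right|].
rewrite -nneseriesD; [|by move=> i _ _; exact: hausdorff_gauge_ge0..].
apply: lee_nneseries => [i _ _|i _].
  by rewrite adde_ge0 ?hausdorff_gauge_ge0.
rewrite /restr; case: asboolP => [[x [Fx Ax]]|_]; last first.
  rewrite hausdorff_gauge0 add0e; case: asboolP => // _.
  by rewrite hausdorff_gauge0 hausdorff_gauge_ge0.
case: asboolP => [[y [Fy By]]|_]; last by rewrite hausdorff_gauge0 adde0.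
rewrite /hausdorff_gauge; case: asboolP => [F0|_]; first by rewrite adde0.
case: asboolP => // h; exfalso.
have := h y x Fy Fx; apply/negP; rewrite -ltNge.
apply: (lt_le_trans dab); apply: le_trans (glip y x).
by apply: lerB; [exact: gB|exact: gA].
Qed.

(** For two scales d1 and d2, a common smaller scale below b - a is used. Finiteness then lets the
    suprema over d1 and d2 be taken one at a time. *)
Lemma hausdorff_separated (a b : R) (A B : set V) : a < b ->
  (forall x, A x -> g x <= a) -> (forall x, B x -> b <= g x) ->
  (hausdorff k A + hausdorff k B <= hausdorff k (A `|` B))%E.
Proof.
move=> ab gA gB.
have [->|oo] := eqVneq (hausdorff k (A `|` B)) +oo%E; first exact: leey.
have m (d1 d2 : R) : 0 < d1 -> 0 < d2 ->
    (mu_ext (hausdorff_gauge k d1) A + mu_ext (hausdorff_gauge k d2) B <=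
     hausdorff k (A `|` B))%E.
  move=> d10 d20.
  pose d := Num.min (Num.min d1 d2) ((b - a) / 2).
  have d0 : 0 < d by rewrite !lt_min d10 d20 divr_gt0// subr_gt0.
  apply: le_trans (mu_ext_le_hausdorff _ d0).
  apply: le_trans (mu_ext_gauge_separated _ gA gB); last first.
    rewrite /d gt_min; apply/orP; right.
    by rewrite ltr_pdivrMr// ltr_pMr ?ltr1n ?subr_gt0.
  apply: leeD; apply: le_mu_ext_gauge; rewrite /d !ge_min ?lexx ?orbT//.
have fin (D : set V) : D `<=` A `|` B -> hausdorff k D \is a fin_num.
  move=> DAB; rewrite ge0_fin_numE; last exact: (outer_measure_ge0 (hausdorff_outer k)).
  apply: (@le_lt_trans _ _ (hausdorff k (A `|` B))); last by rewrite ltey.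
  exact: (le_outer_measure (hausdorff_outer k)).
rewrite -leeBrDr; last by apply: fin; right.
apply: ge_ereal_sup => _ [d1 d10 <-].
rewrite leeBrDr; last by apply: fin; right.
have f1 : mu_ext (hausdorff_gauge k d1) A \is a fin_num.
  rewrite ge0_fin_numE; last by apply: mu_ext_ge0; exact: hausdorff_gauge_ge0.
  apply: (@le_lt_trans _ _ (hausdorff k A)); first exact: mu_ext_le_hausdorff.
  rewrite -ge0_fin_numE; last exact: (outer_measure_ge0 (hausdorff_outer k)).
  by apply: fin; left.
rewrite -leeBrDl//.
apply: ge_ereal_sup => _ [d2 d20 <-].
by rewrite leeBrDl//; exact: m.
Qed.

(** This makes the sphere and the integrand of [Kconst] measurable, through [enorm] and [edot] with
    a unit vector. *)
Lemma hausdorff_measurable_lipschitz :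
  measurable_fun setT (g : caratheodory_type (@hausdorff_outer R N k) -> R).
Proof.
apply: (measurability (@RGenOInfty.G R)) => [|_ [_ [a ->] <-]].
  exact: RGenOInfty.measurableE.
rewrite setTI; apply: le_caratheodory_measurable => X.
have -> : g @^-1` `]a, +oo[ = [set x : V | a < g x].
  by apply/seteqP; split => x /=; rewrite in_itv/= andbT.
apply: (@superlevel_splits _ _ (hausdorff_outer k) g).
exact: hausdorff_separated.
Qed.

End hausdorff_measurability.

(** * The sphere has finite Hausdorff measure *)

Section hausdorff_sphere.
Context {R : realType} {n : nat}.
Local Notation V := 'rV[R]_n.+1.
Local Notation omega := (unit_ball_volume n : R).

Lemma measurable_col' (i : 'I_n.+1) :
  measurable_fun setT (fun x : V => col' i x).
Proof.
apply: measurable_fun_rVP => j.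
rewrite (_ : (fun _ => _) = fun x : V => x 0 (lift i j)).
  exact: measurable_coord.
by apply/funext => x; rewrite mxE.
Qed.

Lemma enorm_col' (i : 'I_n.+1) (x : V) :
  enorm x ^+ 2 = x 0 i ^+ 2 + enorm (col' i x) ^+ 2.
Proof.
rewrite !enorm_sqr /edot (bigD1_ord i)//= expr2; congr (_ + _).
by apply: eq_bigr => j _; rewrite mxE.
Qed.

Lemma hausdorff_gauge_le (d r : R) (D : set V) : 0 <= r -> r <= d ->
  (forall x y, D x -> D y -> enorm (x - y) <= r) ->
  (hausdorff_gauge n d D <= (omega * (r / 2) ^+ n)%:E)%E.
Proof.
move=> r0 rd Dr; rewrite /hausdorff_gauge; case: asboolP => [_|/eqP/set0P[x0 Dx0]].
  by rewrite lee_fin mulr_ge0 ?unit_ball_volume_ge0 ?exprn_ge0 ?divr_ge0.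
case: asboolP => [_|h]; last first.
  by exfalso; apply: h => x y Dx Dy; apply: le_trans rd; exact: Dr.
rewrite lee_fin ler_wpM2l ?unit_ball_volume_ge0//.
have dr : diam D <= r.
  apply: ge_sup; first by exists 0, (x0, x0) => //=; rewrite subrr enorm0.
  by move=> _ [[x y] [/= Dx Dy] <-]; exact: Dr.
by rewrite lerXn2r ?nnegrE ?divr_ge0 ?diam_ge0// ler_pM2r// invr_gt0.
Qed.

Lemma mu_ext_gauge_finite_cover (d c : R) (X : set V) (s : seq (set V)) :
  (forall D, D \in s -> measurable D /\ (hausdorff_gauge n d D <= c%:E)%E) ->
  (forall x, X x -> exists2 D, D \in s & D x) ->
  (mu_ext (hausdorff_gauge n d) X <= ((size s)%:R * c)%:E)%E.
Proof.
move=> hs sX; pose F k := nth set0 s k.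
apply: (@le_trans _ _ (\sum_(k <oo) hausdorff_gauge n d (F k))%E).
  apply: ereal_inf_lbound; exists F => //; split.
    move=> k; rewrite /F; have [ks|ks] := ltnP k (size s).
      by have [] := hs _ (mem_nth set0 ks).
    by rewrite nth_default.
  move=> x /sX[D sD Dx]; exists (index D s) => //.
  by rewrite /F nth_index.
rewrite (nneseries_split 0 (size s)); last first.
  by move=> k _; exact: hausdorff_gauge_ge0.
rewrite add0n eseries0 ?adde0; last first.
  by move=> k sk _; rewrite /F nth_default// hausdorff_gauge0.
apply: (@le_trans _ _ (\sum_(0 <= k < size s) c%:E)%E).
  rewrite big_nat [leRHS]big_nat; apply: lee_sum => k /andP[_ ks].
  by have [] := hs _ (mem_nth set0 ks).
by rewrite sumEFin sumr_const_nat subn0 mulr_natl.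
Qed.

Lemma sphere_large_coord (x : V) : enorm x = 1 ->
  exists i, n.+1%:R^-1 <= `|x 0 i|.
Proof.
move=> x1; apply: contrapT => h.
suff : enorm x < 1 by rewrite x1 ltxx.
apply: le_lt_trans (ler_enorm_sum x) _.
have <- : \sum_(i < n.+1) n.+1%:R^-1 = 1 :> R.
  by rewrite sumr_const card_ord -[LHS]mulr_natl mulfV// pnatr_eq0.
apply: ltr_sum; first by apply/hasP; exists ord0; rewrite ?mem_index_enum.
by move=> i _; rewrite ltNge; apply/negP => hi; apply: h; exists i.
Qed.

(** Where the i-th coordinate has a fixed sign and size at least 1/(n+1), the sphere is a Lipschitz
    graph over the others: they control X^2 - Y^2, and X + Y >= 2/(n+1) can be divided out. *)
Lemma sphere_patch_dist (i : 'I_n.+1) (b : bool) (t : R) (x y : V) :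
  0 <= t -> enorm x = 1 -> enorm y = 1 ->
  n.+1%:R^-1 <= (-1) ^+ b * x 0 i -> n.+1%:R^-1 <= (-1) ^+ b * y 0 i ->
  (forall j, `|col' i x 0 j - col' i y 0 j| <= t) ->
  enorm (x - y) <= n.+1%:R ^+ 3 * t.
Proof.
move=> t0 x1 y1 xi yi xyt.
have p1 : 1 <= n.+1%:R :> R by rewrite ler1n.
set p := n.+1%:R : R in xi yi p1 *.
have p0 : 0 < p by rewrite (lt_le_trans _ p1).
rewrite exprS -mulrA; apply: enorm_le_coord => k; rewrite !mxE.
have coord_le (z : V) l : enorm z = 1 -> `|z 0 l| <= 1.
  by move=> <-; exact: normr_coord_le_enorm.
case: (unliftP i k) => [j|] ->.
  have := xyt j; rewrite !mxE => /le_trans; apply.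
  by rewrite ler_peMl// expr_ge1// ltW.
set X := (-1) ^+ b * x 0 i in xi; set Y := (-1) ^+ b * y 0 i in yi.
have XY : `|x 0 i - y 0 i| = `|X - Y|.
  by rewrite /X /Y -mulrBr normrM normrX normrN1 expr1n mul1r.
have XY2 : X ^+ 2 - Y ^+ 2 = \sum_(j < n)
    (col' i y 0 j - col' i x 0 j) * (col' i y 0 j + col' i x 0 j).
  have -> : X ^+ 2 = x 0 i ^+ 2 by rewrite exprMn sqrr_sign mul1r.
  have -> : Y ^+ 2 = y 0 i ^+ 2 by rewrite exprMn sqrr_sign mul1r.
  have := enorm_col' i x; have := enorm_col' i y; rewrite x1 y1 => Ey Ex.
  transitivity (enorm (col' i y) ^+ 2 - enorm (col' i x) ^+ 2).
    by move: Ex Ey; move: (enorm _ ^+ 2) (enorm _ ^+ 2) => a c Ex Ey; lra.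
  rewrite !enorm_sqr /edot -sumrB; apply: eq_bigr => j _; ring.
have num : `|X ^+ 2 - Y ^+ 2| <= p * (2 * t).
  rewrite XY2; apply: le_trans (ler_norm_sum _ _ _) _.
  apply: (@le_trans _ _ (\sum_(j < n) (2 * t))).
    apply: ler_sum => j _; rewrite normrM mulrC.
    apply: ler_pM => //; last by rewrite distrC.
    apply: le_trans (ler_normD _ _) _.
    by rewrite -[2]/(1 + 1) lerD// mxE coord_le.
  rewrite sumr_const card_ord -[leLHS]mulr_natl ler_wpM2r ?mulr_ge0//.
  by rewrite ler_nat.
have pV0 : 0 < p^-1 by rewrite invr_gt0.
have den : 2 * p^-1 <= X + Y by rewrite mulr_natl mulr2n lerD.
have : `|X - Y| * (2 * p^-1) <= p * (2 * t).
  apply: le_trans num.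
  rewrite subr_sqr normrM ler_wpM2l//; apply: le_trans den _; exact: ler_norm.
rewrite XY => h; have -> : p ^+ 2 * t = p * (2 * t) / (2 * p^-1).
  by field; rewrite gt_eqF.
by rewrite ler_pdivlMr// mulr_gt0.
Qed.

(** With p = n+1, the sphere is covered by 2 p (2m+1)^n patches of diameter at most 2 p^3 / m. Since
    2m+1 <= 3m, the gauge sum stays below 2 p omega (3 p^3)^n at every scale. *)
Lemma hausdorff_sphere_lty : (hausdorff n (sphere : set V) < +oo)%E.
Proof.
set p := n.+1%:R : R.
have p1 : 1 <= p by rewrite ler1n.
have p0 : 0 < p by rewrite (lt_le_trans _ p1).
apply: (@le_lt_trans _ _ (2 * p * omega * (3 * p ^+ 3) ^+ n)%:E);
  last exact: ltry.
apply: ge_ereal_sup => _ [d d0 <-].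
(* The mesh 1/m is fine enough to bring the diameters below d, where the gauge is finite. *)
pose m := (Num.truncn (2 * p ^+ 3 / d)).+1.
have md : 2 * p ^+ 3 / m%:R <= d.
  rewrite ler_pdivrMr ?ltr0n// [d * _]mulrC -ler_pdivrMr//.
  by apply/ltW/truncnS_gt; rewrite divr_ge0 ?mulr_ge0 ?exprn_ge0// ltW.
have m0 : 0 < m%:R :> R by rewrite ltr0n.
pose I : finType := ('I_n.+1 * bool * {ffun 'I_n -> 'I_(2 * m).+1})%type.
pose ctr (c : {ffun 'I_n -> 'I_(2 * m).+1}) : 'rV[R]_n :=
  \row_j ((c j)%:R / m%:R - 1).
pose D (l : I) : set V := [set x | [/\ enorm x = 1,
  p^-1 <= (-1) ^+ l.1.2 * x 0 l.1.1 & cube (ctr l.2) m%:R^-1 (col' l.1.1 x)]].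
apply: (@le_trans _ _ ((size (map D (enum I)))%:R *
    (omega * (2 * p ^+ 3 / m%:R / 2) ^+ n))%:E).
  apply: mu_ext_gauge_finite_cover => [_ /mapP[[[i b] c] _ ->]|x x1].
    split.
      rewrite (_ : D _ = ([set x : V | enorm x <= 1] `&`
        [set x : V | 1 <= enorm x]) `&` ([set x : V |
        p^-1 <= (-1) ^+ b * x 0 i] `&`
        (fun x : V => col' i x) @^-1` (cube (ctr c) m%:R^-1))).
        apply: measurableI; apply: measurableI.
        - apply: measurable_sublevel; exact: measurable_enorm.
        - apply: measurable_superlevel; exact: measurable_enorm.
        - apply: measurable_superlevel; apply: measurable_funM => //.
          exact: measurable_coord.
        - rewrite -[X in measurable X]setTI.
          by apply: measurable_col' => //; exact: measurable_cube.
      apply/seteqP; split => x.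
        by move=> [x1 xi xc]; split; split => //=; rewrite x1.
      move=> [[/= a1 a2] [/= a3 a4]]; split => //.
      by apply/eqP; rewrite eq_le a1 a2.
    apply: hausdorff_gauge_le => //.
      by rewrite divr_ge0// mulr_ge0// exprn_ge0// ltW.
    move=> x y [x1 xi xc] [y1 yi yc].
    have -> : 2 * p ^+ 3 / m%:R = p ^+ 3 * (m%:R^-1 + m%:R^-1).
      by field; rewrite gt_eqF.
    apply: (sphere_patch_dist _ x1 y1 xi yi).
      by rewrite addr_ge0// invr_ge0 ltW.
    move=> j; rewrite -(subrKA (ctr c 0 j)).
    apply: le_trans (ler_normD _ _) _; apply: lerD; first exact: xc.
    by rewrite distrC; exact: yc.
  have [i xi] := sphere_large_coord x1.
  have x1le j : `|x 0 j| <= 1 by rewrite -x1 normr_coord_le_enorm.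
  have tb j :
      (Num.truncn ((x 0 (lift i j) + 1) * m%:R : R)%R < (2 * m).+1)%N.
    rewrite ltnS -(ler_nat R); have := x1le (lift i j).
    rewrite ler_norml => /andP[h1 h2].
    apply: (@le_trans _ _ ((x 0 (lift i j) + 1) * m%:R)).
      by rewrite truncn_le mulr_ge0 ?(ltW m0)//; lra.
    by rewrite natrM ler_pM2r//; lra.
  pose c : {ffun 'I_n -> 'I_(2 * m).+1} := [ffun j => Ordinal (tb j)].
  exists (D (i, (x 0 i < 0), c)).
    by apply: map_f; rewrite mem_enum.
  split => //=.
    by rewrite -normrEsign.
  move=> j; rewrite !mxE ffunE /=.
  set y := x 0 (lift i j).
  have y0 : 0 <= (y + 1) * m%:R.
    have := x1le (lift i j); rewrite ler_norml => /andP[h1 h2].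
    by rewrite mulr_ge0 ?(ltW m0)// /y; lra.
  have -> : y - ((Num.truncn ((y + 1) * m%:R))%:R / m%:R - 1) =
     ((y + 1) * m%:R - (Num.truncn ((y + 1) * m%:R))%:R) / m%:R.
    by field; rewrite gt_eqF.
  rewrite normrM (ger0_norm (_ : 0 <= m%:R^-1)) ?invr_ge0 ?(ltW m0)//.
  rewrite ler_piMl ?invr_ge0 ?(ltW m0)//.
  have /andP[h1 h2] := truncn_itv y0.
  rewrite ger0_norm ?subr_ge0// lerBlDl.
  by apply: ltW; rewrite natr1.
rewrite lee_fin size_map -cardE !card_prod card_ord card_bool card_ffun.
rewrite !card_ord.
have -> : 2 * p ^+ 3 / m%:R / 2 = p ^+ 3 / m%:R by field; rewrite gt_eqF.
rewrite !natrM natrX -/p.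
have -> : p * 2%:R * (2 * m).+1%:R ^+ n * (omega * (p ^+ 3 / m%:R) ^+ n) =
    2 * p * omega * ((2 * m).+1%:R * (p ^+ 3 / m%:R)) ^+ n.
  rewrite (exprMn n (_.+1%:R)); move: (_.+1%:R ^+ n) ((p ^+ 3 / _) ^+ n) => a b.
  by move: omega => om; ring.
rewrite ler_wpM2l ?mulr_ge0 ?unit_ball_volume_ge0 ?(ltW p0)//.
have q0 : 0 < p ^+ 3 by rewrite exprn_gt0.
rewrite lerXn2r ?nnegrE ?mulr_ge0 ?divr_ge0 ?(ltW q0)//.
rewrite mulrCA mulrC ler_pM2r// ler_pdivrMr//.
by rewrite -(natrM _ 3) ler_nat [(3 * m)%N]mulSn addnC -addn1 leq_add2l.
Qed.

End hausdorff_sphere.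

(** Finiteness is part of the claim: a real integral is 0 by convention when the extended one is
    infinite. *)
Lemma Rintegral_sqr_gt0 d (T : measurableType d) (R : realType)
    (mu : {measure set T -> \bar R}) (D : set T) (f : T -> R) (c : R) :
  0 < c -> measurable D -> measurable_fun setT f -> (mu D < +oo)%E ->
  (0 < mu (D `&` [set x : T | (c <= `|f x|)%R]))%E ->
  (forall x, D x -> `|f x| <= 1) ->
  0 < \int[mu]_(x in D) (`|f x| ^+ 2).
Proof.
move=> c0 mD mf Doo Dc f1.
set C := [set x : T | (c <= `|f x|)%R] in Dc.
have mC : measurable C.
  by apply: measurable_superlevel; exact: measurableT_comp.
have m2 : measurable_fun D (fun x => (`|f x| ^+ 2)%:E).
  apply: measurable_funTS; apply: measurable_EFin; apply: measurable_funX.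
  exact: measurableT_comp.
have mi : measurable_fun D (fun x => (\1_C x)%:E : \bar R).
  by apply: measurable_funTS; apply: measurable_EFin; exact: measurable_indic.
apply: fine_gt0; apply/andP; split.
  apply: (@lt_le_trans _ _ (\int[mu]_(x in D) ((c ^+ 2)%:E * (\1_C x)%:E))%E).
    rewrite (ge0_integralZl mu mD mi).
    - rewrite integral_indic// setIC.
      by apply: mule_gt0 => //; rewrite lte_fin exprn_gt0.
    - by move=> x _; rewrite lee_fin.
    - by rewrite lee_fin exprn_ge0// ltW.
  apply: ge0_le_integral => //.
  - by move=> x _; rewrite -EFinM lee_fin mulr_ge0// exprn_ge0// ltW.
  - by apply: emeasurable_funM => //.
  - move=> x _; rewrite -EFinM lee_fin indicE.
    have [|_] := boolP (x \in _); last by rewrite mulr0 exprn_ge0.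
    by rewrite inE => xe; rewrite mulr1 lerXn2r ?nnegrE ?(ltW c0).
apply: (@le_lt_trans _ _ (\int[mu]_(x in D) (cst 1%E x))%E).
  apply: ge0_le_integral => //.
  - by move=> x x1; rewrite lee_fin expr_le1// f1.
by rewrite integral_cst// mul1e.
Qed.

(** The ball lies between the cubes of radius 1/(k+1) and 1; k+1 instead of k also covers dimension
    0. *)
Lemma unit_ball_volume_gt0 (R : realType) k : 0 < unit_ball_volume k :> R.
Proof.
set B := [set x : 'rV[R]_k | enorm x <= 1].
have mB : measurable B by apply: measurable_sublevel; exact: measurable_enorm.
have B1 : (lebesgue_rV k B <= ((2 * 1) ^+ k)%:E)%E.
  rewrite -(lebesgue_rV_cube (0 : 'rV[R]_k) ler01).
  apply: le_measure; rewrite ?inE//; first exact: measurable_cube.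
  move=> x Bx i; rewrite mxE subr0; apply: le_trans Bx.
  exact: normr_coord_le_enorm.
have r0 : 0 <= k.+1%:R^-1 :> R by rewrite invr_ge0.
have B0 : (((2 * k.+1%:R^-1) ^+ k)%:E <= lebesgue_rV k B)%E.
  rewrite -(lebesgue_rV_cube (0 : 'rV[R]_k) r0).
  apply: le_measure; rewrite ?inE//; first exact: measurable_cube.
  move=> x Cx; rewrite /B/=; apply: le_trans (enorm_le_coord (a := k.+1%:R^-1) _) _.
    by move=> i; have := Cx i; rewrite mxE subr0.
  by rewrite ler_pdivrMr ?ltr0n// mul1r ler_nat.
apply: fine_gt0; apply/andP; split.
  by apply: lt_le_trans B0; rewrite lte_fin exprn_gt0// mulr_gt0// invr_gt0 ltr0n.
by apply: le_lt_trans B1 _; rewrite ltry.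
Qed.

(** * A spherical cap has positive Hausdorff measure *)

Section hausdorff_cap.
Context {R : realType} {n : nat}.
Local Notation V := 'rV[R]_n.+1.
Local Notation omega := (unit_ball_volume n : R).

(** The projection of F is enclosed in a cube of radius diam F, which spares its measurability; the
    volume (2 diam F)^n is 4^n (diam F / 2)^n. *)
Lemma lebesgue_proj_le_gauge (i : 'I_n.+1) (d : R) (F : set V) :
  exists D : set 'rV[R]_n, [/\ measurable D, col' i @` F `<=` D &
   (hausdorff_gauge n d F < +oo ->
    lebesgue_rV n D <= (4 ^+ n / omega)%:E * hausdorff_gauge n d F)%E].
Proof.
rewrite /hausdorff_gauge; case: asboolP => [->|/eqP/set0P[x0 Fx0]].
  exists set0; split => //; last by rewrite measure0 mule0.
  by move=> _ [x []].
case: asboolP => [Fd|_]; last first.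
  by exists setT; split => //; rewrite ltxx.
exists (cube (col' i x0) (diam F)); split; first exact: measurable_cube.
  move=> _ [x Fx <-] j.
  apply: (@le_trans _ _ (enorm (x - x0))).
    have := normr_coord_le_enorm (x - x0) (lift i j); rewrite !mxE; exact.
  apply: ub_le_sup; last by exists (x, x0).
  by exists d => _ [[a b] [/= Fa Fb] <-]; exact: Fd.
rewrite lebesgue_rV_cube ?diam_ge0// -EFinM lee_fin => _.
have o0 := unit_ball_volume_gt0 R n.
rewrite mulrA divfK ?gt_eqF// -exprMn.
rewrite (_ : 4 * (diam F / 2) = 2 * diam F)//.
by field.
Qed.

Lemma hausdorff_ge_proj (i : 'I_n.+1) (rho : R) (A : set V) : 0 <= rho ->
  cube 0 rho `<=` col' i @` A ->
  ((omega / 4 ^+ n * (2 * rho) ^+ n)%:E <= hausdorff n A)%E.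
Proof.
move=> rho0 rhoA; have o0 := unit_ball_volume_gt0 R n.
apply: le_trans (mu_ext_le_hausdorff n A ltr01).
apply: le_ereal_inf_tmp => _ [F [mF AF] <-].
set g := hausdorff_gauge n 1.
have [Soo|Sfin] := eqVneq (\sum_(k <oo) g (F k))%E +oo%E.
  by rewrite Soo leey.
have g0 k : (0 <= g (F k))%E by exact: hausdorff_gauge_ge0.
have gfin k : (g (F k) < +oo)%E.
  rewrite ltey; apply/negP => /eqP gk; move/negP: Sfin; apply; apply/eqP.
  by rewrite (eseries_pinfty _ _ gk)// => m _; rewrite -ltNye (lt_le_trans _ (g0 m)).
have [D hD] := choice (fun k => lebesgue_proj_le_gauge i 1 (F k)).
have q0 : 0 < 4 ^+ n / omega by rewrite divr_gt0// exprn_gt0.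
have : (lebesgue_rV n (cube (0 : 'rV[R]_n) rho) <=
    \sum_(k <oo) lebesgue_rV n (D k))%E.
  apply: measure_sigma_subadditive; first by move=> k; have [] := hD k.
    exact: measurable_cube.
  move=> y /rhoA[x Ax <-]; have [k _ Fx] := AF x Ax.
  by exists k => //; have [_ + _] := hD k; apply; exists x.
rewrite lebesgue_rV_cube// => h.
have : (((2 * rho) ^+ n)%:E <= (4 ^+ n / omega)%:E * \sum_(k <oo) g (F k))%E.
  apply: le_trans h _; rewrite -nneseriesZl//.
  apply: lee_nneseries => // k _; have [_ _] := hD k; apply; exact: gfin.
rewrite -lee_pdivrMl//; apply: le_trans; rewrite -EFinM lee_fin.
by rewrite invf_div.
Qed.

Variable e : V.
Hypothesis he : enorm e = 1.

Definition cap : set V := [set x | enorm x = 1 /\ (4 * n.+1%:R)^-1 <= edot x e].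

(** With p = n+1, some |e_i| >= 1/p. Each y in a small cube lifts to a point x of the sphere with
    <x, e> >= 3/(4p) - 1/(4p), so the cap projects onto that cube along the i-th axis. *)
Lemma hausdorff_cap_gt0 : (0 < hausdorff n cap)%E.
Proof.
have [i ei] := sphere_large_coord he.
set p := n.+1%:R : R in ei.
have p1 : 1 <= p by rewrite ler1n.
have p0 : 0 < p by rewrite (lt_le_trans _ p1).
have rho0 : 0 < (4 * p ^+ 2)^-1 by rewrite invr_gt0 mulr_gt0// exprn_gt0.
apply: lt_le_trans (hausdorff_ge_proj (i := i) (ltW rho0) _); last first.
  move=> y yr.
  have yn : enorm y <= (4 * p)^-1.
    apply: le_trans (enorm_le_coord (a := (4 * p ^+ 2)^-1) _) _.
      by move=> j; have := yr j; rewrite mxE subr0.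
    rewrite (_ : (4 * p)^-1 = p * (4 * p ^+ 2)^-1); last first.
      by field; rewrite gt_eqF.
    by rewrite ler_wpM2r ?(ltW rho0)// ler_nat.
  have yn4 : enorm y <= 4^-1.
    by apply: le_trans yn _; rewrite lef_pV2 ?posrE ?mulr_gt0// ler_peMr.
  have y0 := enorm_ge0 y.
  have yn2 : enorm y ^+ 2 <= 4^-1.
    rewrite expr2; apply: (le_trans (ler_piMl y0 _) yn4).
    by apply: le_trans yn4 _; rewrite invf_le1// ler1n.
  (* The missing coordinate takes the sign of e_i, so that it contributes positively to <x, e>. *)
  pose a : R := (-1) ^+ (e 0 i < 0)%R * Num.sqrt (1 - enorm y ^+ 2).
  pose x : V := \row_k if unlift i k is Some j then y 0 j else a.
  have xi : x 0 i = a by rewrite mxE unlift_none.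
  have xy : col' i x = y by apply/rowP => j; rewrite !mxE liftK.
  have a2 : a ^+ 2 = 1 - enorm y ^+ 2.
    by rewrite exprMn sqrr_sign mul1r sqr_sqrtr//; lra.
  have a1 : 1 - enorm y ^+ 2 <= Num.sqrt (1 - enorm y ^+ 2).
    have h0 : 0 <= 1 - enorm y ^+ 2 by lra.
    have h1 : Num.sqrt (1 - enorm y ^+ 2) <= 1.
      apply: (@le_trans _ _ (Num.sqrt 1)); last by rewrite sqrtr1.
      by rewrite ler_wsqrtr// gerBl sqr_ge0.
    rewrite -[leLHS](sqr_sqrtr h0) [leLHS]expr2 ler_piMl//; exact: sqrtr_ge0.
  exists x => //; split.
    have : enorm x ^+ 2 = 1 by rewrite (enorm_col' i) xi xy a2; ring.
    by move=> /eqP; rewrite sqrp_eq1 ?enorm_ge0// => /eqP.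
  rewrite /edot (bigD1_ord i)//= xi.
  have h1 : (3 / 4) * p^-1 <= a * e 0 i.
    rewrite (_ : a * e 0 i = Num.sqrt (1 - enorm y ^+ 2) * `|e 0 i|).
      by apply: ler_pM; [lra|rewrite invr_ge0 (ltW p0)|apply: le_trans a1; lra|].
    by rewrite normrEsign /a mulrAC mulrC.
  have h2 : - (4 * p)^-1 <= \sum_(j < n) x 0 (lift i j) * e 0 (lift i j).
    have -> : \sum_(j < n) x 0 (lift i j) * e 0 (lift i j) =
        edot y (col' i e).
      by apply: eq_bigr => j _; rewrite !mxE liftK.
    have : `|edot y (col' i e)| <= (4 * p)^-1.
      apply: le_trans (ler_normr_edot _ _) _.
      apply: le_trans (ler_piMr y0 _) yn.
      have := enorm_col' i e; rewrite he => h.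
      rewrite -(@ler_pXn2r _ 2) ?nnegrE ?enorm_ge0// h lerDr; exact: sqr_ge0.
    by rewrite ler_norml => /andP[].
  have -> : (4 * p)^-1 = 3 / 4 * p^-1 - (4 * p)^-1 - (4 * p)^-1.
    by field; rewrite gt_eqF.
  have : 0 < (4 * p)^-1 by rewrite invr_gt0 mulr_gt0.
  by move: h1 h2; move: (_^-1) (_ * _) (\sum_(_ < n) _) => b c dd; lra.
rewrite lte_fin mulr_gt0 ?exprn_gt0 ?mulr_gt0//.
exact: unit_ball_volume_gt0.
Qed.

Let H := @hausdorff_measure R n.+1 n.
Let TH := caratheodory_type (@hausdorff_outer R n.+1 n).

Let mdot : measurable_fun setT (fun x : TH => edot (x : V) e).
Proof.
apply: hausdorff_measurable_lipschitz => x y.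
rewrite -edotNl -edotDl; apply: le_trans (ler_norm _) _.
by apply: le_trans (ler_normr_edot _ _) _; rewrite he mulr1.
Qed.

Let mnorm : measurable_fun setT (fun x : TH => enorm (x : V)).
Proof.
apply: hausdorff_measurable_lipschitz => x y.
by rewrite lerBlDr -{1}(subrK y x) ler_enormD.
Qed.

Let msphere : measurable (sphere : set TH).
Proof.
rewrite (_ : sphere = [set x : TH | enorm (x : V) <= 1] `&`
    [set x : TH | 1 <= enorm (x : V)]).
  by apply: measurableI; [exact: measurable_sublevel|exact: measurable_superlevel].
apply/seteqP; split => x; first by move=> x1; rewrite /= x1.
by move=> [/= a1 a2]; apply/eqP; rewrite eq_le a1 a2.
Qed.

Lemma Kconst_gt0 (s : R) : s < 1 -> 0 < Kconst s e.
Proof.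
move=> s1; rewrite /Kconst mulr_gt0 ?mulr_gt0 ?subr_gt0// invr_gt0.
apply: (@Rintegral_sqr_gt0 _ _ _ H _ _ (4 * n.+1%:R)^-1) => //.
- exact: hausdorff_sphere_lty.
- apply: lt_le_trans hausdorff_cap_gt0 _.
  apply: (le_outer_measure (@hausdorff_outer R n.+1 n)) => x [x1 xe].
  by split => //=; apply: le_trans xe _; exact: ler_norm.
- by move=> x x1; apply: le_trans (ler_normr_edot _ _) _; rewrite he x1 mulr1.
Qed.

End hausdorff_cap.

(** * Weak solutions *)

Section Lfun_facts.
Context d (T : measurableType d) (R : realType).
Variable mu : {measure set T -> \bar R}.

(** The integral of a nonnegative function is a supremum over simple functions below it. Seminorms
    restricted to Omega or U can thus be compared without measurability of these sets. *)
Lemma le_integral_nonmeasurable (f g : T -> \bar R) : (forall x, 0 <= f x)%E ->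
  (forall x, f x <= g x)%E -> (\int[mu]_x f x <= \int[mu]_x g x)%E.
Proof.
move=> f0 fg; rewrite !ge0_integralTE//; last first.
  by move=> x; apply: le_trans (fg x).
apply: le_ereal_sup => _ [h hf <-]; exists h => // x.
by apply: le_trans (fg x).
Qed.

Lemma Lfun2P (f : T -> R) : f \in Lfun mu 2%:E <->
  measurable_fun setT f /\ mu.-integrable setT (EFin \o (fun x => f x ^+ 2)).
Proof.
split=> [h|[mf f2]].
  split; last exact: Lfun2_integrable_sqr.
  by move: h; rewrite inE => /andP[]; rewrite inE.
rewrite inE; apply/andP; split; rewrite inE//= /finite_norm unlock.
apply: poweR_lty; move: (integ_lty f2); apply: le_lt_trans.
apply: le_integral_nonmeasurable => x; first exact: poweR_ge0.
by rewrite /= lee_fin powR_mulrn// real_normK ?num_real.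
Qed.

Lemma Lfun_oo_bounded (f : T -> R) : f \in Lfun mu +oo%E ->
  measurable_fun setT f /\
  exists2 M : R, 0 <= M & {ae mu, forall x, `|f x| <= M}.
Proof.
rewrite inE => /andP[]; rewrite !inE/= => mf; rewrite /finite_norm unlock.
move=> h; split => //; move: h; case: ifPn => [_ h|mu0 _].
  exists (Num.max (fine (ess_sup_inf.ess_sup mu (abse \o (EFin \o f)))) 0).
    by rewrite le_max lexx orbT.
  apply: filterS (ess_sup_inf.ess_sup_ge mu (abse \o (EFin \o f))) => x /= hx.
  have : ess_sup_inf.ess_sup mu (abse \o (EFin \o f)) \is a fin_num.
    by rewrite fin_numElt h andbT (lt_le_trans _ hx)// ltNyr.
  by move=> /fineK fE; move: hx; rewrite -fE lee_fin le_max => ->.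
exists 0 => //; exists setT; split => //.
by apply/eqP; rewrite -measure_le0 leNgt.
Qed.

End Lfun_facts.

Section fractional_spaces.
Context {R : realType} {n : nat} (s : R).
Local Notation V := 'rV[R]_n.+1.
Local Notation leb := (lebesgue_rV n.+1 : {sigma_finite_measure set V -> \bar R}).
Variable Omega : set V.

Lemma patch_outside0 (u : V -> R) (A : set V) : (forall x, ~ A x -> u x = 0) ->
  u \_ A = u.
Proof.
move=> u0; apply/funext => x; rewrite patchE; case: ifPn => // /negP xA.
by rewrite u0// => Ax; apply: xA; rewrite inE.
Qed.

Lemma Rintegral_outside0 (g : V -> R) : (forall x, ~ Omega x -> g x = 0) ->
  \int[leb]_(x in Omega) g x = \int[leb]_x g x.
Proof.
move=> g0; rewrite /Rintegral integral_mkcond; congr fine; apply: eq_integral.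
move=> x _; rewrite patchE; case: ifPn => // /negP xA.
by rewrite g0// => Ax; apply: xA; rewrite inE.
Qed.

Lemma gagliardo2E (A : set V) (u : V -> R) : gagliardo2 s A u =
  (\int[leb \x leb]_z (((fun z => (form_density s u u z)%:E) \_ (A `*` A)) z))%E.
Proof.
rewrite /gagliardo2 integral_mkcond; apply: eq_integral => z _.
rewrite !patchE; case: ifPn => // _.
by rewrite /form_density -expr2 real_normK ?num_real.
Qed.

Lemma form_density_ge0 (u : V -> R) z : 0 <= form_density s u u z.
Proof. by rewrite /form_density -expr2 mulr_ge0 ?sqr_ge0 ?kern_ge0. Qed.

Lemma Ws2_tildeP (u : V -> R) :
  Ws2_tilde s Omega u <-> test_space s leb Omega u.
Proof.
have ET : gagliardo2 s setT u = (\int[leb \x leb]_z (form_density s u u z)%:E)%E.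
  by rewrite gagliardo2E setXTT patch_setT.
split=> [[u0 _ [uL ug]]|[mu u0 u2 gu]].
  move: uL; rewrite /L2 patch_setT => /Lfun2P[mu u2]; split => //.
  apply: integ_ge0; [exact: measurable_form_density|exact: form_density_ge0|].
  by rewrite -ET.
have uL : u \in Lfun leb 2%:E by apply/Lfun2P.
have ug : (gagliardo2 s setT u < +oo)%E by rewrite ET; exact: integ_lty gu.
split => //; split => //.
- by rewrite /L2 patch_outside0.
- apply: le_lt_trans ug; rewrite ET gagliardo2E.
  apply: le_integral_nonmeasurable => z; rewrite patchE; case: ifPn => // _;
    by rewrite lee_fin form_density_ge0.
- by rewrite /L2 patch_setT.
Qed.

End fractional_spaces.

Lemma normr_coord_le (R : realType) n (x : 'rV[R]_n) j : `|x 0 j| <= `|x|.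
Proof.
rewrite [leRHS]/Num.norm /= mx_normrE.
exact: (le_bigmax _ (fun k : 'I_1 * 'I_n => `|x k.1 k.2|) (0, j)).
Qed.

Lemma normr_rV_le (R : realType) n (x : 'rV[R]_n) (r : R) : 0 <= r ->
  (forall j, `|x 0 j| <= r) -> `|x| <= r.
Proof.
move=> r0 xr; rewrite [leLHS]/Num.norm /= mx_normrE; apply: bigmax_le => // -[i j] _ /=.
by rewrite (ord1 i).
Qed.

Lemma normr_le_enorm (R : realType) n (x : 'rV[R]_n) : `|x| <= enorm x.
Proof. by apply: normr_rV_le; [exact: enorm_ge0|exact: normr_coord_le_enorm]. Qed.

(** Compactness in near-covering form, with the radius as parameter, gives one sup-norm margin for
    all points; it transfers because the sup norm is at most [enorm]. *)
Lemma compact_radius (R : realType) n (A U : set 'rV[R]_n) :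
  compact (closure A) -> open U -> closure A `<=` U ->
  exists2 rho : R, 0 < rho & forall x y, A x -> enorm (x - y) <= rho -> U y.
Proof.
move=> cA oU AU.
pose P (rho : R) (x : 'rV[R]_n) := forall y, `|x - y| < rho -> U y.
have : near_covering (closure A) by apply/compact_near_coveringP.
move=> /(_ R (0^'+) P _) h.
have /h : forall x, closure A x -> \forall x' \near x & r \near 0^'+, P r x'.
  move=> x /AU Ux; have /nbhs_ballP[e /= e0 xeU] := open_nbhs_nbhs (conj oU Ux).
  exists (ball x (e / 2), [set r : R | r < e / 2]) => /=.
    split; first by apply: nbhsx_ballx; rewrite divr_gt0.
    by apply: nbhs_right_lt; rewrite divr_gt0.
  move=> [x' r] /= [xx' re] y x'y; apply: xeU.
  move: xx'; rewrite -!ball_normE /= => xx'.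
  rewrite -(subrKA x'); apply: le_lt_trans (ler_normD _ _) _.
  by rewrite (splitr e) ltrD// (lt_trans x'y).
move=> hn; have : \forall r \near 0^'+, (0 : R) < r /\ (closure A `<=` P r).
  by near=> r; split; [near: r; exact: nbhs_right_gt|near: r].
move=> /filter_ex[r [r0 AP]]; exists (r / 2); first by rewrite divr_gt0.
move=> x y Ax xy; apply: (AP x); first exact: subset_closure.
apply: (@le_lt_trans _ _ (r / 2)); last by rewrite ltr_pdivrMr// ltr_pMr// ltr1n.
by apply: le_trans xy; exact: normr_le_enorm.
Unshelve. all: by end_near. Qed.

Lemma open_cube (R : realType) n (U : set 'rV[R]_n) (x : 'rV[R]_n) :
  open U -> U x -> exists2 r : R, 0 < r & cube x r `<=` U.
Proof.
move=> oU Ux; have /nbhs_ballP[e /= e0 xeU] := open_nbhs_nbhs (conj oU Ux).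
exists (e / 2); first by rewrite divr_gt0.
move=> y xy; apply: xeU; rewrite -ball_normE /=.
apply: (@le_lt_trans _ _ (e / 2)); last by rewrite ltr_pdivrMr// ltr_pMr// ltr1n.
apply: normr_rV_le; first by rewrite divr_ge0// ltW.
by move=> j; rewrite !mxE distrC; exact: xy.
Qed.

Lemma bounded_cube (R : realType) n (A : set 'rV[R]_n) : bounded_set A ->
  exists2 D : R, 0 < D & A `<=` cube 0 D.
Proof.
move=> [M [_ hM]]; exists (`|M| + 1); first by rewrite ltr_wpDl.
move=> x Ax j; rewrite mxE subr0; apply: le_trans (normr_coord_le _ _) _.
by apply: hM => //; rewrite (le_lt_trans (ler_norm M))// ltrDl.
Qed.

(** * Weak solutions belong to the space of test functions *)

Section weak_solutions.
Context {R : realType} {n : nat} (s : R).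
Local Notation V := 'rV[R]_n.+1.
Local Notation leb := (lebesgue_rV n.+1 : {sigma_finite_measure set V -> \bar R}).
Local Notation leb2 := (leb \x leb)%E.
Local Notation integ f := (leb.-integrable setT (EFin \o f)).
Local Notation integ2 f := (leb2.-integrable setT (EFin \o f)).
Variable Omega : set V.
Variable w : V -> R.
Hypothesis hw : test_space s leb Omega w.
Hypothesis w_pos : {ae leb, forall x, Omega x -> 0 < w x}.
Hypothesis ikw : integ (kern_weight s).

(** For pairs closer than rho, either one point is in Omega and both are in U, where the seminorm is
    finite, or both are off Omega and the difference is 0. [finite_gagliardo_near] handles the other
    pairs. *)
Lemma Ws2_hat_test_space (u : V -> R) : Ws2_hat s Omega u ->
  {ae leb, forall x, ~ Omega x -> u x = 0} ->
  exists2 v, test_space s leb Omega v & {ae leb, forall x, v x = u x}.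
Proof.
move=> [[mu _] [U [oU cO OU [uL ug]]] _] u0.
have [mw w_out _ _] := hw.
have [rho rho0 rhoU] := compact_radius cO oU OU.
(* {w > 0} is a measurable set that agrees with Omega up to a null set. *)
pose v x := u x * \1_[set x : V | 0 < w x] x.
have mP : measurable [set x : V | 0 < w x] by exact: measurable_ssuperlevel.
have mv : measurable_fun setT v.
  by apply: measurable_funM => //; exact: measurable_indic.
have PO x : 0 < w x -> Omega x.
  move=> wx; apply: contrapT => /w_out wx0; by rewrite wx0 ltxx in wx.
have v_out x : ~ Omega x -> v x = 0.
  by move=> xO; rewrite /v indicE memNset ?mulr0// => /PO.
have vu : {ae leb, forall x, v x = u x}.
  apply: filterS2 u0 w_pos => x ux wx; have [xO|xO] := pselect (Omega x).
    by rewrite /v indicE mem_set ?mulr1//; exact: wx.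
  by rewrite v_out// ux.
exists v; last exact: vu.
have [muU u2] := (Lfun2P leb _).1 uL.
have v2 : integ (fun x => v x ^+ 2).
  apply: (integ_le u2); first exact: measurable_funX.
  move=> x; rewrite ger0_norm ?sqr_ge0// patchE /v indicE.
  have [|_] := boolP (x \in [set x : V | 0 < w x]); last first.
    by rewrite mulr0 expr0n sqr_ge0.
  by rewrite inE => /PO xO; rewrite mulr1 mem_set//; apply: OU; exact: subset_closure.
split; [exact: mv|exact: v_out|exact: v2|].
apply: (@finite_gagliardo_near R n s leb (@lebesgue_rV_addr R n.+1) ikw v rho
  rho0 mv v2).
have [N [mN N0 hN]] := vu.
(* The comparison of integrals is pointwise, so the null set N off which v = u is cut out first. *)
pose g (z : V * V) := \1_(~` N) z.1 * \1_(~` N) z.2 *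
  (\1_[set z0 : V * V | enorm (z0.1 - z0.2) <= rho] z * form_density s v v z).
have mnear : measurable [set z0 : V * V | enorm (z0.1 - z0.2) <= rho].
  apply: measurable_sublevel.
  exact: (measurableT_comp (@measurable_enorm R n.+1) measurable_rV_sub).
have md : measurable_fun setT (fun z : V * V =>
    \1_[set z0 : V * V | enorm (z0.1 - z0.2) <= rho] z * form_density s v v z).
  apply: measurable_funM; first exact: measurable_indic.
  exact: measurable_form_density.
have mg : measurable_fun setT g.
  have mNC : measurable_fun setT (\1_(~` N) : V -> R).
    by apply: measurable_indic; exact: measurableC.
  apply: measurable_funM => //; apply: measurable_funM.
    exact: (measurableT_comp mNC measurable_fst).
  exact: (measurableT_comp mNC measurable_snd).
have g0 z : 0 <= g z.
  by rewrite /g; apply: mulr_ge0; apply: mulr_ge0;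
    first [exact: form_density_ge0|rewrite indicE ler0n].
have gi : integ2 g.
  apply: integ_ge0 => //; apply: le_lt_trans ug; rewrite gagliardo2E.
  apply: le_integral_nonmeasurable => z; first by rewrite lee_fin.
  rewrite patchE /g !indicE.
  have [|_] := boolP (z.1 \in ~` N); last first.
    by rewrite !mul0r; case: ifP => _ //; rewrite lee_fin form_density_ge0.
  rewrite inE => z1N.
  have [|_] := boolP (z.2 \in ~` N); last first.
    by rewrite mulr0 !mul0r; case: ifP => _ //; rewrite lee_fin form_density_ge0.
  rewrite inE => z2N; rewrite !mul1r.
  have [|_] := boolP (z \in [set z0 : V * V | enorm (z0.1 - z0.2) <= rho]); last first.
    by rewrite !mul0r; case: ifP => _ //; rewrite lee_fin form_density_ge0.
  rewrite inE/= => zrho; rewrite mul1r.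
  have vN x : ~ N x -> v x = u x.
    by move=> xN; apply: contrapT => vx; apply: xN; apply: hN.
  have E : form_density s v v z = form_density s u u z.
    by rewrite /form_density !vN.
  case: ifPn => [_|zU]; first by rewrite E.
  have no : ~ (Omega z.1 \/ Omega z.2).
    move=> zO; move/negP: zU; apply; rewrite inE; split => /=.
      case: zO => zO; first by apply: OU; exact: subset_closure.
      by apply: (rhoU _ _ zO); rewrite enormB_sym.
    case: zO => zO; last by apply: OU; exact: subset_closure.
    exact: (rhoU _ _ zO).
  rewrite lee_fin /form_density v_out; last by move=> zO; apply: no; left.
  by rewrite v_out ?subrr ?mul0r// => zO; apply: no; right.
apply: (integ_ae gi); first exact: md.
have NC : {ae leb, forall x, ~ N x}.
  by exists N; split => // x /= /contrapT.
apply: filterS (ae_pair NC) => z [z1 z2].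
by rewrite /g !indicE !(mem_set (A := ~` N))// !mul1r.
Qed.

End weak_solutions.

(** * From multiples of the eigenfunction to signs at every point *)

Section signs.
Context {R : realType} {n : nat}.
Local Notation V := 'rV[R]_n.+1.
Local Notation leb := (lebesgue_rV n.+1 : {sigma_finite_measure set V -> \bar R}).
Variable Omega : set V.
Hypothesis oOmega : open Omega.
Variable w : V -> R.
Hypothesis w_pos : {ae leb, forall x, Omega x -> 0 < w x}.
Hypothesis w_loc : forall (x0 : V) (rho : R), 0 < rho ->
  cube x0 rho `<=` Omega -> exists2 r : R, 0 < r & exists2 c : R, 0 < c &
    {ae leb, forall x, enorm (x - x0) < r -> c <= w x}.

Lemma ae_cube (P : V -> Prop) (x0 : V) (r : R) : 0 < r ->
  {ae leb, forall x, P x} -> exists2 x, cube x0 r x & P x.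
Proof.
move=> r0 [N [mN N0 PN]]; apply: contrapT => h.
have : (leb (cube x0 r) <= leb N)%E.
  apply: le_measure; rewrite ?inE//; first exact: measurable_cube.
  by move=> x xr; apply: PN => Px; apply: h; exists x.
rewrite N0 lebesgue_rV_cube; last exact: ltW.
by rewrite lee_fin leNgt exprn_gt0// mulr_gt0.
Qed.

(** Near x0, u >= m c > 0 almost everywhere. If a continuous representative were at most 0 at x0, it
    would stay below m c on a small cube, which has positive measure. *)
Lemma positive_in_of_ge (u : V -> R) (m : R) : 0 < m ->
  {ae leb, forall x, m * w x <= u x} -> positive_in Omega u.
Proof.
move=> m0 mu; split.
  apply: filterS2 mu w_pos => x h wx xO; apply: lt_le_trans h.
  by rewrite mulr_gt0// wx.
move=> u' [cu' u'u] x0 x0O; rewrite ltNge; apply/negP => u'0.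
have [rho rho0 rhoO] := open_cube oOmega x0O.
have [r r0 [c c0 hc]] := w_loc rho0 rhoO.
have mc0 : 0 < m * c by rewrite mulr_gt0.
have clx0 : closure Omega x0 by exact: subset_closure.
have /subspace_continuousP/(_ _ clx0) cux0 := cu'.
have : \forall x \near within (closure Omega) (nbhs x0), u' x < m * c.
  by apply: (cvgr_lt _ cux0); exact: le_lt_trans mc0.
move=> /nbhs_ballP[e /= e0 he].
(* The cube of radius t fits in Omega, in the neighbourhood where u' < m c and in the ball where w
   >= c; [n.+2] makes (n+1) t < r strict. *)
pose t := Num.min rho (Num.min (e / 2) (r / n.+2%:R)).
have t0 : 0 < t by rewrite !lt_min rho0 !divr_gt0.
have [x xt [ux [uu' hx]]] := ae_cube x0 t0 (filterI mu (filterI u'u hc)).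
have xO : Omega x.
  by apply: rhoO => j; apply: le_trans (xt j) _; rewrite ge_min lexx.
have : u' x < m * c.
  apply: he; last exact: subset_closure.
  rewrite -ball_normE /=.
  apply: (@le_lt_trans _ _ (e / 2)); last by rewrite ltr_pdivrMr// ltr_pMr// ltr1n.
  apply: normr_rV_le; first by rewrite divr_ge0// ltW.
  move=> j; rewrite !mxE distrC; apply: le_trans (xt j) _.
  by rewrite !ge_min lexx orbT.
rewrite uu'// ltNge => /negP; apply; apply: le_trans ux.
rewrite ler_pM2l//; apply: hx.
apply: (@le_lt_trans _ _ (n.+1%:R * (r / n.+2%:R))).
  apply: enorm_le_coord => j; rewrite !mxE; apply: le_trans (xt j) _.
  by rewrite !ge_min lexx !orbT.
by rewrite mulrCA gtr_pMr// ltr_pdivrMr ?ltr0n// mul1r ltr_nat.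
Qed.

Lemma negative_in_of_le (u : V -> R) (m : R) : 0 < m ->
  {ae leb, forall x, u x <= - (m * w x)} -> negative_in Omega u.
Proof.
move=> m0 mu.
have [] : positive_in Omega (fun x => - u x).
  by apply: (positive_in_of_ge m0); apply: filterS mu => x; rewrite lerNr.
move=> h1 h2; split.
  by apply: filterS h1 => x h /h; rewrite oppr_gt0.
move=> u' [cu' u'u] x xO; rewrite -oppr_gt0.
apply: (h2 (fun x => - u' x)) => //; split.
  by move=> y; apply: cvgN; exact: cu'.
by apply: filterS u'u => y h /h ->.
Qed.

End signs.

(** * A bounded nonnegative representative of the eigenfunction *)

Section normalized_eigenfunction.
Context {R : realType} {n : nat} (s : R).
Hypothesis hs0 : 0 < s.
Local Notation V := 'rV[R]_n.+1.
Variable leb : {sigma_finite_measure set V -> \bar R}.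
Hypothesis leb_cube : forall (x : V) (r : R), 0 <= r ->
  leb (cube x r) = ((2 * r) ^+ n.+1)%:E.
Variables (Omega : set V) (D K : R).
Hypothesis D0 : 0 < D.
Hypothesis OmegaD : Omega `<=` cube 0 D.
Hypothesis K0 : 0 < K.

(* Truncating changes the eigenfunction on a null set only, since it is
   essentially bounded. *)
Lemma bounded_eigenfunction (w1 : V -> R) (lam1 : R) :
  test_space s leb Omega w1 -> ~ {ae leb, forall x, w1 x = 0} ->
  (forall phi, test_space s leb Omega phi ->
    K * form s leb w1 phi = lam1 * \int[leb]_x (w1 x * phi x)) ->
  {ae leb, forall x, Omega x -> 0 < w1 x} ->
  exists (w : V -> R) (Mw : R),
    [/\ test_space s leb Omega w, forall x, 0 <= w x <= Mw, 0 < Mw,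
        {ae leb, forall x, w x = w1 x} & 0 < \int[leb]_x (w x ^+ 2)] /\
    0 <= lam1 /\ forall phi, test_space s leb Omega phi ->
      K * form s leb w phi = lam1 * \int[leb]_x (w x * phi x).
Proof.
move=> hw1 w1n0 eig1 w1_pos; have [mw1 w1_out w12 gw1] := hw1.
have [Mw Mw0 hMw] : exists2 Mu : R, 0 < Mu & {ae leb, forall x, `|w1 x| <= Mu}.
  apply: (bounded_rhs_bounded hs0 leb_cube D0 OmegaD K0 (lam := lam1) (lexx 0) hw1).
  by move=> phi hphi; rewrite eig1// subrr normr0 mul0r.
pose w x := Num.min (Num.max (w1 x) 0) Mw.
have mw : measurable_fun setT w.
  by apply: measurable_minr => //; exact: measurable_maxr.
have ww1 : {ae leb, forall x, w x = w1 x}.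
  apply: filterS2 w1_pos hMw => x wx wM; rewrite /w.
  have [xO|xO] := pselect (Omega x).
    rewrite max_l; last by rewrite ltW// wx.
    by rewrite min_l// (le_trans (ler_norm _)).
  by rewrite w1_out// maxxx min_l// ltW.
have hw : test_space s leb Omega w.
  apply: (test_space_ae hw1 mw) ww1 => x xO.
  by rewrite /w w1_out// maxxx min_l// ltW.
have [_ _ w2 _] := hw.
have W0 : 0 < \int[leb]_x (w x ^+ 2).
  rewrite lt_neqAle Rintegral_ge0 ?andbT; last by move=> x _; exact: sqr_ge0.
  apply/negP => /eqP W; apply: w1n0.
  have : {ae leb, forall x, w x ^+ 2 = 0}.
    by apply: Rintegral_le0_ae => //; [move=> x; exact: sqr_ge0|rewrite -W].
  by apply: filterS2 ww1 => x <- /eqP; rewrite sqrf_eq0 => /eqP.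
have eig phi : test_space s leb Omega phi ->
    K * form s leb w phi = lam1 * \int[leb]_x (w x * phi x).
  move=> hphi; have [mphi _ _ _] := hphi.
  rewrite (form_ae s mw1 mw mphi ww1) eig1//; congr (_ * _).
  apply: ae_eq_Rintegral; try exact: measurable_funM.
  by apply: filterS ww1 => x ->.
exists w, Mw; split; first split => //.
  by move=> x; rewrite /w le_min ge_min le_max !lexx (ltW Mw0) !orbT.
split; last exact: eig.
(* Testing the eigenvalue equation with w itself shows lam1 >= 0. *)
rewrite -(pmulr_lge0 _ W0).
have -> : \int[leb]_x (w x ^+ 2) = \int[leb]_x (w x * w x).
  by apply: eq_Rintegral => x _; rewrite expr2.
rewrite -eig// mulr_ge0//; first exact: ltW.
by apply: Rintegral_ge0 => z _; exact: form_density_ge0.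
Qed.

End normalized_eigenfunction.

Section weak_equation.
Context {R : realType} {n : nat} (s : R).
Local Notation V := 'rV[R]_n.+1.
Local Notation leb := (lebesgue_rV n.+1 : {sigma_finite_measure set V -> \bar R}).
Variables (Omega : set V) (e : V).

Lemma Rintegral_test (g g' phi : V -> R) :
  measurable_fun setT (g \_ Omega) -> measurable_fun setT g' ->
  {ae leb, forall x, g' x = (g \_ Omega) x} -> test_space s leb Omega phi ->
  \int[leb]_(x in Omega) (g x * phi x) = \int[leb]_x (g' x * phi x).
Proof.
move=> mg mg' gg' [mphi phi_out _ _].
rewrite Rintegral_outside0; last by move=> x xO; rewrite phi_out// mulr0.
have -> : \int[leb]_x (g x * phi x) = \int[leb]_x ((g \_ Omega) x * phi x).
  apply: eq_Rintegral => x _; rewrite patchE; case: ifPn => // /negP xO.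
  by rewrite phi_out ?mulr0// => h; apply: xO; rewrite inE.
apply: ae_eq_Rintegral; try exact: measurable_funM.
by apply: filterS gg' => x ->.
Qed.

Lemma weak_solution_test_space (lam : R) (f f' u u' : V -> R) :
  weak_solution s e Omega lam f u -> measurable_fun setT u ->
  measurable_fun setT (f \_ Omega) -> measurable_fun setT f' ->
  {ae leb, forall x, f' x = (f \_ Omega) x} ->
  test_space s leb Omega u' -> {ae leb, forall x, u' x = u x} ->
  forall phi, test_space s leb Omega phi ->
    Kconst s e * form s leb u' phi =
    lam * \int[leb]_x (u' x * phi x) + \int[leb]_x (f' x * phi x).
Proof.
move=> [_ _ wk] mu mf mf' ff' [mu' u'_out u'2 gu'] u'u phi hphi.
have [mphi phi_out _ _] := hphi.
rewrite (form_ae s mu mu' mphi u'u).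
have := wk phi; rewrite /energy => -> //; last by apply/Ws2_tildeP.
rewrite (Rintegral_test mf mf' ff' hphi); congr (_ * _ + _).
rewrite Rintegral_outside0; last by move=> x xO; rewrite phi_out// mulr0.
apply: ae_eq_Rintegral; try exact: measurable_funM.
by apply: filterS u'u => x ->.
Qed.

End weak_equation.

(** The amplitude t = c / (d W) of w has the sign of c d, and |t| > C by the bound on d. *)
Lemma resonant_amplitude_sign (R : realType) (c C W d : R) : 0 < C -> 0 < W ->
  d != 0 -> `|d| < `|c| / (C * W) ->
  (0 < c * d -> C < c / (d * W)) /\ (c * d < 0 -> c / (d * W) < - C).
Proof.
move=> C0 W0 d0 h; have CW0 : 0 < C * W by rewrite mulr_gt0.
have d20 : 0 < d ^+ 2 by rewrite exprn_even_gt0.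
have cdW : c / (d * W) = c * d / d ^+ 2 / W.
  by field; rewrite d0 gt_eqF.
have h' : C * W < `|c * d / d ^+ 2|.
  rewrite (_ : c * d / d ^+ 2 = c / d); last by field.
  move: h; rewrite ltr_pdivlMr// => h.
  by rewrite normf_div ltr_pdivlMr ?normr_gt0// mulrC.
rewrite cdW; split=> cd.
  by rewrite ltr_pdivlMr// (lt_le_trans h')// ger0_norm ?lexx// divr_ge0// ltW.
rewrite ltr_pdivrMr// mulNr ltrNr (lt_le_trans h')// ltr0_norm ?lexx//.
by rewrite pmulr_llt0 ?invr_gt0.
Qed.

Theorem theorem1p4 (R : realType) (n : nat) (s : R) (hs0 : 0 < s) (hs1 : s < 1)
    (e : 'rV[R]_n.+1) (he : enorm e = 1)
    (Omega : set 'rV[R]_n.+1)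
    (hOmega : bounded_domain Omega) (hC11 : C11_boundary Omega)
    (w1 : 'rV[R]_n.+1 -> R)
    (hw1 : first_eigenfunction s e Omega w1)
    (hw1_pos : {ae lebesgue_rV n.+1, forall x, Omega x -> 0 < w1 x})
    (f : 'rV[R]_n.+1 -> R) (hf : Linfty Omega f)
    (hfw1 : \int[lebesgue_rV n.+1]_(x in Omega) (f x * w1 x) <> 0) :
  exists delta : R, 0 < delta /\
    (0 < \int[lebesgue_rV n.+1]_(x in Omega) (f x * w1 x) ->
     forall (lambda : R) (u : 'rV[R]_n.+1 -> R),
       weak_solution s e Omega lambda f u ->
       (lambda1 s e Omega < lambda < lambda1 s e Omega + delta ->
          negative_in Omega u) /\
       (lambda1 s e Omega - delta < lambda < lambda1 s e Omega ->
          positive_in Omega u)) /\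
    (\int[lebesgue_rV n.+1]_(x in Omega) (f x * w1 x) < 0 ->
     forall (lambda : R) (u : 'rV[R]_n.+1 -> R),
       weak_solution s e Omega lambda f u ->
       (lambda1 s e Omega < lambda < lambda1 s e Omega + delta ->
          positive_in Omega u) /\
       (lambda1 s e Omega - delta < lambda < lambda1 s e Omega ->
          negative_in Omega u)).
Proof.
have [oO _ _ bO] := hOmega.
have [D D0 OD] := bounded_cube bO.
have K0 : 0 < Kconst s e := Kconst_gt0 he hs1.
have [/Ws2_tildeP hw1' w1n0 weig] := hw1.
have [mw1 w1_out w12 gw1] := hw1'.
set lam1 := lambda1 s e Omega.
have la := @lebesgue_rV_addr R n.+1.
have lc := @lebesgue_rV_cube R n.+1.
set leb := (lebesgue_rV n.+1 : {sigma_finite_measure set _ -> \bar R}).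
have eig1 phi : test_space s leb Omega phi ->
    Kconst s e * form s leb w1 phi = lam1 * \int[leb]_x (w1 x * phi x).
  move=> hphi; have [mphi phi_out _ _] := hphi.
  have /weig : Ws2_tilde s Omega phi by apply/Ws2_tildeP.
  rewrite /energy => ->; congr (_ * _).
  by rewrite Rintegral_outside0// => x xO; rewrite phi_out// mulr0.
have [w [Mw [[hw wM Mw0 ww1 W0] [lam10 eig]]]] :=
  bounded_eigenfunction hs0 lc D0 OD K0 hw1' w1n0 eig1 hw1_pos.
have w0 x : 0 <= w x by have /andP[] := wM x.
have wM' x : w x <= Mw by have /andP[] := wM x.
have w_pos : {ae leb, forall x, Omega x -> 0 < w x}.
  by apply: filterS2 ww1 hw1_pos => x ->.
have ikw := eigen_integ_kern_weight la D0 OD hw W0.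
have w_loc := eigen_locally_ge hs0 la lc D0 OD K0 hw w0 lam10 eig W0.
have [mf [Mf Mf0 fM]] := Lfun_oo_bounded hf.
(* A representative of f on Omega, extended by 0, that is bounded at every point. *)
pose f' x := Num.max (- Mf) (Num.min ((f \_ Omega) x) Mf).
have mf' : measurable_fun setT f'.
  by apply: measurable_maxr => //; exact: measurable_minr.
have f'M x : `|f' x| <= Mf.
  have l : - Mf <= Mf by rewrite ge0_cp.
  by rewrite ler_norml le_max lexx/= ge_max l ge_min lexx orbT.
have ff' : {ae leb, forall x, f' x = (f \_ Omega) x}.
  apply: filterS fM => x; rewrite ler_norml => /andP[a b].
  by rewrite /f' min_l// max_r.
have cE : \int[leb]_(x in Omega) (f x * w1 x) = \int[leb]_x (f' x * w x).
  rewrite (Rintegral_test mf mf' ff' hw1'); apply: ae_eq_Rintegral.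
  - exact: measurable_funM.
  - by have [mw _ _ _] := hw; exact: measurable_funM.
  - by apply: filterS ww1 => x ->.
have [C [del [C0 del0 hdec]]] := resonant_decomposition hs0 lc D0 OD K0
  hw w0 lam10 eig W0 Mw0 wM' w_pos Mf0 mf' f'M.
set c := \int[leb]_x (f' x * w x) in cE hdec.
set W := \int[leb]_x (w x ^+ 2) in W0 hdec.
have c0 : c != 0 by rewrite -cE; apply/eqP.
(* The second bound makes the amplitude of w exceed C. *)
pose delta := Num.min del (`|c| / (C * W)).
have delta0 : 0 < delta.
  by rewrite lt_min del0 divr_gt0 ?normr_gt0 ?mulr_gt0.
have key lam u : weak_solution s e Omega lam f u -> `|lam - lam1| < delta ->
    (0 < c * (lam1 - lam) -> positive_in Omega u) /\
    (c * (lam1 - lam) < 0 -> negative_in Omega u).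
  move=> wu; rewrite lt_min => /andP[ldel lcC].
  have [hu u_out _] := wu.
  have [[mu _] _ _] := hu.
  have [v hv vu] := Ws2_hat_test_space hw w_pos ikw hu u_out.
  have dec : lam1 - lam != 0 -> {ae leb, forall x,
      `|u x - c / ((lam1 - lam) * W) * w x| <= C * w x}.
    move=> ll; have lne : lam != lam1 by rewrite eq_sym -subr_eq0.
    have := hdec lam v ldel lne hv
      (weak_solution_test_space wu mu mf mf' ff' hv vu).
    by apply: filterS2 vu => x ->.
  have sgn ll := @resonant_amplitude_sign R c C W (lam1 - lam) C0 W0 ll.
  split=> cl; have ll : lam1 - lam != 0 by
    (apply/eqP => l0; move: cl; rewrite l0 mulr0 ltxx).
    have [/(_ cl) tC _] := sgn ll (eq_ind _ (fun a => a < _) lcC _ (distrC _ _)).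
    (* u >= t w - C w, and t - C is positive. *)
    apply: (positive_in_of_ge oO w_pos w_loc (m := c / ((lam1 - lam) * W) - C)).
      by rewrite subr_gt0.
    apply: filterS (dec ll) => x; rewrite ler_distl => /andP[h _].
    by rewrite mulrBl.
  have [_ /(_ cl) tC] := sgn ll (eq_ind _ (fun a => a < _) lcC _ (distrC _ _)).
  apply: (negative_in_of_le oO w_pos w_loc (m := - C - c / ((lam1 - lam) * W))).
    by rewrite subr_gt0.
  apply: filterS (dec ll) => x; rewrite ler_distl => /andP[_ h].
  by rewrite -mulNr opprB opprK mulrDl.
exists delta; split => //; rewrite cE.
have range lam : lam1 < lam < lam1 + delta -> `|lam - lam1| < delta /\ lam1 - lam < 0.
  move=> /andP[a b]; rewrite subr_lt0 a; split => //.
  by rewrite gtr0_norm ?subr_gt0// ltrBlDl.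
have range' lam : lam1 - delta < lam < lam1 -> `|lam - lam1| < delta /\ 0 < lam1 - lam.
  move=> /andP[a b]; rewrite subr_gt0 b; split => //.
  by rewrite ltr0_norm ?subr_lt0// opprB ltrBlDl -ltrBlDr.
split=> csgn lam u wu; split.
- by move=> /range[h1 h2]; have [_] := key lam u wu h1; apply; rewrite pmulr_rlt0.
- by move=> /range'[h1 h2]; have [+ _] := key lam u wu h1; apply; rewrite mulr_gt0.
- by move=> /range[h1 h2]; have [+ _] := key lam u wu h1; apply; rewrite nmulr_rgt0.
- by move=> /range'[h1 h2]; have [_] := key lam u wu h1; apply; rewrite nmulr_rlt0.
Qed.
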